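(* For any $\epsilon > 0$ and any integer $r \geq 3$, there exists a $5r$-pass insertion-only streaming algorithm which, given a graph $G$ with $n$ vertices, $m$ edges and degeneracy $\lambda$, computes a $(1+\epsilon)$-approximation to the number $\# K_r$ of $r$-cliques in $G$, succeeds with high probability, and has space complexity $$\frac{m\lambda^{r-2}}{\# K_r}\cdot \mathrm{poly}(\log n, \epsilon^{-1}, r^r).$$
   Context: Graphs are undirected. In the arbitrary-order insertion-only streaming model, the edges of the input graph $G$ on vertex set $[n]$ are given one by one in arbitrary (possibly adversarial) order; a $k$-pass algorithm may read the stream $k$ times. $K_r$ is the complete graph on $r$ vertices and $\#K_r$ the number of $r$-cliques in $G$ (the algorithm's complexity is parameterized by $\#K_r$, following common convention). The degeneracy of a graph is the smallest $\kappa\ge 0$ such that every subgraph has a vertex of degree at most $\kappa$. ''With high probability'' means with probability at least $1-n^{-C}$ for some constant $C>0$. A $(1+\epsilon)$-approximation of $\#K_r$ is a value in $[(1-\epsilon)\#K_r,(1+\epsilon)\#K_r]$. *)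

(* Defs.v *)
From mathcomp Require Import all_boot all_order all_algebra.
From mathcomp Require Import reals.

Set Implicit Arguments.
Unset Strict Implicit.
Unset Printing Implicit Defensive.

Import Order.TTheory GRing.Theory Num.Theory.

(* A simple undirected graph on the vertex set [n]; an edge is a 2-element set
   of vertices. *)
Record graph (n : nat) := Graph {
  edges : {set {set 'I_n}};
  card_edge : forall e, e \in edges -> #|e| = 2 }.

Definition is_clique (n : nat) (G : graph n) (K : {set 'I_n}) : bool :=
  [forall x in K, forall y in K, (x != y) ==> ([set x; y] \in edges G)].

Definition num_cliques (n : nat) (G : graph n) (r : nat) : nat :=
  #|[set K : {set 'I_n} | (#|K| == r) && is_clique G K]|.

Definition deg (n : nat) (F : {set {set 'I_n}}) (v : 'I_n) : nat :=
  #|[set f in F | v \in f]|.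

(* (W, F) is a (not necessarily induced) subgraph of G with a vertex. *)
Definition is_subgraph (n : nat) (G : graph n)
    (W : {set 'I_n}) (F : {set {set 'I_n}}) : bool :=
  [&& W != set0, F \subset edges G & [forall f in F, f \subset W]].

Definition degenerate (n : nat) (G : graph n) (k : nat) : bool :=
  [forall W, forall F, is_subgraph G W F ==> [exists v in W, deg F v <= k]].

Lemma degenerate_ex (n : nat) (G : graph n) : exists k, degenerate G k.
Proof.
exists #|edges G|; apply/forallP => W; apply/forallP => F.
apply/implyP => /and3P [/set0Pn [v vW] sFG _].
apply/existsP; exists v; rewrite vW /=.
apply: leq_trans (subset_leq_card sFG); apply: subset_leq_card.
by apply/subsetP => f; rewrite inE => /andP [].
Qed.

Definition degeneracy (n : nat) (G : graph n) : nat :=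
  ex_minn (degenerate_ex G).

(* A stream of G: every edge occurs exactly once, in an arbitrary order. *)
Definition streams (n : nat) (s : seq {set 'I_n}) (G : graph n) : bool :=
  perm_eq s (enum (edges G)).

(* A randomized streaming algorithm on graphs with vertex set [n].  All it
   keeps between two symbols is a bit string, its memory.  A symbol is either
   an edge or the end-of-pass mark [None]; when reading one, the algorithm
   also draws a fresh uniform element of 'I_(coins.+1), which it can use later
   only by storing it. *)
Record stream_alg (R : Type) (n : nat) := StreamAlg {
  coins : nat;
  init : seq bool;
  step : seq bool -> option {set 'I_n} -> 'I_coins.+1 -> seq bool;
  out : seq bool -> R }.

(* What a [k]-pass algorithm reads, pass after pass. *)
Definition tape (n k : nat) (s : seq {set 'I_n}) : seq (option {set 'I_n}) :=
  flatten (nseq k (rcons (map some s) None)).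

(* The sequence of draws made while reading the tape. *)
Definition draws (R : Type) (n : nat) (A : stream_alg R n) (k : nat)
    (s : seq {set 'I_n}) : finType :=
  (size (tape k s)).-tuple 'I_(coins A).+1.

(* The memory contents after the first symbol, the second symbol, etc. *)
Definition memories (R : Type) (n : nat) (A : stream_alg R n) (k : nat)
    (s : seq {set 'I_n}) (w : draws A k s) : seq (seq bool) :=
  scanl (fun M p => step M p.1 p.2) (init A) (zip (tape k s) w).

Definition output (R : Type) (n : nat) (A : stream_alg R n) (k : nat)
    (s : seq {set 'I_n}) (w : draws A k s) : R :=
  out A (last (init A) (memories w)).

(* Worst-case number of memory bits, over all random draws and all times. *)
Definition space_bits (R : Type) (n : nat) (A : stream_alg R n) (k : nat)
    (s : seq {set 'I_n}) : nat :=
  \max_(w : draws A k s) \max_(M <- init A :: memories w) size M.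

Local Open Scope ring_scope.

Definition approx (R : realType) (eps : R) (N : nat) (x : R) : bool :=
  (1 - eps) * N%:R <= x <= (1 + eps) * N%:R.

Definition success_prob (R : realType) (n : nat) (A : stream_alg R n) (k : nat)
    (s : seq {set 'I_n}) (good : pred R) : R :=
  #|[set w : draws A k s | good (output w)]|%:R / #|draws A k s|%:R.

(* Main.v *)
(* A clique is explored as a chain of vertices: a chain is extended by the
   neighbours of its vertex of least degree. The edge starting a chain is kept
   with probability 2^-g, every later vertex with probability 1/lambda, so that
   a chain of r vertices survives with probability 1/(2^g lambda^(r-2)), and the
   number of surviving chains, divided by this probability, is an unbiased
   estimate; about m/2^g chains are ever stored.

   Its variance is too large when many cliques extend one prefix. A prefix c is
   therefore tested: chains are grown from c with the same rates in further
   independent runs, and c is active when a majority of them find few chains.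
   A clique is counted through one fixed order all of whose proper prefixes are
   active, which bounds the variance by the extensions of active prefixes.
   Only few cliques have no such order: in a degeneracy order at most
   lambda^(r-t) cliques start with a given prefix of t vertices, so the cliques
   whose degeneracy order has a prefix with many more extensions than that are,
   by double counting, a small fraction of all cliques.

   All guesses 2^g run in parallel, each in several copies; the output is the
   value around which most copies agree for the smallest guess that has one.
   Each round of extensions costs one pass for sampling and one for checking
   adjacencies and counting degrees, hence 1 + 2r passes for sampling, and 2r
   more for the tests. *)
Require Import Defs.
From mathcomp Require Import all_boot all_order all_algebra.
From mathcomp Require Import ring lra zify.
From mathcomp Require Import reals sequences exp.
From mathcomp Require mpoly.

Set Implicit Arguments.
Unset Strict Implicit.
Unset Printing Implicit Defensive.

Import Order.TTheory GRing.Theory Num.Theory.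

(** The clique count is known only through a lower bound [T], so the guesses start at the densest
    rate that the space bound for [T] affords. Every guess whose weight is small against the true
    count is accurate unless its runs overflow, and an overflow casts no vote. So the smallest guess
    with a majority value is not misled, and the largest admissible guess ensures that one exists.
    Whether a prefix is active is itself random, and bounding the variance of its test requires
    bounds on the extensions of longer prefixes. The argument therefore descends from long prefixes
    to short ones: once the coins of all other tests are frozen, the extensions through active
    longer prefixes form a fixed set with controlled multiplicities, and Chebyshev's inequality
    applies to the coins of the test alone. The thresholds grow geometrically towards short prefixes
    to absorb the sum over all longer ones. Memory cannot hold one coin per chain. The analysis has
    independent coins for all pairs of a run and a chain; the machine draws a whole family of coins
    at each symbol and uses only those of the chains closed by the edge just read. *)

Lemma sum_deg n (F : {set {set 'I_n}}) : (forall e, e \in F -> #|e| = 2) ->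
  \sum_v deg F v = 2 * #|F|.
Proof.
move=> F2; rewrite mulnC -sum_nat_const -(eq_bigr _ F2).
rewrite [RHS](eq_bigr (fun e : {set 'I_n} => \sum_v (v \in e : nat))); last first.
  by move=> e _; rewrite -sum1_card big_mkcond; apply: eq_bigr => v _; case: (v \in e).
rewrite exchange_big /=; apply: eq_bigr => v _.
rewrite /deg -sum1_card (eq_bigl (fun e => (e \in F) && (v \in e))); last first.
  by move=> e; rewrite inE.
by rewrite big_mkcondr; apply: eq_bigr => e _; case: (v \in e).
Qed.

Lemma set2_inj (T : finType) (v : T) : injective (fun w => [set v; w]).
Proof.
move=> w w' e; have := set22 v w; rewrite e => /set2P[wv|//].
by have := set22 v w'; rewrite -e wv => /set2P[].
Qed.

(** * Cliques and degeneracy orders *)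

Section Cliques.
Variables (n : nat) (G : graph n).
Implicit Types (v w : 'I_n) (x y z : seq 'I_n) (K : {set 'I_n}).

Definition adj v w := [set v; w] \in edges G.
Definition nb v := [set w | adj v w].
Definition cl x := pairwise adj x.

Lemma adjC v w : adj v w = adj w v.
Proof. by rewrite /adj setUC. Qed.

Lemma adjvv v : adj v v = false.
Proof. by apply/negP => /card_edge; rewrite setUid cards1. Qed.

Lemma deg_nb v : deg (edges G) v = #|nb v|.
Proof.
rewrite -(card_imset (mem (nb v)) (@set2_inj _ v)); apply: eq_card => e.
rewrite inE; apply/andP/imsetP => [[eE ve]|[w + ->]]; last first.
  by rewrite inE => vw; rewrite set21.
have /eqP/cards2P[a [b [ab eab]]] := card_edge eE; move: ve eE; rewrite eab.
case/set2P=> -> abE; [exists b | exists a; last exact: setUC] => //.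
  by rewrite !inE /adj.
by rewrite !inE /adj setUC.
Qed.

Lemma sum_nb : \sum_v #|nb v| = 2 * #|edges G|.
Proof.
rewrite -sum_deg; last exact: card_edge.
by apply: eq_bigr => v _; rewrite deg_nb.
Qed.

Lemma cl_uniq x : cl x -> uniq x.
Proof.
elim: x => //= v x IHx /andP[/allP vx /IHx ->]; rewrite andbT.
by apply/negP => /vx; rewrite adjvv.
Qed.

Lemma cl_take j x : cl x -> cl (take j x).
Proof. by rewrite -{1}(cat_take_drop j x) /cl pairwise_cat => /and3P[]. Qed.

Lemma cl_is_clique x : cl x -> is_clique G [set v in x].
Proof.
move=> xcl; apply/forall_inP => v; rewrite inE => vx.
apply/forall_inP => w; rewrite inE => wx; apply/implyP => vw.
rewrite -/(adj v w); elim: x xcl vx wx => //= u x IHx /andP[/allP ux xcl].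
rewrite !inE => /predU1P[vu|vx] /predU1P[wu|wx].
- by rewrite vu wu eqxx in vw.
- by rewrite vu; apply: ux.
- by rewrite adjC wu; apply: ux.
- exact: IHx.
Qed.

Lemma is_clique_cl K x : is_clique G K -> uniq x -> {subset x <= K} -> cl x.
Proof.
move=> Kcl; elim: x => //= v x IHx /andP[vx ux] xK.
rewrite IHx ?andbT // => [|w wx]; last by rewrite xK // inE wx orbT.
apply/allP => w wx; have vK := xK v (mem_head _ _).
have wK : w \in K by rewrite xK // inE wx orbT.
have /forall_inP/(_ w wK)/implyP := forall_inP Kcl v vK; apply.
by apply: contraNneq vx => ->.
Qed.

(** A vertex of small degree in the subgraph induced by [K] goes first, where all its neighbours in
    [K] come later; induction orders the remaining vertices. *)
Lemma degeneracy_order_in K : exists z,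
  [/\ uniq z, z =i K & forall v, v \in K ->
     #|[set w in K | adj v w && (index v z < index w z)]| <= degeneracy G].
Proof.
move: {2}#|K| (leqnn #|K|) => k; elim: k K => [|k IHk] K.
  rewrite leqn0 cards_eq0 => /eqP ->; exists [::]; split=> // v; by rewrite inE.
move=> Kk; have [->|K0] := eqVneq K set0.
  by exists [::]; split=> // v; rewrite inE.
pose F := [set e in edges G | e \subset K].
have [v vK degv] : exists2 v, v \in K & deg F v <= degeneracy G.
  have sub : is_subgraph G K F.
    rewrite /is_subgraph K0 /=; apply/andP; split.
      by apply/subsetP => e; rewrite inE => /andP[].
    by apply/forall_inP => e; rewrite inE => /andP[].
  have : degenerate G (degeneracy G) by rewrite /degeneracy; case: ex_minnP.
  move=> /forallP/(_ K)/forallP/(_ F)/implyP/(_ sub)/existsP[v /andP[vK dv]].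
  by exists v.
have [|z [uz zK zd]] := IHk (K :\ v).
  by move: Kk; rewrite (cardsD1 v K) vK.
have vz : v \notin z by rewrite zK !inE eqxx.
exists (v :: z); split=> [||u uK]; first by rewrite /= vz.
  by move=> u; rewrite inE zK !inE; case: eqVneq => // ->.
have [->|uv] := eqVneq u v.
  apply: leq_trans degv; rewrite -(card_imset _ (@set2_inj _ v)).
  apply: subset_leq_card; apply/subsetP => _ /imsetP[w + ->].
  rewrite inE => /and3P[wK vw _]; rewrite 2!inE set21 andbT [_ \in _]vw /=.
  by apply/subsetP => t /set2P[] ->.
have /zd ud : u \in K :\ v by rewrite !inE uv.
apply: leq_trans ud; apply: subset_leq_card; apply/subsetP => w.
rewrite !inE /= [v == u]eq_sym (negbTE uv) => /and3P[-> ->].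
by rewrite [v == w]eq_sym; case: eqVneq => //= _; rewrite ltnS.
Qed.

Lemma pairwise_index z : uniq z -> pairwise (fun v w => index v z < index w z) z.
Proof.
case: z => // v z uz; apply/(pairwiseP v) => i j.
by rewrite !inE => iz jz ij; rewrite !index_uniq.
Qed.

(** Edges are oriented along one degeneracy order of all vertices, and a clique is listed in that
    order. Later bounds in terms of the degeneracy come from this orientation. *)
Lemma degeneracy_orientation : exists out : 'I_n -> {set 'I_n},
  (forall v, #|out v| <= degeneracy G) /\
  (forall K, is_clique G K -> exists z,
     [/\ uniq z, z =i K & pairwise (fun v w => w \in out v) z]).
Proof.
have [z [uz zT zd]] := degeneracy_order_in setT.
exists (fun v => [set w | adj v w && (index v z < index w z)]); split=> [v|K Kcl].
  apply: leq_trans (zd v (in_setT _)); apply: subset_leq_card.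
  by apply/subsetP => w; rewrite !inE.
exists [seq v <- z | v \in K].
have uf : uniq [seq v <- z | v \in K] by rewrite filter_uniq.
have fK : [seq v <- z | v \in K] =i K by move=> v; rewrite mem_filter zT inE andbT.
split=> //.
have fcl : cl [seq v <- z | v \in K].
  by apply: (is_clique_cl Kcl) => // v; rewrite fK.
have := pairwise_filter (mem K) (pairwise_index uz) => /= fz.
have : pairwise [rel v w | adj v w && (index v z < index w z)]
    [seq v <- z | v \in K] by rewrite pairwise_relI; apply/andP.
by apply: sub_pairwise => v w /=; rewrite inE.
Qed.

End Cliques.

(** * Counting chains of vertices *)

Lemma card_fibers (T U : finType) (f : T -> U) (S : {set T}) :
  #|S| = \sum_c #|[set y in S | f y == c]|.
Proof.
rewrite -sum1_card (partition_big f xpredT) //=; apply: eq_bigr => c _.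
by rewrite -sum1_card; apply: eq_bigl => y; rewrite inE.
Qed.

Lemma leq_card_fibers (T U : finType) (f : T -> U) (S : {set T}) (S' : {set U}) d :
  (forall y, y \in S -> f y \in S') ->
  (forall c, c \in S' -> #|[set y in S | f y == c]| <= d) -> #|S| <= #|S'| * d.
Proof.
move=> fS fd; rewrite (card_fibers f) (bigID (mem S')) /= [X in _ + X]big1.
  by rewrite addn0 -sum_nat_const; apply: leq_sum.
move=> c cS; apply/eqP; rewrite cards_eq0; apply/set0Pn => -[y].
by rewrite inE => /andP[/fS + /eqP e]; rewrite e (negbTE cS).
Qed.

Lemma prod_tail l t p : \prod_(i < p) (if i < t then 1 else l) = l ^ (p - t).
Proof.
elim: p => [|p IHp]; first by rewrite big_ord0.
rewrite big_ord_recr /= IHp; case: ltnP => [pt|tp].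
  by rewrite muln1 !(eqP (_ : _ <= _)) ?(ltnW pt).
by rewrite subSn // expnSr.
Qed.

Section Chains.
Variables (n r : nat).
Notation Ch := (r.-bseq 'I_n).
Implicit Types (x y z c : Ch) (v w : 'I_n).

Definition pre (j : nat) (y : Ch) : Ch := take_bseq j y.

Lemma val_pre j y : pre j y = take j y :> seq _.
Proof. by []. Qed.

Lemma card_chains (x0 : 'I_n) (A : nat -> {set 'I_n}) p :
  #|[set y : Ch | (size y == p) && [forall i : 'I_p, nth x0 y i \in A i]]|
    <= \prod_(i < p) #|A i|.
Proof.
set S := [set y | _].
pose f y : {ffun 'I_p -> 'I_n} := [ffun i : 'I_p => nth x0 y i].
rewrite -(@card_in_imset _ _ f S) => [|y z]; last first.
  rewrite !inE => /andP[/eqP yp _] /andP[/eqP zp _] /ffunP e.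
  apply: val_inj => /=; apply: (@eq_from_nth _ x0) => [|i]; first by rewrite yp.
  by rewrite yp => ip; have := e (Ordinal ip); rewrite !ffunE.
apply: leq_trans (subset_leq_card (_ : _ \subset family (fun i : 'I_p => mem (A i)))) _.
  apply/subsetP => _ /imsetP[y + ->]; rewrite inE => /andP[_ /forallP yA].
  by apply/familyP => i; rewrite ffunE; apply: yA.
by rewrite card_family foldrE big_map big_enum.
Qed.

(** Stated for any weighting of positions, so that the same choice with the same tie-breaking is
    made from true degrees and from the counters kept in memory. *)
Definition argmin_vertex (x : seq 'I_n) (d : 'I_r -> nat) : option 'I_n :=
  obind (fun k : 'I_r => onth x k)
    [pick k : 'I_r | (k < size x) && [forall l : 'I_r, (l < size x) ==> (d k <= d l)]].

Definition touches (x : seq 'I_n) (k : nat) (e : {set 'I_n}) : bool :=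
  if onth x k is Some v then v \in e else false.

Definition pos_deg (P : {set {set 'I_n}}) (x : seq 'I_n) (k : 'I_r) : nat :=
  #|[set e in P | touches x k e]|.

Lemma onth_lt (T : Type) (x0 : T) (x : seq T) k :
  k < size x -> onth x k = Some (nth x0 x k).
Proof. by move=> kx; rewrite onthE (nth_map x0). Qed.

Lemma pos_degE P x v (k : 'I_r) : k < size x -> pos_deg P x k = deg P (nth v x k).
Proof.
by move=> kx; apply: eq_card => e; rewrite !inE /touches (onth_lt v).
Qed.

Section Graph.
Variable G : graph n.
Notation lam := (degeneracy G).
Notation m := #|edges G|.

Definition min_vertex x : option 'I_n := argmin_vertex x (pos_deg (edges G) x).

Lemma min_vertexP x : x != [::] :> seq _ ->
  exists v, [/\ min_vertex x = Some v, v \in x &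
                forall w, w \in x -> #|nb G v| <= #|nb G w|].
Proof.
move=> x0; have [v0 _] : exists v, v \in (x : seq _).
  by case: (x : seq _) x0 => // v ? _; exists v; rewrite mem_head.
have xr : 0 < size x by rewrite lt0n size_eq0.
have r0 : 0 < r by apply: leq_trans xr (size_bseq x).
rewrite /min_vertex /argmin_vertex; case: pickP => [k /andP[kx /forallP kmin]|none].
  exists (nth v0 x k); rewrite /= (onth_lt v0) // mem_nth //; split=> // w wx.
  have wr : index w x < r by rewrite (leq_trans _ (size_bseq x)) ?index_mem.
  have := kmin (Ordinal wr); rewrite /= index_mem wx /=.
  by rewrite !(pos_degE _ v0) ?index_mem //= nth_index // !deg_nb.
have [k kx kmin] := @arg_minnP _ (Ordinal r0) (fun k : 'I_r => k < size x)
  (pos_deg (edges G) x) xr.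
have := none k; rewrite kx /= => /forallP[] l; apply/implyP; exact: kmin.
Qed.

(** The edge whose arrival in a sampling pass completes the chain; adjacency of the last vertex to
    the other vertices is checked one pass later. *)
Definition last_edge y : {set 'I_n} :=
  let x := pre (size y).-1 y in
  if min_vertex x is Some v then [set v; last v y] else set0.

Lemma last_edge_rcons x y w : x != [::] :> seq _ -> y = rcons x w :> seq _ ->
  exists v, [/\ last_edge y = [set v; w], min_vertex x = Some v, v \in x &
    forall u, u \in x -> #|nb G v| <= #|nb G u|].
Proof.
move=> x0 yx; have [v [xv vx vmin]] := min_vertexP x0; exists v; split=> //.
rewrite /last_edge (_ : pre _ y = x) ?xv; last first.
  by apply: val_inj; rewrite /= yx size_rcons -cats1 take_size_cat.
by rewrite yx last_rcons.
Qed.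

Definition cliques_of_size p := [set x : Ch | (size x == p) && cl G x].

(* The chains that one extension step may produce before their last vertex is
   tested against the others. *)
Definition candidates p :=
  [set y : Ch | [&& size y == p, cl G (pre p.-1 y) & last_edge y \in edges G]].

Lemma candidates_fiber p x : 0 < p -> size x = p ->
  #|[set y in candidates p.+1 | pre p y == x]| <=
  (if min_vertex x is Some v then #|nb G v| else 0).
Proof.
move=> p0 xp.
have x0 : x != [::] :> seq _ by rewrite -size_eq0 xp -lt0n.
have [v [xv _ _]] := min_vertexP x0; rewrite xv.
rewrite -(@card_in_imset _ _ (fun y : Ch => last v y)) => [|y z]; last first.
  rewrite !inE => /andP[/and3P[/eqP yp _ _] /eqP yx] /andP[/and3P[/eqP zp _ _] /eqP zx] e.
  apply: val_inj; rewrite /= -(cat_take_drop p y) -(cat_take_drop p z).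
  rewrite -!val_pre yx zx; congr cat.
  have lastE (t : Ch) : size t = p.+1 -> drop p t = [:: last v t].
    move=> tp; rewrite (drop_nth v) ?tp // drop_oversize ?tp //.
    by rewrite (last_nth v) tp.
  by rewrite !lastE // e.
apply: subset_leq_card; apply/subsetP => _ /imsetP[y + ->].
rewrite !inE => /andP[/and3P[/eqP yp _ +] /eqP yx].
by rewrite /last_edge yp /= yx xv.
Qed.

Variable out : 'I_n -> {set 'I_n}.
Hypothesis out_lam : forall v, #|out v| <= lam.
Hypothesis out_order : forall K, is_clique G K -> exists z : seq 'I_n,
  [/\ uniq z, z =i K & pairwise (fun v w => w \in out v) z].
Notation ordered := (pairwise (fun v w => w \in out v)).

(** Let [u] be the first vertex of a clique prefix in the degeneracy order. The least degree in the
    prefix is at most that of [u], and the other vertices lie in [out u]. Choosing the position of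
    [u], then [u], then the others, bounds the count by a multiple of the sum of all degrees, which
    is [2 * m]. *)
Lemma card_candidates p : 1 < p ->
  #|candidates p| <= p.-1 * lam ^ (p - 2) * (2 * m).
Proof.
case: p => // q; rewrite ltnS /= => q0.
rewrite (card_fibers (pre q)).
apply: leq_trans (_ : \sum_(x in cliques_of_size q) \sum_(i < q) \sum_v
   (if (nth v x i == v) && [forall j : 'I_q, (j != i) ==> (nth v x j \in out v)]
    then #|nb G v| else 0) <= _).
  rewrite (bigID (mem (cliques_of_size q))) /= [X in _ + X]big1 ?addn0; last first.
    move=> x xq; apply/eqP; rewrite cards_eq0; apply/set0Pn => -[y].
    rewrite !inE => /andP[/and3P[/eqP yq ycl _] /eqP yx].
    by case/negP: xq; rewrite inE -yx ycl size_take yq ltnSn eqxx.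
  apply: leq_sum => x; rewrite inE => /andP[/eqP xq xcl].
  apply: leq_trans (candidates_fiber q0 xq) _.
  have x0 : x != [::] :> seq _ by rewrite -size_eq0 xq -lt0n.
  have [v [xv vx vmin]] := min_vertexP x0; rewrite xv.
  have [z [uz zx zo]] := out_order (cl_is_clique xcl).
  case: z uz zx zo => [|u z] uz zx zo; first by have := zx v; rewrite !inE vx.
  have ux : u \in x by have := zx u; rewrite !inE eqxx.
  have iq : index u x < q by rewrite -xq index_mem.
  apply: leq_trans (vmin u ux) _.
  rewrite (bigD1 (Ordinal iq)) //= (bigD1 u) //= nth_index // eqxx /=.
  case: ifP => [_|/negP[]]; first by rewrite -addnA leq_addr.
  apply/forallP => j; apply/implyP => ji.
  have jx : nth u x j \in x by rewrite mem_nth // xq.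
  have := zx (nth u x j); rewrite inE [in RHS]inE jx => /predU1P[ju|jz].
    case/negP: ji; apply/eqP/val_inj; rewrite /= -ju index_uniq ?xq //.
    exact: cl_uniq xcl.
  by case/andP: zo => /allP zo _; apply: zo.
rewrite exchange_big /=.
apply: leq_trans (_ : \sum_(i < q) lam ^ q.-1 * (2 * m) <= _); last first.
  by rewrite sum_nat_const card_ord mulnA subSS subn1.
apply: leq_sum => i _; rewrite exchange_big /= -sum_nb big_distrr /=.
apply: leq_sum => v _; rewrite -big_mkcondr /= sum_nat_const leq_mul2r.
apply/orP; right.
pose A (j : nat) := if j == i then [set v] else out v.
apply: leq_trans (_ : \prod_(j < q) #|A j| <= _).
  apply: leq_trans (card_chains v A q); apply: subset_leq_card.
  apply/subsetP => x; rewrite unfold_in [_ \in cliques_of_size q]inE inE /=.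
  case/and3P => /andP[-> _] /eqP xi /forallP xo /=.
  apply/forallP => j; rewrite /A; case: eqVneq => [->|ji].
    by rewrite xi inE.
  by apply: (implyP (xo j)).
rewrite (bigD1 i) //= /A eqxx cards1 mul1n.
apply: leq_trans (_ : \prod_(j < q | j != i) lam <= _).
  by apply: leq_prod => j ji; rewrite (negbTE (ji : nat_of_ord j != i)) out_lam.
by rewrite prod_nat_const cardC1 card_ord.
Qed.

(** The prefix [c] fixes the first vertex, and every later vertex of an ordered chain lies in the
    out-neighbourhood of that one vertex. *)
Lemma card_ordered_above c p : 0 < size c ->
  #|[set y : Ch | [&& size y == p, ordered y & take (size c) y == c]]| <=
  lam ^ (p - size c).
Proof.
move=> c0; have [v0 vE] : exists v, onth c 0 = Some v.
  by case: (bseqval c) c0 => // v s _; exists v.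
pose A (i : nat) := if i < size c then [set nth v0 c i] else out v0.
rewrite -prod_tail.
apply: leq_trans (_ : \prod_(i < p) #|A i| <= _); last first.
  by apply: leq_prod => i _; rewrite /A; case: ifP => _; rewrite ?cards1.
apply: leq_trans (card_chains v0 A p); apply: subset_leq_card.
apply/subsetP => y; rewrite !inE => /and3P[/eqP yp yo /eqP yc].
rewrite yp eqxx /=; apply/forallP => i; rewrite /A; case: ifP => ic.
  by rewrite inE -yc nth_take.
have iy : i < size y by rewrite yp.
have y0 : onth y 0 = Some v0.
  rewrite -vE (onth_lt v0 c0) (onth_lt v0 (leq_ltn_trans (leq0n _) iy)).
  by rewrite -[in RHS]yc nth_take.
case: (bseqval y) yo iy y0 => //= v s /andP[/allP vs _] iy [<-].
by case: (i : nat) ic iy => [|j]; rewrite ?c0 //= => _ js; apply: vs; rewrite mem_nth.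
Qed.

End Graph.

Lemma card_chains_in (K : {set 'I_n}) p : K != set0 ->
  #|[set y : Ch | (size y == p) && all (mem K) y]| <= #|K| ^ p.
Proof.
move=> /set0Pn[v0 _].
rewrite -[in leqRHS](card_ord p) -prod_nat_const.
apply: leq_trans (card_chains v0 (fun=> K) p); apply: subset_leq_card.
apply/subsetP => y; rewrite !inE => /andP[/eqP yp /allP yK]; rewrite yp eqxx /=.
by apply/forallP => i; apply: yK; rewrite mem_nth // yp.
Qed.

End Chains.

(** * Growing chains round by round *)

Section Growth.
Variables (n r : nat) (G : graph n).
Notation Ch := (r.-bseq 'I_n).
Implicit Types (x y c : Ch) (T : {set Ch}) (o : option {set Ch}).
Variables (beta : pred Ch) (L : nat).

(* A chain of size 2 descends directly from the empty chain. *)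
Definition parent y : Ch := if size y == 2 then nil_bseq r _ else pre (size y).-1 y.

(** [P] is the part of the stream read so far: one definition describes a sampling pass in progress
    and, with all edges, its result. *)
Definition offspring (P : {set {set 'I_n}}) s T :=
  [set y : Ch | [&& 1 < size y, parent y \in T, size (parent y) == s,
               last_edge G y \in P & beta y]].

(* [None] records that the run has exceeded its memory allowance. *)
Definition grow_round s o :=
  if o is Some T then
    let C := offspring (edges G) s T in
    if #|C| <= L then Some [set y : Ch in C :|: [set x : Ch in T | size x != s] | cl G y]
    else None
  else None.

Definition grow_until s o := foldl (fun o s => grow_round s o) o (iota 0 s).
Definition grow := grow_until r.

Definition tosses t y := all (fun j => beta (pre j y)) (index_iota t.+1 (size y).+1).

(** The [maxn 1] is there because children of the empty chain have size 2, so that no coin belongs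
    to a single vertex. *)
Definition branches c s :=
  [set y : Ch | [&& size y == s, cl G y, pre (size c) y == c &
               tosses (maxn 1 (size c)) y]].

Definition fringe c s :=
  [set y : Ch in candidates r G s | (pre (size c) y == c) && tosses (maxn 1 (size c)) y].

Lemma pre_pre i j y : i <= j -> pre i (pre j y) = pre i y.
Proof. by move=> ij; apply: val_inj; rewrite /= take_takel. Qed.

Lemma pre_full j y : size y <= j -> pre j y = y.
Proof. by move=> yj; apply: val_inj; rewrite /= take_oversize. Qed.

Lemma pre_size j y : j <= size y -> size (pre j y) = j.
Proof. by move=> jy; rewrite /= size_take_min; apply/minn_idPl. Qed.

Lemma tossesS t s y : t <= s -> size y = s.+1 ->
  tosses t y = tosses t (pre s y) && beta y.
Proof.
move=> ts ys; rewrite /tosses pre_size ys ?leqnSn //.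
rewrite /index_iota !subSS subSn // -[(s - t).+1]addn1 iotaD all_cat /= andbT.
rewrite addSn subnKC // (pre_full (j := s.+1)) ?ys //; congr andb.
apply: eq_in_all => j; rewrite mem_iota addSn subnKC // ltnS => /andP[_ js].
by rewrite pre_pre.
Qed.

Lemma cl_small y : size y <= 1 -> cl G y.
Proof. by case: (bseqval y) => [|v []]. Qed.

Lemma cl_last_edge y : cl G y -> 1 < size y -> last_edge G y \in edges G.
Proof.
move=> ycl y1; have [x [w yx]] : exists (x : seq 'I_n) w, y = rcons x w :> seq _.
  by case/lastP: (bseqval y) y1 => // x w _; exists x, w.
have xE : pre (size y).-1 y = x :> seq _.
  by rewrite /= yx size_rcons -cats1 take_size_cat.
have x0 : pre (size y).-1 y != [::] :> seq _.
  by rewrite xE -size_eq0; move: y1; rewrite yx size_rcons; case: (size x).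
have [|v [-> _ vx _]] := last_edge_rcons G (y := y) (w := w) x0.
  by rewrite xE.
move: ycl; rewrite /cl yx pairwise_rcons => /andP[/allP/(_ v) + _].
by rewrite -xE => /(_ vx).
Qed.

Lemma grow_untilS s o : grow_until s.+1 o = grow_round s (grow_until s o).
Proof. by rewrite /grow_until -addn1 iotaD foldl_cat. Qed.

Section Root.
Variable c : Ch.
Hypotheses (c_cl : cl G c) (c1 : size c != 1).
Let t := size c.
Let t' := maxn 1 t.
(** Size of the chains held before round [s]. The root waits until round [t]; from the empty chain,
    round 0 leads directly to size 2 and round 1 is idle. *)
Let lev s := if s <= t then t else maxn 2 s.

Lemma grow_round_idle s : s < r -> lev s != s ->
  grow_round s (Some (branches c (lev s))) = Some (branches c (lev s)).
Proof.
move=> sr ls; rewrite /grow_round /=.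
have -> : offspring (edges G) s (branches c (lev s)) = set0.
  apply/setP => y; rewrite !inE; apply/negP => /and4P[_ + /eqP ps _].
  by case/andP => /eqP; rewrite ps => e; rewrite -e eqxx in ls.
rewrite cards0 /= set0U; congr Some; apply/setP => y; rewrite !inE.
case: eqVneq => [->|] /=; last by [].
by rewrite ls /=; case: (cl G y) => //=; rewrite ?andbF ?andbT.
Qed.

(** A chain is offspring of the current branches exactly when it is a candidate all of whose coins
    succeeded: the coins of its proper prefixes put its parent there, its own coin keeps it. The
    adjacency test then cuts this fringe down to the next branches. *)
Lemma grow_round_step s : s < r -> lev s = s ->
  grow_round s (Some (branches c s)) = Some (branches c (lev s.+1)) \/
  grow_round s (Some (branches c s)) = None /\ L < #|fringe c (lev s.+1)|.
Proof.
move=> sr ls.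
pose p := (lev s.+1).-1.
have ts : t <= s by move: ls; rewrite /lev; case: ifP; lia.
have s1 : s != 1.
  by move: ls; rewrite /lev; case: ifP; move: c1; rewrite -/t; lia.
have pE : p = if s == 0 then 1 else s.
  by rewrite /p /lev; case: ifP; case: (s) s1 ts => [|[|k]] //=; lia.
have lE : lev s.+1 = p.+1 by rewrite /p /lev; case: ifP; lia.
have t'p : t' <= p by rewrite pE /t'; case: eqP; lia.
have tp : t <= p by rewrite pE; case: eqP; lia.
have parE y : size y = p.+1 -> parent y = pre s y.
  move=> yp; rewrite /parent yp pE; case: (s) s1 => [|[|k]] //= _.
  by apply: val_inj; rewrite /= take0.
have sizepar y : 1 < size y -> size (parent y) = s -> size y = p.+1.
  rewrite /parent pE => y1; case: ifP => [/eqP -> <- //|y2].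
  rewrite pre_size ?leq_pred // => <-.
  by case: (size y) y1 y2 => [|[|[|k]]].
have preS y : size y = p.+1 -> pre s y \in branches c s =
    [&& cl G (pre p y), pre t y == c & tosses t' (pre p y)].
  move=> yp; have sp : s <= p by rewrite pE; case: eqP => // ->.
  rewrite inE pre_size ?yp ?(leq_trans sp) // eqxx /= pre_pre // -/t' -/t.
  move: (pE); case: eqP => [s0 p1|_ -> //].
  rewrite p1 !cl_small ?s0 ?pre_size ?yp ?p1 //=.
  congr andb; rewrite /tosses !pre_size ?yp ?p1 ?s0 //.
  by rewrite /index_iota !subSS (eqP (_ : 0 - t' == 0)) // (eqP (_ : 1 - t' == 0)) // /t' subn_eq0 leq_max.
have offE : offspring (edges G) s (branches c s) = fringe c p.+1.
  apply/setP => y; rewrite [LHS]inE [RHS]inE [y \in candidates _ _ _]inE -/t -/t'.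
  apply/idP/idP => [/and5P[y1 py /eqP ys ye yb]|].
    have yp := sizepar y y1 ys; rewrite parE // preS // in py.
    case/and3P: py => ycl yc yt.
    by rewrite yp eqxx ycl ye yc (tossesS t'p yp) yt yb.
  case/and3P=> /and3P[/eqP yp ycl ye] yc.
  rewrite (tossesS t'p yp) => /andP[yt yb].
  rewrite parE // preS // ycl yc yt ye yb yp ltnS andbT /=.
  rewrite pre_size ?yp // ?eqxx ?andbT; last by rewrite leqW // pE; case: eqP => // ->.
  by rewrite pE; case: (s).
rewrite /grow_round offE lE /=; case: leqP => [_|]; [left; congr Some|by right].
apply/setP => y; rewrite !inE -/t -/t'.
have [ycl|] := boolP (cl G y); last by rewrite !andbF.
rewrite (_ : cl G (pre _ y)) ?cl_take //= andbT.
have -> : forall b, [&& size y == s, true & b] && (size y != s) = false.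
  by move=> b; case: eqP => //= _; rewrite andbF.
rewrite orbF; case: eqVneq => //= yp; rewrite cl_last_edge // yp ltnS.
by rewrite pE; case: (s).
Qed.

Lemma grow_untilP s : s <= r ->
  grow_until s (Some [set c]) = Some (branches c (lev s)) \/
  grow_until s (Some [set c]) = None /\
    exists2 s', t' < s' <= maxn 2 r & L < #|fringe c s'|.
Proof.
elim: s => [_|s IHs sr].
  left; rewrite /grow_until /=; congr Some; apply/setP => y; rewrite !inE /lev leq0n.
  apply/eqP/and4P => [->|[/eqP yt _ /eqP <- _]]; last by rewrite pre_full // yt.
  split; rewrite ?pre_full // /tosses /index_iota (eqP (_ : _ - _ == 0)) //.
  by rewrite subn_eq0 ltnS leq_maxr.
have [e|[e ex]] := IHs (ltnW sr); last by right; rewrite grow_untilS e; split.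
rewrite grow_untilS e; have [ls|ls] := eqVneq (lev s) s; last first.
  left; rewrite grow_round_idle //; congr (Some (branches c _)).
  by move: ls; rewrite /lev; do 2 case: ifP; lia.
rewrite ls; have [->|[-> big]] := grow_round_step sr ls; [by left|right; split=> //].
exists (lev s.+1) => //; move: ls c1; rewrite /lev /t' -/t; do 2 case: ifP; lia.
Qed.

(** Frees the analysis from rounds: a run is described by [branches] and [fringe], both explicit in
    the coins, and an overflow is witnessed by one large fringe, whose probability Markov's
    inequality bounds. *)
Lemma growP : 1 < r -> t < r ->
  grow (Some [set c]) = Some (branches c r) \/
  grow (Some [set c]) = None /\ exists2 s', t' < s' <= r & L < #|fringe c s'|.
Proof.
move=> r1 tr; have := grow_untilP (leqnn r).
rewrite /lev leqNgt tr /= (maxn_idPr r1).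
by move=> [e|[e [s' s'r Ls]]]; [left|right; split=> //; exists s'].
Qed.

End Root.
End Growth.

Local Open Scope ring_scope.

(** * Probability on finite uniform spaces *)

Section Expectation.
Variables (R : realFieldType) (T : finType).
Implicit Types (f g : T -> R) (E F : pred T).

Definition Ex f : R := (#|T|%:R)^-1 * \sum_x f x.
Definition Pr E : R := Ex (fun x => (E x)%:R).

Lemma eq_Ex f g : f =1 g -> Ex f = Ex g.
Proof. by move=> fg; rewrite /Ex; under eq_bigr do rewrite fg. Qed.

Lemma ExD f g : Ex (fun x => f x + g x) = Ex f + Ex g.
Proof. by rewrite /Ex big_split mulrDr. Qed.

Lemma ExZ c f : Ex (fun x => c * f x) = c * Ex f.
Proof. by rewrite /Ex -mulr_sumr mulrCA. Qed.

Lemma Ex_sum (I : Type) (s : seq I) (P : pred I) (F : I -> T -> R) :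
  Ex (fun x => \sum_(i <- s | P i) F i x) = \sum_(i <- s | P i) Ex (F i).
Proof. by rewrite /Ex exchange_big /= mulr_sumr. Qed.

Lemma Ex_cst c : (0 < #|T|)%N -> Ex (fun=> c) = c.
Proof.
move=> T0; rewrite /Ex sumr_const mulrC -[c *+ _]mulr_natr mulfK //.
by rewrite pnatr_eq0 -lt0n.
Qed.

Lemma Ex_le f g : (forall x, f x <= g x) -> Ex f <= Ex g.
Proof.
by move=> fg; rewrite ler_wpM2l ?invr_ge0 ?ler0n //; apply: ler_sum.
Qed.

Lemma Ex_ge0 f : (forall x, 0 <= f x) -> 0 <= Ex f.
Proof. by move=> f0; rewrite mulr_ge0 ?invr_ge0 ?ler0n ?sumr_ge0. Qed.

Lemma PrE E : Pr E = #|[set x | E x]|%:R / #|T|%:R.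
Proof.
rewrite /Pr /Ex mulrC -natr_sum; congr (_%:R / _).
by rewrite -sum1_card [RHS]big_mkcond /=; apply: eq_bigr => x _; rewrite inE; case: (E x).
Qed.

Lemma Pr_ge0 E : 0 <= Pr E.
Proof. by apply: Ex_ge0 => x; apply: ler0n. Qed.

Lemma Pr_eq0 E : (forall x, E x = false) -> Pr E = 0.
Proof. by move=> E0; rewrite /Pr /Ex big1 ?mulr0 // => x _; rewrite E0. Qed.

Lemma Pr_sub E F : (forall x, E x -> F x) -> Pr E <= Pr F.
Proof.
move=> EF; apply: Ex_le => x; rewrite ler_nat.
by case: (E x) (EF x) => // ->.
Qed.

Lemma Pr_or E F : Pr (fun x => E x || F x) <= Pr E + Pr F.
Proof.
rewrite /Pr -ExD; apply: Ex_le => x; rewrite -natrD ler_nat.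
by case: (E x); case: (F x).
Qed.

Lemma Pr_exists (I : finType) (P : pred I) (E : I -> pred T) :
  Pr (fun x => [exists i, P i && E i x]) <= \sum_(i | P i) Pr (E i).
Proof.
rewrite -Ex_sum; apply: Ex_le => x.
case: existsP => [[i /andP[Pi Ei]]|_]; last by rewrite sumr_ge0.
by rewrite (bigD1 i) //= Ei lerDl sumr_ge0.
Qed.

Lemma Pr_compl E : (0 < #|T|)%N -> Pr (fun x => ~~ E x) = 1 - Pr E.
Proof.
move=> T0; apply/eqP; rewrite eq_sym subr_eq -ExD; apply/eqP.
by rewrite -[LHS](Ex_cst _ T0); apply: eq_Ex => x; case: (E x) => /=; lra.
Qed.

Lemma markov f (c : R) : 0 < c -> (forall x, 0 <= f x) ->
  Pr (fun x => c <= f x) <= Ex f / c.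
Proof.
move=> c0 f0; rewrite ler_pdivlMr // mulrC -ExZ; apply: Ex_le => x.
by case: (boolP (c <= f x)) => /=; rewrite ?mulr1 ?mulr0.
Qed.

Lemma chebyshev f (d : R) : (0 < #|T|)%N -> 0 < d ->
  Pr (fun x => d <= `|f x - Ex f|) <=
  (Ex (fun x => f x ^+ 2) - Ex f ^+ 2) / d ^+ 2.
Proof.
move=> T0 d0; set mu := Ex f.
have -> : Ex (fun x => f x ^+ 2) - mu ^+ 2 = Ex (fun x => (f x - mu) ^+ 2).
  rewrite [RHS](eq_Ex (g := fun x => f x ^+ 2 + ((- 2 * mu) * f x + mu ^+ 2))); last first.
    by move=> x /=; ring.
  by rewrite !ExD ExZ Ex_cst // -/mu; ring.
have d20 : 0 < d ^+ 2 by rewrite exprn_gt0.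
apply: le_trans (markov d20 _); last by move=> x; apply: sqr_ge0.
apply: Pr_sub => x dx; rewrite -[(_ - _) ^+ 2]real_normK ?num_real //.
by rewrite ler_pXn2r ?nnegrE // ltW.
Qed.

End Expectation.

(* Averaging over the translations of [T2] makes the image of [phi] uniform. *)
Lemma Ex_equivariant (R : realFieldType) (T1 T2 : finType)
    (act : T2 -> T1 -> T1) (add : T2 -> T2 -> T2) (phi : T1 -> T2) (f : T2 -> R) :
  (0 < #|T1|)%N -> (0 < #|T2|)%N -> (forall h, injective (act h)) ->
  (forall y, injective (add y)) -> (forall h x, phi (act h x) = add (phi x) h) ->
  Ex (f \o phi) = Ex f.
Proof.
move=> T10 T20 inj_act inj_add phiD.
have sumE h : \sum_x f (phi x) = \sum_x f (add (phi x) h).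
  by rewrite (reindex_inj (inj_act h)) /=; apply: eq_bigr => x _; rewrite phiD.
have N20 : #|T2|%:R != 0 :> R.
  by rewrite pnatr_eq0 -lt0n.
have N10 : #|T1|%:R != 0 :> R by rewrite pnatr_eq0 -lt0n.
have: \sum_(h : T2) \sum_x f (phi x) = #|T1|%:R * \sum_h f h.
  rewrite (eq_bigr _ (fun h _ => sumE h)) exchange_big /=.
  rewrite (eq_bigr (fun=> \sum_h f h)) ?sumr_const ?mulr_natl // => x _.
  by rewrite [RHS](reindex_inj (inj_add (phi x))).
rewrite sumr_const -[X in X = _]mulr_natl -[#|xpredT|]/#|T2| => e.
rewrite /Ex /=; apply: (mulfI N20); rewrite mulrCA e mulrA mulVf // mul1r.
by rewrite mulrA divff ?mul1r.
Qed.

(** * Independent coins on a product space *)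

Section ProductSpace.
Variables (R : realFieldType) (I : finType) (w : nat).
Notation Om := {ffun I -> 'I_w.+1}.
Implicit Types (f g : Om -> R) (E : pred Om) (J : pred I).

Lemma Om_gt0 : (0 < #|{: Om}|)%N.
Proof. by apply/card_gt0P; exists [ffun=> ord0]. Qed.

Definition depends_on J (A : Type) (f : Om -> A) :=
  forall x y : Om, (forall i, J i -> x i = y i) -> f x = f y.

Definition merge J (x y : Om) : Om := [ffun i => if J i then x i else y i].

Lemma merge_depl J A (f : Om -> A) x y :
  depends_on J f -> f (merge J x y) = f x.
Proof. by apply=> i Ji; rewrite ffunE Ji. Qed.

Lemma merge_depr J A (f : Om -> A) x y :
  depends_on (predC J) f -> f (merge J x y) = f y.
Proof. by apply=> i; rewrite ffunE /= => /negbTE ->. Qed.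

(** Swapping the coordinates outside [J] between two points is an involution on pairs, so merging
    two independent uniform points gives a uniform point. Independence and conditioning both rest on
    this identity. *)
Lemma sum_merge J f :
  \sum_x \sum_y f (merge J x y) = #|{: Om}|%:R * \sum_x f x.
Proof.
rewrite pair_big /=.
pose h (p : Om * Om) := (merge J p.1 p.2, merge J p.2 p.1).
have hK : involutive h.
  move=> [x y]; congr pair; apply/ffunP => i; rewrite !ffunE; by case: (J i).
rewrite (reindex_inj (inv_inj hK)) /=.
rewrite (eq_bigr (fun p => f p.1)); last first.
  move=> [x y] _ /=; congr f; apply/ffunP => i; rewrite !ffunE; by case: (J i).
rewrite -(pair_big xpredT xpredT (fun x _ => f x)) /= mulr_sumr.
by apply: eq_bigr => x _; rewrite sumr_const mulr_natl.
Qed.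

Lemma Ex_indep J f g : depends_on J f -> depends_on (predC J) g ->
  Ex (fun x => f x * g x) = Ex f * Ex g.
Proof.
move=> fJ gJ; have N0 : #|{: Om}|%:R != 0 :> R by rewrite pnatr_eq0 -lt0n Om_gt0.
have := sum_merge J (fun x => f x * g x).
under eq_bigr => x _ do under eq_bigr => y _ do
  rewrite (merge_depl _ _ fJ) (merge_depr _ _ gJ).
under eq_bigr do rewrite -mulr_sumr.
rewrite -mulr_suml /Ex => e.
by rewrite mulrACA e; field.
Qed.

(** Takes the place of conditional probability: the coordinates outside [J] are fixed to those of
    [y], only those in [J] stay random. *)
Lemma Pr_freeze J E d :
  (forall y, Pr R (fun x => E (merge J x y)) <= d) -> Pr R E <= d.
Proof.
move=> Ed; have N0 : #|{: Om}|%:R != 0 :> R by rewrite pnatr_eq0 -lt0n Om_gt0.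
rewrite -(Ex_cst d Om_gt0).
have -> : Pr R E = Ex (fun y => Pr R (fun x => E (merge J x y))).
  have e := sum_merge J (fun x => (E x)%:R).
  by rewrite /Pr /Ex -mulr_sumr exchange_big /= e; field.
exact: Ex_le.
Qed.

Lemma Pr_all_indep (k : finType) (J : k -> pred I) (E : k -> pred Om) (p : R)
    (s : seq k) :
  (forall j j' i, J j i -> J j' i -> j = j') ->
  (forall j, depends_on (J j) (E j)) -> (forall j, Pr R (E j) <= p) -> uniq s ->
  Pr R (fun x => all (E^~ x) s) <= p ^+ size s.
Proof.
move=> disJ EJ Ep; elim: s => [_|j s IHs /= /andP[js us]].
  by rewrite expr0 -(Ex_cst 1 Om_gt0); apply: Ex_le.
rewrite exprS; apply: le_trans (ler_pM (Pr_ge0 _ _) (Pr_ge0 _ _) (Ep j) (IHs us)).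
rewrite le_eqVlt; apply/orP; left; apply/eqP.
rewrite /Pr -(Ex_indep (J := J j)).
- by apply: eq_Ex => x; case: (E j x); rewrite /= ?mul1r ?mul0r.
- by move=> x y xy; rewrite (EJ j x y xy).
move=> x y xy; congr (_%:R); congr nat_of_bool; apply: eq_in_all => j' j's.
apply: EJ => i Ji; apply: xy => /=; apply/negP => Jji.
by move: js; rewrite (disJ _ _ _ Jji Ji) j's.
Qed.

(** Union bound over the at most [2 ^ k] sets of at least half of the copies: each such set fails
    jointly with probability at most [16 ^ (- k / 2) = 4 ^ (- k)]. *)
Lemma Pr_majority (k : nat) (J : 'I_k -> pred I) (E : 'I_k -> pred Om) :
  (forall j j' i, J j i -> J j' i -> j = j') ->
  (forall j, depends_on (J j) (E j)) -> (forall j, Pr R (E j) <= 16%:R^-1) ->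
  Pr R (fun x => (k <= 2 * #|[set j | E j x]|)%N) <= 2%:R ^- k.
Proof.
move=> disJ EJ Ep.
pose P (S : {set 'I_k}) := (k <= 2 * #|S|)%N.
apply: le_trans (_ : Pr R (fun x => [exists S, P S && all (E^~ x) (enum S)]) <= _).
  apply: Pr_sub => x kx; apply/existsP; exists [set j | E j x].
  by rewrite /P kx; apply/allP => j; rewrite mem_enum inE.
apply: le_trans (Pr_exists _ _ _) _.
apply: le_trans (_ : \sum_(S | P S) 4%:R ^- k <= _).
  apply: ler_sum => S PS.
  apply: le_trans (Pr_all_indep disJ EJ Ep (enum_uniq S)) _.
  rewrite -cardE exprVn lef_pV2 ?posrE ?exprn_gt0 //.
  rewrite (_ : 16%:R = 4%:R ^+ 2) ?(ler_eXn2l,ler_weXn2l) -?exprM ?ler_weXn2l ?ler1n //.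
  by rewrite -natrX.
apply: le_trans (_ : \sum_(S : {set 'I_k}) 4%:R ^- k <= _).
  by rewrite [X in _ <= X](bigID P) /= lerDl sumr_ge0 // => S _; rewrite invr_ge0 exprn_ge0.
rewrite sumr_const -[#|_|]/#|{: {set 'I_k}}| -cardsT -powersetT card_powerset cardsT card_ord.
rewrite -[X in X <= _]mulr_natl natrX (_ : 4%:R = 2%:R * 2%:R) ?exprMn; last by rewrite -natrM.
by rewrite invfM mulrA divff ?mul1r // expf_neq0 // pnatr_eq0.
Qed.

Lemma Ex_marginal (i : I) (f : 'I_w.+1 -> R) : Ex (fun x : Om => f (x i)) = Ex f.
Proof.
apply: (@Ex_equivariant R Om 'I_w.+1 (fun h x => [ffun j => x j + h])
          (fun y h => y + h) (fun x : Om => x i) f Om_gt0); rewrite ?card_ord //.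
- move=> h x y /ffunP xy; apply/ffunP => j; have := xy j.
  by rewrite !ffunE => /addIr.
- exact: addrI.
- by move=> h x; rewrite ffunE.
Qed.

Section Coins.
Variable md : I -> nat.
Hypothesis md_dvd : forall i, (md i %| w.+1)%N.

(** Success when [x i] lies in the first [1 / md i] of its range; divisibility makes this
    probability exact. *)
Definition coin (x : Om) (i : I) : bool := (x i * md i < w.+1)%N.

Lemma coin_dep i : depends_on (pred1 i) (coin^~ i).
Proof. by move=> x y xy; rewrite /coin xy /=. Qed.

Lemma Pr_coin i : Pr R (coin^~ i) = (md i)%:R^-1.
Proof.
have [q e] := dvdnP (md_dvd i).
have m0 : (0 < md i)%N by case: (md i) e => //; rewrite muln0.
rewrite /Pr (Ex_marginal i (fun z => (z * md i < w.+1)%N%:R)) /Ex card_ord.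
rewrite -natr_sum (_ : (\sum_z _ = q)%N).
  rewrite [X in X%:R^-1]e natrM invfM mulrC mulrA divff ?mul1r // pnatr_eq0.
  by case: q e.
rewrite (eq_bigr (fun z : 'I_w.+1 => if (z < q)%N then 1%N else 0%N)); last first.
  by move=> z _; rewrite [X in (_ < X)%N]e ltn_pmul2r //; case: ltnP.
have qw : (q <= w.+1)%N by rewrite e leq_pmulr.
by rewrite -big_mkcond -(big_ord_widen _ (fun=> 1%N) qw) sum1_card card_ord.
Qed.

Lemma Pr_coins (s : seq I) : uniq s ->
  Pr R (fun x => all (coin x) s) = \prod_(i <- s) (md i)%:R^-1.
Proof.
elim: s => [_|i s IHs /= /andP[is_ us]].
  by rewrite big_nil -[RHS](Ex_cst 1 Om_gt0); apply: eq_Ex.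
rewrite big_cons -IHs // -Pr_coin /Pr -(Ex_indep (J := pred1 i)).
- by apply: eq_Ex => x; case: (coin x i); rewrite /= ?mul1r ?mul0r.
- by move=> x y xy; rewrite (coin_dep xy).
move=> x y xy; congr (_%:R); congr nat_of_bool; apply: eq_in_all => j js.
apply: (@coin_dep j) => k /eqP ->; apply: xy => /=.
by apply: contraNneq is_ => <-.
Qed.

End Coins.

End ProductSpace.

(** The indices satisfying [e] form an initial segment, so the product on the left is empty or is
    itself one of the terms of the sum. *)
Lemma prod_down_closed (q : nat -> nat) (e : pred nat) (a b : nat) :
  (forall i j, (a <= i <= j)%N -> e j -> e i) ->
  (\prod_(a <= j < b | e j) q j <=
   1 + \sum_(a <= j < b | e j) \prod_(a <= i < j.+1) q i)%N.
Proof.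
move=> down; have [ba|ab] := leqP b a; first by rewrite !big_geq.
rewrite -(subnKC (ltnW ab)); elim: (b - a)%N => [|d IHd].
  by rewrite addn0 !big_geq.
rewrite addnS !(big_mkcond e) /= !big_nat_recr ?leq_addr //= -!big_mkcond /=.
case: ifP => ed; last by rewrite muln1 addn0.
rewrite [X in (X * _ <= _)%N](_ : _ = \prod_(a <= j < a + d) q j)%N; last first.
  rewrite big_nat_cond [RHS]big_nat; apply: eq_bigl => j.
  by apply: andb_idr => /andP[aj jd]; apply: down ed; rewrite aj ltnW.
by rewrite addnA leq_addl.
Qed.

(** * Variance of the number of surviving paths in a tree of coins *)

Section TreeVariance.
Variables (R : realFieldType) (I X : finType) (w : nat).
Notation Om := {ffun I -> 'I_w.+1}.
Variable md : I -> nat.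
Hypothesis md_dvd : forall i, (md i %| w.+1)%N.
Variables (a b : nat) (p : X -> nat -> I) (q : nat -> nat).
Variable D : pred X.
Hypothesis p_inj : forall x y i j, D x -> D y -> (a <= i < b)%N -> (a <= j < b)%N ->
  p x i = p y j -> i = j.
Hypothesis p_down : forall x y i j, (a <= i <= j)%N -> p x j = p y j -> p x i = p y i.
Hypothesis md_p : forall x j, D x -> (a <= j < b)%N -> md (p x j) = q j.
Implicit Types (x y : X) (om : Om) (Y : {set X}).

Definition survives om x : bool := all (fun j => coin md om (p x j)) (index_iota a b).
Definition survivors om Y : nat := #|[set x in Y | survives om x]|.
Definition rate (j : nat) : nat := \prod_(a <= i < j) q i.

Let q_gt0 x j : D x -> (a <= j < b)%N -> (0 < q j)%N.
Proof. by move=> Dx jab; rewrite -(md_p Dx jab); apply: dvdn_gt0 (md_dvd _). Qed.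

Lemma rate_gt0 x j : D x -> (j <= b)%N -> (0 < rate j)%N.
Proof.
move=> Dx jb; rewrite /rate big_nat prodn_cond_gt0 // => i /andP[ai ij].
by apply: (q_gt0 Dx); rewrite ai (leq_trans ij).
Qed.

Lemma Pr_survives x : D x -> Pr R (survives^~ x) = (rate b)%:R^-1.
Proof.
move=> Dx.
transitivity (Pr R (fun om => all (coin md om) (map (p x) (index_iota a b)))).
  by apply: eq_Ex => om; rewrite all_map.
rewrite Pr_coins //; last first.
  rewrite map_inj_in_uniq ?iota_uniq // => i j; rewrite !mem_index_iota.
  exact: p_inj.
rewrite big_map /rate natr_prod -prodfV !big_nat.
by apply: eq_bigr => j jab; rewrite md_p.
Qed.

(** Coins common to the two paths are tossed only once, so the product of the two survival
    probabilities is multiplied by the rates of the common initial part. *)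
Lemma Pr_survives2 x y : D x -> D y ->
  Pr R (fun om => survives om x && survives om y) <=
  (1 + \sum_(a <= j < b | p x j == p y j) rate j.+1)%N%:R / (rate b)%:R ^+ 2.
Proof.
move=> Dx Dy; pose s := map (p x) (index_iota a b) ++
  map (p y) [seq j <- index_iota a b | p x j != p y j].
have us : uniq s.
  rewrite cat_uniq !map_inj_in_uniq ?filter_uniq ?iota_uniq ?andbT //=; first last.
  - by move=> i j; rewrite !mem_index_iota; apply: p_inj.
  - move=> i j; rewrite !mem_filter !mem_index_iota => /andP[_ iab] /andP[_ jab].
    exact: p_inj.
  apply/hasPn => _ /mapP[j jf ->]; apply/negP => /mapP[i iab e].
  move: jf; rewrite mem_filter mem_index_iota => /andP[+ jab].
  rewrite mem_index_iota in iab; have ji := p_inj Dy Dx jab iab e.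
  by rewrite -ji in e; rewrite e eqxx.
have b0 : (rate b)%:R != 0 :> R by rewrite pnatr_eq0 -lt0n (rate_gt0 Dx).
have -> : Pr R (fun om => survives om x && survives om y) =
    Pr R (fun om => all (coin md om) s).
  apply: eq_Ex => om; congr (_%:R); congr nat_of_bool.
  rewrite all_cat !all_map; apply: andb_id2l => /allP xs.
  rewrite all_filter; apply: eq_in_all => j js /=.
  by case: eqP => //= <-; apply: xs.
rewrite Pr_coins // big_cat !big_map big_filter /=.
have eR : \prod_(j <- index_iota a b) (md (p x j))%:R^-1 = (rate b)%:R^-1 :> R.
  rewrite /rate natr_prod -prodfV !big_nat.
  by apply: eq_bigr => j jab; rewrite md_p.
have eqs (P : pred nat) : \prod_(j <- index_iota a b | P j) (md (p y j))%:R^-1 =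
    (\prod_(a <= j < b | P j) (q j)%:R)^-1 :> R.
  rewrite -prodfV big_nat_cond [RHS]big_nat_cond.
  by apply: eq_bigr => j /andP[jab _]; rewrite md_p.
have rb : (rate b)%:R = \prod_(a <= j < b | p x j == p y j) (q j)%:R *
    \prod_(a <= j < b | p x j != p y j) (q j)%:R :> R.
  by rewrite /rate natr_prod (bigID (fun j => p x j == p y j)).
rewrite eR eqs.
set u := \prod_(a <= j < b | p x j == p y j) (q j)%:R in rb.
set v := \prod_(a <= j < b | p x j != p y j) (q j)%:R in rb *.
have /norP[u0 v0] : ~~ ((u == 0) || (v == 0)) by rewrite -mulf_eq0 -rb.
rewrite expr2 invfM mulrCA ler_wpM2l ?invr_ge0 ?ler0n //.
rewrite rb invfM mulrA -[leLHS]mul1r ler_wpM2r //.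
  by rewrite invr_ge0 prodr_ge0.
rewrite ler_pdivlMr ?mul1r; last by rewrite lt_neqAle eq_sym u0 prodr_ge0.
rewrite /u -natr_prod ler_nat.
apply: prod_down_closed => i j ij /eqP e; apply/eqP.
exact: p_down ij e.
Qed.

Lemma Ex_survivors Y : {in Y, forall x, D x} ->
  Ex (fun om => (survivors om Y)%:R) = #|Y|%:R / (rate b)%:R :> R.
Proof.
move=> YD; rewrite mulr_natl -sumr_const.
rewrite -(eq_bigr _ (fun x xY => Pr_survives (YD x xY))) -Ex_sum.
apply: eq_Ex => om; rewrite /survivors -natr_sum -sum1_card; congr (_%:R).
rewrite [RHS]big_mkcond [LHS]big_mkcond; apply: eq_bigr => x _ /=.
by rewrite inE; case: (x \in Y); case: survives.
Qed.

(** In the second moment, the excess over the squared mean comes from pairs with a common coin. At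
    level [j] there are at most [#|Y| * g j] of them, each weighted by [rate j.+1]; Chebyshev's
    inequality concludes. *)
Lemma survivors_concentrated Y (g : nat -> nat) (c : R) :
  {in Y, forall x, D x} -> 0 < c -> (0 < #|Y|)%N ->
  (forall x j, x \in Y -> (a <= j < b)%N ->
     (#|[set y in Y | p y j == p x j]| <= g j)%N) ->
  Pr R (fun om => c * (#|Y|%:R / (rate b)%:R) <=
          `|(survivors om Y)%:R - #|Y|%:R / (rate b)%:R|) <=
  (\sum_(a <= j < b) rate j.+1 * g j)%N%:R / (c ^+ 2 * #|Y|%:R).
Proof.
move=> YD c0 Y0 Yg.
have [x0 x0Y] : exists x, x \in Y by apply/card_gt0P.
have r0 : 0 < (rate b)%:R :> R by rewrite ltr0n (rate_gt0 (YD _ x0Y)).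
have y0 : 0 < #|Y|%:R :> R by rewrite ltr0n.
set mu := #|Y|%:R / (rate b)%:R.
have mu0 : 0 < mu by apply: mulr_gt0 => //; rewrite invr_gt0.
have muE : Ex (fun om => (survivors om Y)%:R) = mu := Ex_survivors YD.
have := @chebyshev R _ (fun om => (survivors om Y)%:R) (c * mu) (Om_gt0 I w) (mulr_gt0 c0 mu0).
rewrite muE => /le_trans; apply.
set S := \sum_(a <= j < b) _.
suff : Ex (fun om => (survivors om Y)%:R ^+ 2) - mu ^+ 2 <=
    #|Y|%:R * S%:R / (rate b)%:R ^+ 2.
  move=> A; rewrite ler_pdivrMr ?exprn_gt0 ?(mulr_gt0 c0 mu0) //.
  apply: le_trans A _.
  rewrite le_eqVlt; apply/orP; left; apply/eqP; rewrite /mu; field.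
  by rewrite !gt_eqF.
rewrite lerBlDr.
have -> : Ex (fun om => (survivors om Y)%:R ^+ 2) =
    \sum_(x in Y) \sum_(y in Y) Pr R (fun om => survives om x && survives om y).
  rewrite -[RHS](eq_bigr _ (fun x _ => Ex_sum _ _ _)) -Ex_sum; apply: eq_Ex => om.
  have -> : (survivors om Y)%:R = \sum_(x in Y) (survives om x)%:R :> R.
    rewrite /survivors -natr_sum -sum1_card; congr (_%:R).
    rewrite [RHS]big_mkcond [LHS]big_mkcond; apply: eq_bigr => x _ /=.
    by rewrite inE; case: (x \in Y); case: survives.
  rewrite expr2 mulr_suml; apply: eq_bigr => x _; rewrite mulr_sumr.
  by apply: eq_bigr => y _; case: (survives om x); rewrite ?mul1r ?mul0r.
apply: le_trans (_ : (\sum_(x in Y) \sum_(y in Y)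
    (1 + \sum_(a <= j < b | p x j == p y j) rate j.+1))%N%:R / (rate b)%:R ^+ 2 <= _).
  rewrite natr_sum mulr_suml; apply: ler_sum => x xY.
  rewrite natr_sum mulr_suml; apply: ler_sum => y yY.
  by apply: Pr_survives2; apply: YD.
rewrite /mu expr_div_n -mulrDl ler_wpM2r //; first by rewrite invr_ge0 exprn_ge0 // ltW.
rewrite -natrM -natrX -natrD ler_nat.
apply: leq_trans (_ : \sum_(x in Y) (#|Y| + S) <= _)%N; last first.
  by rewrite sum_nat_const mulnDr addnC -mulnn leqnn.
apply: leq_sum => x xY; rewrite big_split /= sum1_card leq_add2l.
rewrite (eq_bigr (fun y => \sum_(a <= j < b) if p x j == p y j then rate j.+1 else 0%N)); last first.
  by move=> y _; rewrite -big_mkcond.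
rewrite exchange_big /= /S big_nat [leqRHS]big_nat; apply: leq_sum => j jab.
rewrite -big_mkcondr /= sum_nat_const mulnC leq_mul2l; apply/orP; right.
apply: leq_trans (Yg x j xY jab); rewrite subset_leq_card //.
by apply/subsetP => y; rewrite !inE eq_sym.
Qed.

End TreeVariance.

Lemma markov_nat (R : realFieldType) (T : finType) (f : T -> nat) (c : nat) (e : R) :
  (0 < c)%N -> Ex (fun x => (f x)%:R) <= e * c%:R ->
  Pr R (fun x => (c <= f x)%N) <= e.
Proof.
move=> c0 fe; have c0' : 0 < c%:R :> R by rewrite ltr0n.
apply: le_trans (_ : Ex (fun x => (f x)%:R) / c%:R <= _); last by rewrite ler_pdivrMr.
apply: le_trans (markov c0' _) => [|x]; last exact: ler0n.
by apply: Pr_sub => x; rewrite ler_nat.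
Qed.

(** * Probabilistic guarantees for a single run *)

Section Runs.
Variables (R : realFieldType) (n r : nat) (G : graph n) (lam g0 gm k b : nat).
Notation Ch := (r.-bseq 'I_n).
Notation m := #|edges G|.
Hypothesis lam_gt0 : (0 < lam)%N.

(* A run is identified by its guess, its root ([None] for the sampling runs,
   whose root is the empty chain) and a copy number. *)
Definition Id : finType := ('I_gm * option Ch * 'I_k)%type.
Definition scale (g : 'I_gm) : nat := (2 ^ (g0 + g))%N.
Definition root (id : Id) : Ch := odflt (nil_bseq r _) id.1.2.
Definition modulus (id : Id) (s : nat) : nat :=
  if (id.1.2 == None) && (s == 2%N) then scale id.1.1 else lam.
Definition md (i : Id * Ch) : nat := modulus i.1 (size i.2).
(* [width.+1] is a multiple of [lam] and of every [scale g], so that the coins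
   have exactly the probabilities 1/lam and 1/(scale g). *)
Definition width : nat := (lam * 2 ^ (g0 + gm)).-1.
Notation Om := {ffun Id * Ch -> 'I_width.+1}.
Implicit Types (om : Om) (id : Id) (c y : Ch) (g : 'I_gm).

Lemma widthE : width.+1 = (lam * 2 ^ (g0 + gm))%N.
Proof. by rewrite prednK // muln_gt0 lam_gt0 expn_gt0. Qed.

Lemma md_dvd i : (md i %| width.+1)%N.
Proof.
rewrite widthE /md /modulus; case: ifP => _; last exact: dvdn_mulr.
by rewrite dvdn_mull // dvdn_exp2l // leq_add2l ltnW.
Qed.

Definition bits om id : pred Ch := fun y => coin md om (id, y).

Definition depth id := maxn 1 (size (root id)).
(** The inverse of the probability that a given chain of size [s] above the root survives in run
    [id]. *)
Definition Q id s : nat := rate (depth id).+1 (modulus id) s.+1.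
Definition below c (S : {set Ch}) := [set y in S | pre (size c) y == c].

Section OneRun.
Variables (id : Id) (s : nat).
Let D : pred Ch := fun y => size y == s.
Let p (y : Ch) j : Id * Ch := (id, pre j y).

Let p_inj x y i j : D x -> D y -> ((depth id).+1 <= i < s.+1)%N ->
  ((depth id).+1 <= j < s.+1)%N -> p x i = p y j -> i = j.
Proof.
move=> /eqP xs /eqP ys /andP[_ is_] /andP[_ js] [/(congr1 size)].
by rewrite !size_take_min xs ys (minn_idPl (is_ : i <= s)%N) (minn_idPl (js : j <= s)%N).
Qed.

Let p_down x y i j : ((depth id).+1 <= i <= j)%N -> p x j = p y j -> p x i = p y i.
Proof.
move=> /andP[_ ij] [e]; congr pair; apply: val_inj => /=.
by rewrite -(take_takel _ ij) e take_takel.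
Qed.

Let md_p : forall (x : Ch) j, D x -> ((depth id).+1 <= j < s.+1)%N -> md (p x j) = modulus id j.
Proof.
by move=> x j /eqP xs /andP[_ js]; rewrite /md /= size_take_min xs (minn_idPl (js : j <= s)%N).
Qed.

Definition surviving om (Y : {set Ch}) : nat :=
  #|[set y in Y | tosses (bits om id) (depth id) y]|.

Let survivingE om (Y : {set Ch}) : {in Y, forall y, D y} ->
  surviving om Y = survivors md (depth id).+1 s.+1 p om Y.
Proof.
move=> YD; apply: eq_card => y; rewrite !inE; apply: andb_id2l => yY.
by rewrite /tosses (eqP (YD y yY)).
Qed.

Lemma Ex_surviving (Y : {set Ch}) : {in Y, forall y, size y == s} ->
  Ex (fun om => (surviving om Y)%:R) = #|Y|%:R / (Q id s)%:R :> R.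
Proof.
move=> YD; rewrite -(Ex_survivors R md_dvd p_inj md_p YD).
by apply: eq_Ex => om; rewrite survivingE.
Qed.

Lemma surviving_concentrated (Y : {set Ch}) (g : nat -> nat) (c : R) :
  {in Y, forall y, size y == s} -> 0 < c -> (0 < #|Y|)%N ->
  (forall x j, x \in Y -> (depth id < j <= s)%N ->
     (#|[set y in Y | pre j y == pre j x]| <= g j)%N) ->
  Pr R (fun om => c * (#|Y|%:R / (Q id s)%:R) <=
          `|(surviving om Y)%:R - #|Y|%:R / (Q id s)%:R|) <=
  (\sum_((depth id).+1 <= j < s.+1) Q id j * g j)%N%:R / (c ^+ 2 * #|Y|%:R).
Proof.
move=> YD c0 Y0 Yg.
have := survivors_concentrated md_dvd p_inj p_down md_p YD c0 Y0.
move=> /(_ g) h; apply: le_trans (h _) => [|x j xY js]; last first.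
  apply: leq_trans (Yg x j xY js); apply: subset_leq_card; apply/subsetP => y.
  by rewrite !inE => /andP[-> /eqP[e]] /=; apply/eqP/val_inj.
by apply: Pr_sub => om; rewrite survivingE.
Qed.

Lemma fringe_surviving om :
  #|fringe G (bits om id) (root id) s| = surviving om (below (root id) (candidates r G s)).
Proof. by apply: eq_card => y; rewrite !inE andbA. Qed.

Lemma branches_surviving om :
  #|branches G (bits om id) (root id) s| = surviving om (below (root id) (cliques_of_size r G s)).
Proof. by apply: eq_card => y; rewrite !inE !andbA. Qed.

Lemma surviving_sub om (Y Y' : {set Ch}) : Y \subset Y' ->
  (surviving om Y <= surviving om Y')%N.
Proof.
move=> /subsetP YY; apply: subset_leq_card; apply/subsetP => y.
by rewrite !inE => /andP[/YY -> ->].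
Qed.

End OneRun.

(** A sampling run expects at most [2 * r * m / scale g] chains in a fringe. The remaining factor
    [64 * r] serves Markov's inequality and the union bound over rounds; a test with twice that
    expectation still has [32 * r]. *)
Definition cap g : nat := (128 * r ^ 2 * m %/ scale g)%N.
(* The base 65 makes [\sum_(t < s <= r) 64 * b * 65 ^ (r - s) < b * 65 ^ (r - t)]. *)
Definition theta t : nat := (32 * b * 65 ^ (r - t))%N.

Lemma scale_gt0 g : (0 < scale g)%N.
Proof. by rewrite expn_gt0. Qed.

Lemma cap_lt g x : (cap g < x)%N = (128 * r ^ 2 * m < x * scale g)%N.
Proof. by rewrite /cap ltn_divLR ?scale_gt0. Qed.

Lemma rate_cst a j l : (\prod_(a <= i < j) l = l ^ (j - a))%N.
Proof. by rewrite prod_nat_const_nat. Qed.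

Lemma Q_test g c j t : (1 < size c)%N -> Q (g, Some c, j) t = (lam ^ (t - size c))%N.
Proof.
move=> c1; rewrite /Q /rate /modulus /= rate_cst /depth /root /=.
by rewrite subSS (maxn_idPr (ltnW c1)).
Qed.

Lemma Q_main g i t : (1 < t)%N -> Q (g, None, i) t = (scale g * lam ^ (t - 2))%N.
Proof.
move=> t1; rewrite /Q /rate /modulus /depth /root /= big_ltn //=; congr muln.
rewrite big_nat (eq_bigr (fun=> lam)) -?big_nat ?rate_cst ?subSS // => s.
by case/andP; case: s => [|[|[|]]].
Qed.

Lemma sum_theta t : (t <= r)%N ->
  (\sum_(t.+1 <= j < r.+1) 2 * theta j <= b * 65 ^ (r - t))%N.
Proof.
move=> /subnKC; move: (r - t)%N => d; elim: d t => [|d IHd] t tr.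
  by rewrite big_geq // -tr addn0.
rewrite big_ltn; last by rewrite -tr; lia.
have /IHd : (t.+1 + d = r)%N by rewrite addSnnS.
rewrite /theta (_ : r - t.+1 = d)%N ?expnS; last lia.
lia.
Qed.

Definition run om id : option {set Ch} := grow G (bits om id) (cap id.1.1) (Some [set root id]).

(** An overflowing test counts against the prefix: only a completed count can show that the
    extensions are few. *)
Definition bad_test g c om j : bool :=
  if run om (g, Some c, j) is Some T then (theta (size c) < #|T|)%N else true.

Lemma run_test g c om j : cl G c -> (1 < size c < r)%N ->
  run om (g, Some c, j) = Some (branches G (bits om (g, Some c, j)) c r) \/
  run om (g, Some c, j) = None /\
    exists2 s, (size c < s <= r)%N & (cap g < #|fringe G (bits om (g, Some c, j)) c s|)%N.
Proof.
move=> ccl /andP[c1 cr].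
have h1 : size c != 1%N by rewrite gtn_eqF.
have [e|[e [s cs big]]] := @growP n r G (bits om (g, Some c, j)) (cap g) c ccl h1
  (ltn_trans c1 cr) cr; first by left.
by right; split=> //; exists s => //; rewrite -(maxn_idPr (ltnW c1)).
Qed.

Lemma run_main g om i : (1 < r)%N ->
  run om (g, None, i) = Some (branches G (bits om (g, None, i)) (nil_bseq r _) r) \/
  run om (g, None, i) = None /\
    exists2 s, (1 < s <= r)%N & (cap g < #|fringe G (bits om (g, None, i)) (nil_bseq r _) s|)%N.
Proof.
by move=> r1; apply: (@growP n r G (bits om (g, None, i)) (cap g)) => //=; apply: ltnW.
Qed.

Hypothesis b_gt0 : (0 < b)%N.

Lemma theta_gt0 t : (0 < theta t)%N.
Proof. by rewrite !muln_gt0 b_gt0 expn_gt0. Qed.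

(** The mean number of survivors from [Y] exceeds twice the threshold, so missing them is a
    deviation by half the mean. By [sum_theta] the multiplicities contribute at most a 64th of the
    lower bound on [#|Y|], and Chebyshev's inequality gives [4 / 64]. *)
Lemma test_detects g c j (Y : {set Ch}) : cl G c -> (1 < size c < r)%N ->
  Y \subset below c (cliques_of_size r G r) ->
  (lam ^ (r - size c) * (2 * theta (size c)) < #|Y|)%N ->
  (forall x s, x \in Y -> (size c < s <= r)%N ->
     (#|[set y in Y | pre s y == pre s x]| <= lam ^ (r - s) * (2 * theta s))%N) ->
  Pr R (fun om => ~~ bad_test g c om j) <= 16%:R^-1.
Proof.
move=> ccl cr Yb Ybig Ymult; have /andP[c1 cr'] := cr; set t := size c in Ybig Ymult cr *.
pose id : Id := (g, Some c, j).
have YD : {in Y, forall y, size y == r}.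
  by move=> y /(subsetP Yb); rewrite !inE => /andP[/andP[]].
have Y0 : (0 < #|Y|)%N by apply: leq_ltn_trans Ybig.
have dE : depth id = t by rewrite /depth /root /= (maxn_idPr (ltnW c1)).
have QE : Q id r = (lam ^ (r - t))%N by rewrite Q_test.
have lam0 : 0 < lam%:R :> R by rewrite ltr0n.
have l0 : 0 < (lam ^ (r - t))%:R :> R by rewrite natrX exprn_gt0.
have y0 : 0 < #|Y|%:R :> R by rewrite ltr0n.
apply: le_trans (_ : Pr R (fun om => 2^-1 * (#|Y|%:R / (Q id r)%:R) <=
          `|(surviving id om Y)%:R - #|Y|%:R / (Q id r)%:R|) <= _).
  apply: Pr_sub => om; rewrite /bad_test.
  case: (run_test g om j ccl cr) => [->|[-> //]]; rewrite -leqNgt => Zt.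
  have Zle : (surviving id om Y <= theta t)%N.
    apply: leq_trans Zt; have -> := @branches_surviving id r om.
    exact: surviving_sub.
  have Zh : (surviving id om Y)%:R <= 2^-1 * (#|Y|%:R / (Q id r)%:R) :> R.
    have : (surviving id om Y * 2 * lam ^ (r - t) <= #|Y|)%N.
      apply: leq_trans (ltnW Ybig); rewrite mulnC leq_mul2l mulnC leq_mul2l Zle.
      by rewrite !orbT.
    by rewrite -(ler_nat R) !natrM QE mulrA ler_pdivlMr //; lra.
  have z0 : 0 <= (surviving id om Y)%:R :> R by apply: ler0n.
  by rewrite ler0_norm; lra.
have := @surviving_concentrated id r Y
  (fun s => lam ^ (r - s) * (2 * theta s))%N 2^-1 YD _ Y0.
rewrite dE => /(_ _ Ymult) h; apply: le_trans (h _) _; first by rewrite invr_gt0.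
rewrite ler_pdivrMr ?mulr_gt0 ?exprn_gt0 ?invr_gt0 //.
have : ((\sum_(t.+1 <= s < r.+1) Q id s * (lam ^ (r - s) * (2 * theta s))) * 64 <= #|Y|)%N.
  apply: leq_trans (ltnW Ybig).
  rewrite big_nat (eq_bigr (fun s => lam ^ (r - t) * (2 * theta s)))%N => [|s /andP[ts sr]].
    rewrite -big_nat -big_distrr /= -mulnA leq_pmul2l ?expn_gt0 ?lam_gt0 //.
    apply: leq_trans (leq_mul (sum_theta (ltnW cr')) (leqnn _)) _.
    rewrite /theta -/t; move: (65 ^ (r - t))%N => K; lia.
  rewrite Q_test // mulnA -expnD; congr (lam ^ _ * _)%N; move: ts sr; rewrite -/t; lia.
rewrite -(ler_nat R) natrM; lra.
Qed.

(** Two Markov bounds of [1 / 32] each: the threshold is 32 times the bound on the mean count, and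
    the allowance is [32 * r] times the bound on the mean fringe, over at most [r] sizes. *)
Lemma test_accepts g c j : cl G c -> (1 < size c < r)%N -> (0 < m)%N ->
  (#|below c (cliques_of_size r G r)| <= lam ^ (r - size c) * (b * 65 ^ (r - size c)))%N ->
  (forall s, (size c < s <= r)%N ->
     (#|below c (candidates r G s)| * scale g <= 4 * r * m * lam ^ (s - size c))%N) ->
  Pr R (fun om => bad_test g c om j) <= 16%:R^-1.
Proof.
move=> ccl cr m0 Nc Sc; have /andP[c1 cr'] := cr; set t := size c in Nc Sc cr *.
pose id : Id := (g, Some c, j).
have lam0 s : 0 < (lam ^ s)%:R :> R by rewrite natrX exprn_gt0 // ltr0n.
apply: le_trans (_ : Pr R (fun om => (theta t <= #|branches G (bits om id) c r|)%N ||
   [exists s : 'I_r.+1, (t < s)%N && (128 * r ^ 2 * m <= #|fringe G (bits om id) c s| * scale g)%N]) <= _).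
  apply: Pr_sub => om; rewrite /bad_test.
  case: (run_test g om j ccl cr) => [->|[-> [s /andP[cs sr]]]]; first by move=> /ltnW ->.
  rewrite cap_lt => big _; apply/orP; right; apply/existsP.
  by exists (Ordinal (sr : (s < r.+1)%N)); rewrite /= cs ltnW.
apply: le_trans (Pr_or _ _ _) _.
rewrite (_ : 16^-1 = 32%:R^-1 + 32%:R^-1); last by field.
apply: lerD.
  apply: markov_nat; rewrite ?theta_gt0 //.
  rewrite (eq_Ex (fun om => congr1 _ (branches_surviving id r om))) (@Ex_surviving id r) //; last first.
    by move=> y; rewrite !inE => /andP[/andP[]].
  have : (#|below c (cliques_of_size r G r)| * 32 <= theta t * lam ^ (r - t))%N.
    apply: leq_trans (leq_mul Nc (leqnn _)) _.
    by rewrite /theta -/t; move: (65 ^ _)%N (lam ^ _)%N => K K'; lia.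
  by rewrite Q_test // ler_pdivrMr // -(ler_nat R) !natrM; lra.
apply: le_trans (Pr_exists _ _ _) _.
apply: le_trans (_ : \sum_(s < r.+1 | (t < s)%N) (32 * r)%:R^-1 <= _).
  apply: ler_sum => s ts; have sr : (s <= r)%N by rewrite -ltnS.
  apply: markov_nat; first by rewrite !muln_gt0 m0 (leq_trans _ cr').
  under eq_Ex => om do rewrite natrM mulrC.
  rewrite ExZ (eq_Ex (fun om => congr1 _ (fringe_surviving id s om))) (@Ex_surviving id s) //; last first.
    by move=> y; rewrite !inE => /andP[/andP[]].
  have h := Sc s (introT andP (conj ts sr)).
  rewrite Q_test // mulrA ler_pdivrMr // -natrM mulnC.
  apply: le_trans (_ : (4 * r * m * lam ^ (s - t))%:R <= _); first by rewrite ler_nat.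
  have r0 : 0 < r%:R :> R by rewrite ltr0n (leq_trans _ cr').
  rewrite !natrM; move: (m%:R) (_ ^ _)%:R => x z.
  by rewrite le_eqVlt; apply/orP; left; apply/eqP; field; rewrite gt_eqF.
apply: le_trans (_ : \sum_(s < r.+1 | (t < s)%N) (32 * r)%:R^-1 <= _); first exact: lexx.
rewrite sumr_const -[leLHS]mulr_natl natrM invfM mulrCA ler_piMr ?invr_ge0 ?ler0n //.
have r0 : 0 < r%:R :> R by rewrite ltr0n (leq_trans _ cr').
rewrite ler_pdivrMr // mul1r ler_nat.
apply: leq_trans (_ : #|[pred s : 'I_r.+1 | s != ord0]| <= _)%N.
  by apply: subset_leq_card; apply/subsetP => s; rewrite !unfold_in /=; case: s => -[].
by rewrite cardC1 card_ord.
Qed.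

Lemma main_overflow g i : lam = degeneracy G -> (1 < r)%N -> (0 < m)%N ->
  Pr R (fun om => run om (g, None, i) == None) <= 64%:R^-1.
Proof.
move=> lamE r1 m0; pose id : Id := (g, None, i).
have [out [out_lam out_ord]] := degeneracy_orientation G.
have r0 : 0 < r%:R :> R by rewrite ltr0n ltnW.
apply: le_trans (_ : Pr R (fun om => [exists s : 'I_r.+1, (1 < s)%N &&
   (128 * r ^ 2 * m <= #|fringe G (bits om id) (nil_bseq r _) s| * scale g)%N]) <= _).
  apply: Pr_sub => om; case: (run_main g om i r1) => [->//|[_ [s /andP[s1 sr]]]] + _.
  rewrite cap_lt => big; apply/existsP.
  by exists (Ordinal (sr : (s < r.+1)%N)); rewrite /= s1 ltnW.
apply: le_trans (Pr_exists _ _ _) _.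
apply: le_trans (_ : \sum_(s < r.+1 | (1 < s)%N) (64 * r)%:R^-1 <= _).
  apply: ler_sum => s s1; have sr : (s <= r)%N by rewrite -ltnS.
  apply: markov_nat; first by rewrite !muln_gt0 m0 (ltnW r1).
  under eq_Ex => om do rewrite natrM mulrC.
  rewrite ExZ (eq_Ex (fun om => congr1 _ (fringe_surviving id s om))) (@Ex_surviving id s) //; last first.
    by move=> y; rewrite !inE => /andP[/andP[]].
  have lam0 : 0 < (lam ^ (s - 2))%:R :> R by rewrite natrX exprn_gt0 // ltr0n.
  have sc0 : 0 < (scale g)%:R :> R by rewrite ltr0n scale_gt0.
  rewrite Q_main // mulrA ler_pdivrMr; last by rewrite natrM mulr_gt0.
  have : (#|below (root id) (candidates r G s)| <= r * lam ^ (s - 2) * (2 * m))%N.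
    have sub : below (root id) (candidates r G s) \subset candidates r G s.
      by apply/subsetP => y; rewrite inE => /andP[].
    apply: leq_trans (subset_leq_card sub) _.
    apply: leq_trans (card_candidates r out_lam out_ord s1) _.
    by rewrite lamE !leq_mul2r (leq_trans (leq_pred _) sr) !orbT.
  rewrite -(ler_nat R) !natrM => h.
  apply: le_trans (_ : (scale g)%:R * (r%:R * (lam ^ (s - 2))%:R * (2%:R * m%:R)) <= _).
    by rewrite ler_wpM2l // ltW.
  rewrite le_eqVlt; apply/orP; left; apply/eqP; field; by rewrite gt_eqF.
rewrite sumr_const -[leLHS]mulr_natl natrM invfM mulrCA ler_piMr ?invr_ge0 ?ler0n //.
rewrite ler_pdivrMr // mul1r ler_nat.
apply: leq_trans (_ : #|[pred s : 'I_r.+1 | s != ord0]| <= _)%N.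
  by apply: subset_leq_card; apply/subsetP => s; rewrite !unfold_in /=; case: s => -[].
by rewrite cardC1 card_ord.
Qed.

Lemma main_found g i F : (1 < r)%N -> (0 < F)%N ->
  (#|cliques_of_size r G r| * 64 <= F * (scale g * lam ^ (r - 2)))%N ->
  Pr R (fun om => F <= #|branches G (bits om (g, None, i)) (nil_bseq r _) r|)%N <= 64%:R^-1.
Proof.
move=> r1 F0 h; pose id : Id := (g, None, i); apply: markov_nat => //.
rewrite (eq_Ex (fun om => congr1 _ (branches_surviving id r om))) (@Ex_surviving id r) //; last first.
  by move=> y; rewrite !inE => /andP[/andP[]].
have lam0 : 0 < (lam ^ (r - 2))%:R :> R by rewrite natrX exprn_gt0 // ltr0n.
have sc0 : 0 < (scale g)%:R :> R by rewrite ltr0n scale_gt0.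
rewrite Q_main // ler_pdivrMr; last by rewrite natrM mulr_gt0.
have : (#|below (root id) (cliques_of_size r G r)| * 64 <= F * (scale g * lam ^ (r - 2)))%N.
  apply: leq_trans h; rewrite leq_mul2r; apply/orP; right.
  by apply: subset_leq_card; apply/subsetP => y; rewrite inE => /andP[].
by rewrite -(ler_nat R) !natrM; lra.
Qed.

Variable a : nat.
Hypothesis a_gt0 : (0 < a)%N.
(** The sample size at which Chebyshev's inequality yields relative error [1 / a] with failure
    probability [1 / 32]: the multiplicities cost [b * 65 ^ r.-1], the precision [a ^ 2], the
    probability 32, and a last factor 2 allows for counting only half of the cliques. *)
Definition samples : nat := (64 * a ^ 2 * b * 65 ^ r.-1)%N.

Lemma main_accurate g i (Y : {set Ch}) N : (1 < r)%N ->
  {in Y, forall y, size y == r} ->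
  (samples * (scale g * lam ^ (r - 2)) <= N)%N -> (N <= 2 * #|Y|)%N ->
  (forall x s, x \in Y -> (1 < s <= r)%N ->
     (#|[set y in Y | pre s y == pre s x]| <= lam ^ (r - s) * (2 * theta s))%N) ->
  Pr R (fun om => #|Y|%:R / (scale g * lam ^ (r - 2))%:R <=
    (a%:R : R) * `|(surviving (g, None, i) om Y)%:R -
             #|Y|%:R / (scale g * lam ^ (r - 2))%:R|) <= 32%:R^-1.
Proof.
move=> r1 YD XN NY Ymult; set id : Id := (g, None, i); set q := (scale g * lam ^ (r - 2))%N in XN *.
set mu : R := _ / _; have QE : Q id r = q by rewrite Q_main.
have q0 : (0 < q)%N by rewrite muln_gt0 scale_gt0 expn_gt0 lam_gt0.
have X0 : (0 < samples)%N by rewrite !muln_gt0 b_gt0 !expn_gt0 a_gt0.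
have Y0 : (0 < #|Y|)%N.
  by have := leq_trans XN NY; have : (0 < samples * q)%N by [rewrite muln_gt0 X0 q0]; lia.
have a0 : 0 < a%:R :> R by rewrite ltr0n.
have y0 : 0 < #|Y|%:R :> R by rewrite ltr0n.
have dE : depth id = 1%N by [].
have := @surviving_concentrated id r Y
  (fun s => lam ^ (r - s) * (2 * theta s))%N a%:R^-1 YD _ Y0.
rewrite dE QE => /(_ _ Ymult) h.
apply: le_trans (_ : _ <= (\sum_(2 <= j < r.+1) Q id j * (lam ^ (r - j) * (2 * theta j)))%N%:R /
   (a%:R^-1 ^+ 2 * #|Y|%:R)) _.
  apply: le_trans (h _); last by rewrite invr_gt0.
  by apply: Pr_sub => om; rewrite -/mu ler_pdivrMl.
have : ((\sum_(2 <= j < r.+1) Q id j * (lam ^ (r - j) * (2 * theta j))) * (32 * a ^ 2) <= #|Y|)%N.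
  rewrite big_nat (eq_bigr (fun s => q * (2 * theta s)))%N => [|s /andP[s1 sr]].
    rewrite -big_nat -big_distrr /=.
    have := sum_theta (ltnW r1); rewrite subn1 => hs.
    suff : (q * (b * 65 ^ r.-1) * (32 * a ^ 2) * 2 <= 2 * #|Y|)%N.
      by rewrite mulnC leq_pmul2l //; apply: leq_trans; rewrite leq_mul2r leq_mul2l hs !orbT.
    apply: leq_trans NY; apply: leq_trans XN; rewrite /samples.
    by move: (65 ^ _)%N (a ^ 2)%N => K K'; nia.
  by rewrite Q_main // mulnA -mulnA -mulnA [(lam ^ _ * (lam ^ _ * _))%N]mulnA -expnD mulnA; congr (_ * lam ^ _ * _)%N; lia.
rewrite -(ler_nat R) 2!natrM natrX; set S : R := _%:R => hh.
rewrite exprVn ler_pdivrMr ?mulr_gt0 ?invr_gt0 ?exprn_gt0 // mulrCA -ler_pdivrMl ?invr_gt0 ?exprn_gt0 //.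
rewrite invrK; lra.
Qed.

End Runs.

Lemma eq_grow n r (G : graph n) (beta beta' : pred (r.-bseq 'I_n)) L o :
  beta =1 beta' -> grow G beta L o = grow G beta' L o.
Proof.
move=> bb; have eqg s : grow_until G beta L s o = grow_until G beta' L s o; last exact: eqg.
elim: s => [//|s IHs].
rewrite !grow_untilS IHs; case: grow_until => //= T.
suff -> : offspring G beta (edges G) s T = offspring G beta' (edges G) s T by [].
by apply/setP => y; rewrite !inE bb.
Qed.

(** * Cliques and the chains that list them *)

Section CliqueChains.
Variables (n r : nat) (G : graph n).
Notation Ch := (r.-bseq 'I_n).
Notation N := (num_cliques G r).
Notation cliques := (cliques_of_size r G).
Hypothesis r_gt1 : (1 < r)%N.

Definition rcliques := [set K : {set 'I_n} | (#|K| == r) && is_clique G K].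

Lemma chain_rclique (x : Ch) : x \in cliques r -> [set v in x] \in rcliques.
Proof.
rewrite !inE => /andP[/eqP xr xcl]; rewrite cl_is_clique // andbT.
by rewrite cardsE -[X in _ == X]xr; apply/eqP/card_uniqP/(cl_uniq xcl).
Qed.

Lemma card_clique_chains : (#|cliques r| <= r ^ r * N)%N.
Proof.
rewrite mulnC.
apply: (@leq_card_fibers _ _ (fun x : Ch => [set v in x]) _ rcliques).
  exact: chain_rclique.
move=> K; rewrite inE => /andP[/eqP Kr _].
have K0 : K != set0 by rewrite -card_gt0 Kr ltnW.
have := card_chains_in r r K0; rewrite Kr; apply: leq_trans.
apply: subset_leq_card.
apply/subsetP => x; rewrite !inE => /andP[/andP[-> _] /eqP <-] /=.
by apply/allP => v vx /=; rewrite inE.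
Qed.

Variable out : 'I_n -> {set 'I_n}.
Hypothesis out_lam : forall v, (#|out v| <= degeneracy G)%N.
Hypothesis out_order : forall K, is_clique G K -> exists z : seq 'I_n,
  [/\ uniq z, z =i K & pairwise (fun v w => w \in out v) z].
Notation ordered := (pairwise (fun v w => w \in out v)).

Definition ordered_chain (K : {set 'I_n}) : Ch :=
  odflt (nil_bseq r _) [pick z : Ch | [&& size z == r, cl G z, [set v in z] == K & ordered z]].

Lemma ordered_chainP K : K \in rcliques ->
  [/\ size (ordered_chain K) = r, cl G (ordered_chain K),
      [set v in ordered_chain K] = K & ordered (ordered_chain K)].
Proof.
rewrite inE => /andP[/eqP Kr Kcl]; rewrite /ordered_chain; case: pickP => [z|none].
  by case/and4P => /eqP ? ? /eqP ? ?.
have [z [uz zK zo]] := out_order Kcl.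
have zr : size z = r.
  by rewrite -(card_uniqP uz) -Kr; apply: eq_card.
have zle : (size z <= r)%N by rewrite zr.
have := none (Bseq zle); rewrite /= zr eqxx zo andbT /= => /negbT/negP[].
rewrite (is_clique_cl Kcl uz) => [|v]; last by rewrite zK.
by apply/eqP/setP => v; rewrite inE zK.
Qed.

Lemma card_cliques_above (c : Ch) : (0 < size c)%N ->
  (#|[set K in rcliques | pre (size c) (ordered_chain K) == c]|
     <= degeneracy G ^ (r - size c))%N.
Proof.
move=> c0; apply: leq_trans (card_ordered_above out_lam r c0).
rewrite -(@card_in_imset _ _ ordered_chain) => [|K K']; last first.
  rewrite inE => /andP[KR _]; rewrite inE => /andP[KR' _] e.
  have [_ _ <- _] := ordered_chainP KR; rewrite e.
  by have [_ _ -> _] := ordered_chainP KR'.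
apply: subset_leq_card; apply/subsetP => _ /imsetP[K + ->].
rewrite 2!inE => /andP[KR /eqP e]; have [zr _ _ zo] := ordered_chainP KR.
by rewrite zr zo eqxx /= -val_pre e.
Qed.

(** In degeneracy order a clique starts with one of at most [2 * m] oriented edges, each having at
    most [lam ^ (r - 2)] continuations. This bounds the range of guesses, and in the space bound it
    pays for the terms of constant size. *)
Lemma num_cliques_le : (N <= 2 * #|edges G| * degeneracy G ^ (r - 2))%N.
Proof.
have c2 : (#|cliques 2| <= 2 * #|edges G|)%N.
  apply: leq_trans (subset_leq_card (_ : _ \subset candidates r G 2)) _.
    apply/subsetP => y; rewrite !inE => /andP[/eqP y2 ycl].
    by rewrite y2 cl_take // cl_last_edge ?y2.
  by have := card_candidates r out_lam out_order (ltnSn 1); rewrite subnn mul1n.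
apply: leq_trans (_ : #|cliques 2| * degeneracy G ^ (r - 2) <= _)%N; last first.
  by rewrite leq_mul2r c2 orbT.
apply: (@leq_card_fibers _ _ (fun K => pre 2 (ordered_chain K)) rcliques).
  move=> K KR; have [zr zcl _ _] := ordered_chainP KR.
  by rewrite inE pre_size ?zr // eqxx cl_take.
move=> c; rewrite inE => /andP[/eqP c2' _].
by have := @card_cliques_above c; rewrite c2'; apply.
Qed.

End CliqueChains.

(** * Reliability of the tests *)

Section Analysis.
Variables (R : realFieldType) (n r : nat) (G : graph n) (lam g0 gm k b a : nat).
Notation Ch := (r.-bseq 'I_n).
Notation m := #|edges G|.
Notation N := (num_cliques G r).
Notation cliques := (cliques_of_size r G).
Notation Om := {ffun Id n r gm k * Ch -> 'I_(width lam g0 gm).+1}.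
Notation theta := (theta r b).
Notation scale := (scale g0).
Hypothesis lam_gt0 : (0 < lam)%N.
Hypothesis b_gt0 : (0 < b)%N.
Hypothesis r_gt1 : (1 < r)%N.
Hypothesis m_gt0 : (0 < m)%N.
Implicit Types (om : Om) (id : Id n r gm k) (c x y z : Ch) (g : 'I_gm) (K : {set 'I_n}).

Definition active om g c : bool := (2 * #|[set j | bad_test G b g c om j]| < k)%N.

Definition all_active om g z : bool :=
  [forall t : 'I_r, (1 < t)%N ==> active om g (pre t z)].

(** Activity is asked of the prefixes strictly longer than [c], so that this set is independent of
    the coins of the tests of [c]. *)
Definition active_above om g c :=
  [set x in below c (cliques r) |
     [forall t : 'I_r, (size c < t)%N ==> active om g (pre t x)]].

Definition few_above om g c : bool :=
  active om g c ==>
  (#|active_above om g c| <= lam ^ (r - size c) * (2 * theta (size c)))%N.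

Definition sparse1 c : bool :=
  (#|below c (cliques r)| <= lam ^ (r - size c) * (b * 65 ^ (r - size c)))%N.

(** Guards against overflow: a test may hold too many candidates of some intermediate size even when
    few of them grow into cliques of size [r]. *)
Definition sparse2 g c (s : nat) : bool :=
  (#|below c (candidates r G s)| * scale g <= 4 * r * m * lam ^ (s - size c))%N.

Definition sparse g c : bool :=
  sparse1 c && [forall s : 'I_r.+1, (size c < s)%N ==> sparse2 g c s].

Definition prefixes := [set c : Ch | (1 < size c < r)%N && cl G c].

Definition tests_ok om g : bool :=
  [forall c in prefixes, few_above om g c && (sparse g c ==> active om g c)].

Lemma run_ext om om' id : (forall y, om (id, y) = om' (id, y)) ->
  run G om id = run G om' id.
Proof. by move=> e; apply: eq_grow => y; rewrite /bits /coin e. Qed.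

Definition kind_of (g : 'I_gm) (o : option Ch) : pred (Id n r gm k * Ch) :=
  fun i => i.1.1 == (g, o).

Lemma run_merge_in g o j om om' :
  run G (merge (kind_of g o) om om') (g, o, j) = run G om (g, o, j).
Proof. by apply: run_ext => y; rewrite ffunE /kind_of /= eqxx. Qed.

Lemma run_merge_out g o id om om' : id.1 != (g, o) ->
  run G (merge (kind_of g o) om om') id = run G om' id.
Proof. by move=> ne; apply: run_ext => y; rewrite ffunE /kind_of /= (negbTE ne). Qed.

Lemma active_merge_in g c om om' :
  active (merge (kind_of g (Some c)) om om') g c = active om g c.
Proof.
rewrite /active (eq_card (B := [set j | bad_test G b g c om j])) // => j.
by rewrite !inE /bad_test run_merge_in.
Qed.

Lemma active_merge_out g o c om om' : o != Some c ->
  active (merge (kind_of g o) om om') g c = active om' g c.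
Proof.
move=> oc; rewrite /active (eq_card (B := [set j | bad_test G b g c om' j])) // => j.
by rewrite !inE /bad_test run_merge_out // xpair_eqE eqxx /= eq_sym.
Qed.

Lemma majority_copies g o (E : 'I_k -> pred Om) :
  (forall j om om', run G om (g, o, j) = run G om' (g, o, j) -> E j om = E j om') ->
  (forall j, Pr R (E j) <= 16%:R^-1) ->
  Pr R (fun om => (k <= 2 * #|[set j | E j om]|)%N) <= 2%:R ^- k.
Proof.
move=> Erun Ep; apply: (Pr_majority (J := fun j i => i.1 == (g, o, j))) => //.
  by move=> j j' i /eqP -> /eqP[].
by move=> j om om' e; apply: Erun; apply: run_ext => y; apply: e => /=.
Qed.

(** Members of [Y] with the same prefix of size [s] are all active extensions of this prefix, which
    is itself active, so [few_above] bounds their number. For [s = r] the prefix is the whole chain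
    and the multiplicity is 1. *)
Lemma multiplicity om g (Y : {set Ch}) (t : nat) :
  (forall c, c \in prefixes -> (t < size c)%N -> few_above om g c) ->
  Y \subset cliques r ->
  {in Y, forall x s, (maxn 1 t < s < r)%N -> active om g (pre s x)} ->
  forall x s, x \in Y -> (maxn 1 t < s <= r)%N ->
    (#|[set y in Y | pre s y == pre s x]| <= lam ^ (r - s) * (2 * theta s))%N.
Proof.
move=> few Yr Yact x s xY /andP[ts]; rewrite leq_eqVlt => /predU1P[->|sr].
  apply: leq_trans (_ : #|[set x]| <= _)%N.
    apply: subset_leq_card; apply/subsetP => y.
    rewrite !inE => /andP[/(subsetP Yr)]; rewrite inE => /andP[/eqP yr _].
    have := subsetP Yr _ xY; rewrite inE => /andP[/eqP xr _].
    by rewrite !pre_full ?yr ?xr.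
  by rewrite cards1 subnn expn0 mul1n muln_gt0 theta_gt0.
have := subsetP Yr _ xY; rewrite inE => /andP[/eqP xr xcl].
have sx : size (pre s x) = s by rewrite pre_size // xr ltnW.
move: ts; rewrite gtn_max => /andP[s1 ts].
have px : pre s x \in prefixes by rewrite inE sx s1 sr cl_take.
have := few _ px; rewrite sx => /(_ ts) /implyP/(_ (Yact _ xY _ _)).
rewrite gtn_max s1 ts sr sx => /(_ isT); apply: leq_trans.
apply: subset_leq_card; apply/subsetP => y; rewrite !inE => /andP[yY yx].
have := subsetP Yr _ yY; rewrite inE => /andP[-> ->] /=; rewrite sx yx /=.
apply/forallP => u; apply/implyP => su; apply: (Yact _ yY).
by rewrite ltn_ord andbT gtn_max (ltn_trans s1 su) (ltn_trans ts su).
Qed.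

Lemma Pr_not_active g c : c \in prefixes -> sparse g c ->
  Pr R (fun om => ~~ active om g c) <= 2%:R ^- k.
Proof.
rewrite inE => /andP[cr ccl] /andP[s1 /forallP s2].
apply: le_trans (_ : Pr R (fun om => (k <= 2 * #|[set j | bad_test G b g c om j]|)%N) <= _).
  by apply: Pr_sub => om; rewrite -leqNgt.
apply: (majority_copies (g := g) (o := Some c)) => [j om om'|j].
  by rewrite /bad_test => ->.
apply: test_accepts => // s /andP[cs sr].
exact: (implyP (s2 (Ordinal (sr : (s < r.+1)%N)))).
Qed.

(** With all coins but those of the tests of [c] frozen, [active_above] is a fixed set, and
    [few_above] for longer prefixes supplies its multiplicities. If it is too large, each test of
    [c] detects it with probability at least [15 / 16], so a majority rarely misses it. *)
Lemma Pr_many_above g c : c \in prefixes ->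
  Pr R (fun om => [forall c' in prefixes, (size c < size c')%N ==> few_above om g c'] &&
                  ~~ few_above om g c) <= 2%:R ^- k.
Proof.
move=> cP; have := cP; rewrite inE => /andP[cr ccl].
apply: (Pr_freeze (J := kind_of g (Some c))) => om'.
have out om c' : (size c < size c')%N ->
    active (merge (kind_of g (Some c)) om om') g c' = active om' g c'.
  move=> cc'; apply: active_merge_out.
  by apply: contraTneq cc' => -[->]; rewrite ltnn.
have aboveE om c' : (size c <= size c')%N ->
    active_above (merge (kind_of g (Some c)) om om') g c' = active_above om' g c'.
  move=> cc'; apply/setP => x; rewrite ![_ \in active_above _ _ _]inE.
  apply: andb_id2l; rewrite inE => /andP[+ _]; rewrite inE => /andP[/eqP xr _].
  apply: eq_forallb => t; case: ltnP => //= ct.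
  by rewrite out // pre_size ?xr ?(leq_ltn_trans cc') // ltnW.
have [ok|nok] := boolP ([forall c' in prefixes, (size c < size c')%N ==> few_above om' g c'] &&
    (lam ^ (r - size c) * (2 * theta (size c)) < #|active_above om' g c|)%N); last first.
  rewrite Pr_eq0 ?invr_ge0 ?exprn_ge0 // => om.
  suff -> : [forall c' in prefixes, (size c < size c')%N ==>
     few_above (merge (kind_of g (Some c)) om om') g c'] &&
     ~~ few_above (merge (kind_of g (Some c)) om om') g c = false by [].
  apply: contraNF nok => /andP[/forall_inP few]; rewrite negb_imply aboveE // -ltnNge.
  case/andP=> _ ->; rewrite andbT; apply/forall_inP => c' c'P; apply/implyP => cc'.
  by have := implyP (few _ c'P) cc'; rewrite /few_above out // aboveE // ltnW.
case/andP: ok => /forall_inP few big.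
apply: le_trans (_ : Pr R (fun om => (k <= 2 * #|[set j | ~~ bad_test G b g c om j]|)%N) <= _).
  apply: Pr_sub => om /andP[_]; rewrite negb_imply active_merge_in => /andP[act _].
  have := cardsC [set j | bad_test G b g c om j]; rewrite card_ord.
  rewrite (eq_card (A := ~: _) (B := [set j | ~~ bad_test G b g c om j])); last first.
    by move=> j; rewrite !inE.
  by move: act; rewrite /active; lia.
apply: (majority_copies (g := g) (o := Some c)) => [j om1 om2|j].
  by rewrite /bad_test => ->.
have /andP[c1 cr'] := cr.
apply: (@test_detects R n r G lam g0 gm k b lam_gt0 b_gt0 g c j (active_above om' g c)) => //.
  by apply/subsetP => x; rewrite inE => /andP[].
have maxE := maxn_idPr (ltnW c1).
move=> x s xY cs; apply: (@multiplicity om' g _ (size c)) xY _; rewrite ?maxE //.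
- by move=> c' c'P cc'; apply: (implyP (few _ c'P)).
- by apply/subsetP => y; rewrite 2!inE => /andP[/andP[]].
move=> y; rewrite inE => /andP[_ /forallP yact] u; rewrite ?maxE => /andP[cu ur].
exact: (implyP (yact (Ordinal ur))).
Qed.

Lemma Pr_tests_fail g :
  Pr R (fun om => ~~ tests_ok om g) <= (2 * #|{: Ch}|)%:R * 2%:R ^- k.
Proof.
pose E om c := [forall c' in prefixes, (size c < size c')%N ==> few_above om g c'] &&
                  ~~ few_above om g c.
apply: le_trans (_ : Pr R (fun om => [exists c, (c \in prefixes) && E om c] ||
   [exists c, (c \in prefixes) && (sparse g c && ~~ active om g c)]) <= _).
  apply: Pr_sub => om; rewrite negb_forall_in => /exists_inP[c cP].
  rewrite negb_and negb_imply => /orP[nf|na]; last first.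
    by apply/orP; right; apply/existsP; exists c; rewrite cP.
  apply/orP; left; apply/existsP.
  have cP' : (c \in prefixes) && ~~ few_above om g c by rewrite cP.
  (* A longest offending prefix: all longer ones satisfy [few_above], as the event [E] requires. *)
  have [c' /andP[c'P nc'] cmax] := @arg_maxnP _ c
    (fun c => (c \in prefixes) && ~~ few_above om g c) (fun c : Ch => size c) cP'.
  exists c'; rewrite c'P /E nc' andbT; apply/forall_inP => d dP; apply/implyP => c'd.
  apply: contraLR c'd => nd; rewrite -leqNgt; apply: cmax; by rewrite dP.
apply: le_trans (Pr_or _ _ _) _.
have cst0 : 0 <= 2%:R ^- k :> R by rewrite invr_ge0 exprn_ge0.
have bound (A : pred Ch) (F : Ch -> R) : (forall c, A c -> F c <= 2%:R ^- k) ->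
    \sum_(c | A c) F c <= #|{: Ch}|%:R * 2%:R ^- k.
  move=> AF; apply: le_trans (ler_sum _ AF) _.
  by rewrite sumr_const -[leLHS]mulr_natl ler_wpM2r // ler_nat max_card.
rewrite natrM -mulrA [leRHS]mulr_natl mulr2n lerD //.
  by apply: le_trans (Pr_exists _ _ _) _; apply: bound => c; apply: Pr_many_above.
apply: le_trans (Pr_exists _ _ _) _; apply: bound => c cP.
have [sc|nsc] := boolP (sparse g c); first exact: Pr_not_active.
by rewrite Pr_eq0.
Qed.

End Analysis.

(** * Few cliques are lost *)

Section Counting.
Variables (n r : nat) (G : graph n) (lam g0 gm k b a : nat).
Notation Ch := (r.-bseq 'I_n).
Notation m := #|edges G|.
Notation N := (num_cliques G r).
Notation cliques := (cliques_of_size r G).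
Notation Om := {ffun Id n r gm k * Ch -> 'I_(width lam g0 gm).+1}.
Notation samples := (samples r b a).
Hypothesis lam_gt0 : (0 < lam)%N.
Hypothesis lamE : lam = degeneracy G.
Hypothesis r_gt1 : (1 < r)%N.
Hypothesis a_gt1 : (1 < a)%N.
Hypothesis m_gt0 : (0 < m)%N.
Hypothesis b_big : (2 * a * r ^ r.+1 <= b)%N.
Implicit Types (om : Om) (c x y z : Ch) (g : 'I_gm) (K : {set 'I_n}).

Definition unit_weight g : nat := (scale g0 g * lam ^ (r - 2))%N.

Definition good_order om g K : option Ch :=
  [pick z : Ch | [&& size z == r, [set v in z] == K & all_active G b om g z]].

Definition counted om g := [set x in cliques r | good_order om g [set v in x] == Some x].

Lemma good_orderP om g K z : good_order om g K = Some z ->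
  [/\ size z = r, [set v in z] = K & all_active G b om g z].
Proof.
by rewrite /good_order; case: pickP => // y /and3P[/eqP ? /eqP ? ?] [<-].
Qed.

Lemma counted_multiplicity om g : tests_ok G b om g ->
  forall x s, x \in counted om g -> (1 < s <= r)%N ->
  (#|[set y in counted om g | pre s y == pre s x]| <=
     lam ^ (r - s) * (2 * theta r b s))%N.
Proof.
move=> /forall_inP ok x s xc sr.
have b0 : (0 < b)%N by apply: leq_trans b_big; rewrite !muln_gt0 expn_gt0 /=; lia.
apply: (@multiplicity n r G lam g0 gm k b b0 om g _ 1) xc sr => //.
- by move=> c cP _; have /andP[] := ok c cP.
- by apply/subsetP => y; rewrite inE => /andP[].
move=> y; rewrite inE => /andP[_ /eqP e] u /andP[u1 ur].
have [_ _ /forallP act] := good_orderP e; exact: (implyP (act (Ordinal ur))).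
Qed.

Definition lost om g := [set K in rcliques r G | good_order om g K == None].

Lemma counted_lost om g : (N <= #|counted om g| + #|lost om g|)%N.
Proof.
rewrite -[leqLHS]/#|rcliques r G| -(cardsID (lost om g) (rcliques r G)) addnC.
apply: leq_add; last by apply: subset_leq_card; apply/subsetP => K; rewrite inE => /andP[].
pose f K := odflt (nil_bseq r _) (good_order om g K).
have fP K : K \in rcliques r G :\: lost om g ->
    [/\ good_order om g K = Some (f K), size (f K) = r, [set v in f K] = K & (#|K| == r) && is_clique G K].
  rewrite inE => /andP[+ KR]; rewrite inE KR /= /f; move: KR; rewrite inE => Kcl.
  by case E: (good_order om g K) => [z|//] _; have [? ? _] := good_orderP E.
rewrite -(@card_in_imset _ _ f) => [|K K' /fP[_ _ fK _] /fP[_ _ fK' _] e]; last first.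
  by rewrite -fK e.
apply: subset_leq_card; apply/subsetP => _ /imsetP[K /fP[e fr fK Kcl] ->].
rewrite 2!inE fK e eqxx andbT fr eqxx /=; have /andP[/eqP Kr Kcl'] := Kcl.
apply: (is_clique_cl Kcl') => [|v vf]; last by rewrite -fK inE.
by apply/card_uniqP; rewrite -(cardsE (mem (f K))) fK Kr fr.
Qed.

(** Each chain has at most one prefix of each size below [r]. *)
Lemma sum_below (U : {set Ch}) :
  (\sum_(c in prefixes r G) #|below c U| <= r * #|U|)%N.
Proof.
apply: leq_trans (_ : \sum_(y in U) #|[set c in prefixes r G | pre (size c) y == c]| <= _)%N.
  rewrite (eq_bigr (fun c => \sum_(y in U) (pre (size c) y == c : nat)))%N; last first.
    move=> c _; rewrite -sum1_card [LHS]big_mkcond [RHS]big_mkcond; apply: eq_bigr => y _.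
    by rewrite inE; case: (y \in U); case: eqP.
  rewrite exchange_big /=; apply: leq_sum => y _.
  rewrite -sum1_card [X in (X <= _)%N]big_mkcond [X in (_ <= X)%N]big_mkcond; apply: leq_sum => c _.
  by rewrite inE; case: (c \in prefixes r G); case: eqP.
rewrite mulnC -sum_nat_const; apply: leq_sum => y _.
have r0 : (0 < r)%N by apply: ltnW.
pose f c : 'I_r := insubd (Ordinal r0) (size c).
rewrite -(@card_in_imset _ _ f) => [|c d].
  by apply: leq_trans (max_card _) _; rewrite card_ord.
rewrite inE => /andP[cP /eqP yc]; rewrite inE => /andP[dP /eqP yd].
move: cP dP; rewrite inE => /andP[/andP[_ cr] _]; rewrite inE => /andP[/andP[_ dr] _].
by move=> /(congr1 val); rewrite !insubdK // => e; rewrite -yc -yd e.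
Qed.

(** The degeneracy order of a lost clique has an inactive, hence not sparse, prefix [c], shared by
    at most [lam ^ (r - size c)] cliques. Violations of [sparse1] are charged to the clique chains
    above [c], those of [sparse2] to the candidates, whose number [card_candidates] bounds. The
    choices of [b] and [samples] keep each part below [N / (2 * a)]. *)
Lemma lost_le om g : tests_ok G b om g -> (samples * unit_weight g <= N)%N ->
  (a * #|lost om g| <= N)%N.
Proof.
move=> /forall_inP ok XN.
have [out [out_lam out_ord]] := degeneracy_orientation G.
pose NS (c : Ch) := (c \in prefixes r G) && ~~ sparse G lam g0 b g c.
have lostS : (#|lost om g| <= \sum_(c | NS c) lam ^ (r - size c))%N.
  apply: leq_trans (_ : \sum_(K in rcliques r G) \sum_(c | NS c)
      (pre (size c) (ordered_chain r G out K) == c : nat) <= _)%N.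
    rewrite -sum1_card [X in (X <= _)%N]big_mkcond [X in (_ <= X)%N]big_mkcond; apply: leq_sum => K _.
    rewrite inE; case: (boolP (K \in rcliques r G)) => //= KR.
    case: eqP => // nog; have [zr zcl zK _] := ordered_chainP out_ord KR.
    set z := ordered_chain r G out K in zr zcl zK *.
    have : ~~ all_active G b om g z.
      apply/negP => act; move: nog; rewrite /good_order; case: pickP => // /(_ z).
      by rewrite zr zK !eqxx act.
    rewrite negb_forall => /existsP[t]; rewrite negb_imply => /andP[t1 nact].
    have st : size (pre t z) = t by rewrite pre_size // zr ltnW.
    have tP : pre t z \in prefixes r G by rewrite inE st t1 ltn_ord cl_take.
    have tNS : NS (pre t z).
      rewrite /NS tP; apply: contra nact => sp.
      by have /andP[_ /implyP] := ok _ tP; apply.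
    by rewrite (bigD1 (pre t z)) //= st eqxx.
  rewrite exchange_big /=; apply: leq_sum => c /andP[]; rewrite inE => /andP[/andP[c1 _] _] _.
  rewrite lamE; apply: leq_trans (card_cliques_above out_lam out_ord (ltnW c1)).
  rewrite -sum1_card [X in (X <= _)%N]big_mkcond [X in (_ <= X)%N]big_mkcond; apply: leq_sum => K _.
  by rewrite inE; case: (K \in rcliques r G); case: eqP.
pose S1 := (\sum_(c in prefixes r G | ~~ sparse1 G lam b c) lam ^ (r - size c))%N.
pose S2 s := (\sum_(c in prefixes r G | (size c < s)%N && ~~ sparse2 G lam g0 g c s)
  lam ^ (r - size c))%N.
have split12 : (\sum_(c | NS c) lam ^ (r - size c) <= S1 + \sum_(s < r.+1) S2 s)%N.
  rewrite /S1 /S2 (exchange_big_dep (mem (prefixes r G))) /= => [|s c _ /andP[]//].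
  rewrite big_mkcond [X in (_ <= X + _)%N]big_mkcond [X in (_ <= _ + X)%N]big_mkcond.
  rewrite -big_split; apply: leq_sum => c _ /=; rewrite /NS.
  case: (boolP (c \in prefixes r G)) => //= cP.
  rewrite /sparse negb_and; case: (boolP (sparse1 G lam b c)) => //= _; last by rewrite leq_addr.
  rewrite negb_forall; case: ifP => // /existsP[s]; rewrite negb_imply => sP.
  by rewrite (bigD1 s) //= leq_addr.
have S1b : (S1 * b <= r * (r ^ r * N))%N.
  apply: leq_trans (_ : r * #|cliques r| <= _)%N; last first.
    by rewrite leq_mul2l card_clique_chains ?orbT.
  apply: leq_trans (sum_below _).
  rewrite /S1 big_distrl /= [X in (_ <= X)%N](bigID (fun c => sparse1 G lam b c)) /=.
  apply: leq_trans (leq_addl _ _); apply: leq_sum => c /andP[_].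
  rewrite /sparse1 -ltnNge => /ltnW; apply: leq_trans.
  by rewrite leq_mul2l leq_pmulr ?orbT ?expn_gt0.
have S2b (s : 'I_r.+1) : (S2 s * 2 <= r * unit_weight g)%N.
  have [s1|s1] := leqP s 1.
    rewrite /S2 big1 // => c /andP[]; rewrite inE => /andP[/andP[c1 _] _] /andP[cs _].
    by have := leq_trans (ltn_trans c1 cs) s1.
  suff : (S2 s * (4 * r * m) <= lam ^ (r - s) * scale g0 g * (r * #|candidates r G s|))%N.
    have := card_candidates r out_lam out_ord s1; rewrite -lamE => cand h.
    have {}h := leq_trans h (leq_mul (leqnn _) (leq_mul (leqnn _) cand)).
    have sr : (s.-1 <= r)%N by apply: leq_trans (leq_pred _) _; rewrite -ltnS.
    have e : (lam ^ (r - 2) = lam ^ (r - s) * lam ^ (s - 2))%N.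
      by rewrite -expnD; congr (_ ^ _)%N; have := ltn_ord s; lia.
    rewrite -(leq_pmul2r (_ : 0 < 2 * r * m)%N) ?muln_gt0 ?m_gt0 ?(ltnW r_gt1) //.
    rewrite /unit_weight e.
    move: h; move: (lam ^ (r - s))%N (lam ^ (s - 2))%N => A B h.
    have -> : (S2 s * 2 * (2 * r * m) = S2 s * (4 * r * m))%N by lia.
    apply: leq_trans h _.
    have -> : (A * scale g0 g * (r * (s.-1 * B * (2 * m))) = s.-1 * (A * B * scale g0 g * 2 * m * r))%N by lia.
    have -> : (r * (scale g0 g * (A * B)) * (2 * r * m) = r * (A * B * scale g0 g * 2 * m * r))%N by lia.
    by rewrite leq_mul2r sr orbT.
  apply: leq_trans (_ : lam ^ (r - s) * scale g0 g * \sum_(c in prefixes r G) #|below c (candidates r G s)| <= _)%N.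
    rewrite /S2 big_distrl big_distrr /= [X in (_ <= X)%N](bigID (fun c : Ch => (size c < s)%N && ~~ sparse2 G lam g0 g c s)) /=.
    apply: leq_trans (leq_addr _ _); apply: leq_sum => c /andP[_ /andP[cs]].
    rewrite /sparse2 -ltnNge => /ltnW h.
    have -> : (r - size c = (r - s) + (s - size c))%N by have := ltn_ord s; lia.
    rewrite expnD; move: h; move: (lam ^ (s - size c))%N (lam ^ (r - s))%N => B A h.
    have -> : (A * B * (4 * r * m) = A * (4 * r * m * B))%N by lia.
    have := leq_mul (leqnn A) h; move: (#|below _ _|) (scale _ _) => F S.
    lia.
  by rewrite leq_mul2l sum_below orbT.
have S2t : (\sum_(s < r.+1) S2 s <= r ^ 2 * unit_weight g)%N.
  have : (\sum_(s < r.+1) S2 s * 2 <= \sum_(s < r.+1) r * unit_weight g)%N.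
    by apply: leq_sum => s _; apply: S2b.
  rewrite -big_distrl sum_nat_const card_ord /= -mulnn; nia.
have X2 : (2 * a * r ^ 2 <= samples)%N.
  rewrite /samples; apply: leq_trans (_ : 2 * a * r ^ r.+1 <= _)%N.
    by rewrite leq_mul2l leq_pexp2l ?orbT // ?(ltnW r_gt1) // ltnW // ltnS.
  apply: leq_trans b_big _; rewrite -mulnA mulnCA leq_pmulr //.
  by rewrite !muln_gt0 !expn_gt0 (ltnW a_gt1).
have l1 : (2 * (a * S1) <= N)%N.
  have p0 : (0 < r ^ r.+1)%N by rewrite expn_gt0 ltnW.
  rewrite -(leq_pmul2r p0); apply: leq_trans (_ : S1 * b <= _)%N.
    apply: leq_trans (leq_mul (leqnn S1) b_big); lia.
  by apply: leq_trans S1b _; rewrite expnS mulnA mulnC.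
have l2 : (2 * (a * \sum_(s < r.+1) S2 s) <= N)%N.
  apply: leq_trans XN; apply: leq_trans (leq_mul X2 (leqnn _)).
  by apply: leq_trans (leq_mul (leqnn 2) (leq_mul (leqnn a) S2t)) _; lia.
have := leq_mul (leqnn a) (leq_trans lostS split12); lia.
Qed.

End Counting.

(** * Choosing among the guesses *)

Section Verdict.
Variables (R : realFieldType) (n r : nat) (G : graph n) (lam g0 gm k b a : nat).
Notation Ch := (r.-bseq 'I_n).
Notation m := #|edges G|.
Notation N := (num_cliques G r).
Notation cliques := (cliques_of_size r G).
Notation Om := {ffun Id n r gm k * Ch -> 'I_(width lam g0 gm).+1}.
Notation samples := (samples r b a).
Notation weight := (unit_weight r lam g0).
Notation counted := (counted G b).
Notation tests_ok := (tests_ok G b).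
Implicit Types (om : Om) (c x y z : Ch) (g : 'I_gm) (K : {set 'I_n}).

(** For the largest admissible guess at most [2 * samples * r ^ r] clique chains are expected; 64
    times that leaves failure probability [1 / 64]. The cap limits how many prefixes have to be
    tested. *)
Definition found_cap : nat := (128 * samples * r ^ r)%N.

(** [Y] stands for the counted chains. As a parameter, it separates the coins of the sampling runs
    from those of the tests, on which the counted chains depend. *)
Definition outcome_with (Y : {set Ch}) om g i : option nat :=
  if run G om (g, None, i) is Some T then
    if (found_cap < #|T|)%N then None else Some #|T :&: Y|
  else None.

Definition outcome om g i := outcome_with (counted om g) om g i.

(* [z] found chains of weight [weight g] approximate the count [N0] up to a
   relative error [2 / a]. *)
Definition near g (N0 z : nat) : bool :=
  ((a * N0 <= a * z * weight g + 2 * N0) && (a * z * weight g <= a * N0 + 2 * N0))%N.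

Definition votes (oc : 'I_gm -> 'I_k -> option nat) g (N0 : nat) : bool :=
  (k < 2 * #|[set i | if oc g i is Some z then near g N0 z else false]|)%N.

Definition verdict oc g : option 'I_(2 ^ n).+1 :=
  [pick N0 : 'I_(2 ^ n).+1 | votes oc g N0].

Definition result oc : nat :=
  if [pick g | verdict oc g && [forall g' : 'I_gm, (g' < g)%N ==> ~~ verdict oc g']]
    is Some g then oapp val 0%N (verdict oc g) else 0%N.

Lemma eq_result oc oc' : oc =2 oc' -> result oc = result oc'.
Proof.
move=> e; have ev : verdict oc =1 verdict oc'.
  move=> g; apply: eq_pick => N0; rewrite /votes; congr (_ < 2 * _)%N.
  by apply: eq_card => i; rewrite !inE e.
rewrite /result (eq_pick (Q := fun g => verdict oc' g &&
    [forall g' : 'I_gm, (g' < g)%N ==> ~~ verdict oc' g'])); last first.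
  by move=> g; rewrite /= ev; congr andb; apply: eq_forallb => g'; rewrite ev.
by case: pickP => // g _; rewrite ev.
Qed.

(** What follows for [N0] when one number of found chains is [near] both [N0] and the true count. *)
Definition close (N0 : nat) : bool :=
  ((a * N0 <= a * N + 2 * N + 2 * N0) && (a * N <= a * N0 + 2 * N0 + 2 * N))%N.

Hypothesis lam_gt0 : (0 < lam)%N.
Hypothesis lamE : lam = degeneracy G.
Hypothesis r_gt1 : (1 < r)%N.
Hypothesis a_gt1 : (1 < a)%N.
Hypothesis m_gt0 : (0 < m)%N.
Hypothesis b_big : (2 * a * r ^ r.+1 <= b)%N.

Let b_gt0 : (0 < b)%N.
Proof. by apply: leq_trans b_big; rewrite !muln_gt0 expn_gt0 /=; lia. Qed.

Let a_gt0 : (0 < a)%N := ltnW a_gt1.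

(** What the accuracy of a sampling run needs to know about the counted chains, stated for a
    deterministic set: at most a fraction [1 / a] is missing and prefixes are shared by few. *)
Definition target (Y : {set Ch}) : Prop :=
  [/\ Y \subset cliques r, (#|Y| <= N)%N, (a * N <= a * #|Y| + N)%N &
      forall x s, x \in Y -> (1 < s <= r)%N ->
        (#|[set y in Y | pre s y == pre s x]| <= lam ^ (r - s) * (2 * theta r b s))%N].

Lemma counted_target om g : tests_ok om g -> (samples * weight g <= N)%N ->
  target (counted om g).
Proof.
move=> ok XN; split.
- by apply/subsetP => x; rewrite inE => /andP[].
- rewrite -(@card_in_imset _ _ (fun x : Ch => [set v in x])) => [|x y].
    apply: subset_leq_card; apply/subsetP => _ /imsetP[x + ->].
    by rewrite [x \in _]inE => /andP[xr _]; exact: chain_rclique xr.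
  rewrite inE => /andP[_ /eqP ex]; rewrite inE => /andP[_ /eqP ey] e.
  by move: ex; rewrite e ey => -[].
- have h := lost_le lam_gt0 lamE r_gt1 a_gt1 m_gt0 b_big ok XN.
  have h' := counted_lost G b om g.
  by apply: leq_trans (leq_mul (leqnn a) h') _; rewrite mulnDr leq_add2l.
exact: (counted_multiplicity lam_gt0 lamE r_gt1 a_gt1 m_gt0 b_big ok).
Qed.

(** Freezing all coins except those of the sampling runs of guess [g] fixes the tests, hence the
    counted chains; the copies are then independent and a majority bound applies. *)
Lemma Pr_copies g (P : pred (option nat)) : (samples * weight g <= N)%N ->
  (forall Y i, target Y -> Pr R (fun om => P (outcome_with Y om g i)) <= 16%:R^-1) ->
  Pr R (fun om => tests_ok om g && (k <= 2 * #|[set i | P (outcome om g i)]|)%N) <= 2%:R ^- k.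
Proof.
move=> XN PY; apply: (Pr_freeze (J := kind_of g None)) => om'.
have actE om c : active G b (merge (kind_of g None) om om') g c = active G b om' g c.
  exact: active_merge_out.
have okE om : tests_ok (merge (kind_of g None) om om') g = tests_ok om' g.
  apply: eq_forallb => c; rewrite /few_above actE.
  rewrite (_ : active_above _ _ _ _ _ = active_above G b om' g c) //.
  by apply/setP => x; rewrite [LHS]inE [RHS]inE; congr andb; apply: eq_forallb => t; rewrite actE.
have countE om : counted (merge (kind_of g None) om om') g = counted om' g.
  apply/setP => x; rewrite [LHS]inE [RHS]inE; congr (_ && (_ == _)).
  by apply: eq_pick => z; rewrite /all_active; congr [&& _, _ & _]; apply: eq_forallb => t; rewrite actE.
have [ok|nok] := boolP (tests_ok om' g); last first.
  by rewrite Pr_eq0 ?invr_ge0 ?exprn_ge0 // => om; rewrite okE (negbTE nok).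
pose Y := counted om' g.
apply: le_trans (_ : Pr R (fun om => (k <= 2 * #|[set i | P (outcome_with Y om g i)]|)%N) <= _).
  have e om : #|[set i | P (outcome (merge (kind_of g None) om om') g i)]| =
      #|[set i | P (outcome_with Y om g i)]|.
    have oE i : outcome (merge (kind_of g None) om om') g i = outcome_with Y om g i.
      by rewrite /outcome countE /outcome_with run_merge_in.
    by apply: eq_card => i; rewrite [LHS]in_set [RHS]in_set oE.
  apply: Pr_sub => om.
  case/andP => _.
  move/leq_trans; apply.
  rewrite leq_mul2l /=.
  by apply: eq_leq; apply: e.
apply: (majority_copies (G := G) (g := g) (o := None)) => [i om1 om2|i].
  by rewrite /outcome_with => ->.
exact: PY (counted_target ok XN).
Qed.

(** Lost cliques and sampling each contribute a relative error [1 / a], together the [2 / a] of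
    [near]. *)
Lemma near_concentrated g (Y : {set Ch}) (Z : nat) : target Y ->
  a%:R * `|Z%:R - #|Y|%:R / (weight g)%:R| < #|Y|%:R / (weight g)%:R :> R -> near g N Z.
Proof.
move=> [_ YN NY _].
have q0 : 0 < (weight g)%:R :> R by rewrite ltr0n muln_gt0 scale_gt0 expn_gt0 lam_gt0.
move: q0; rewrite /near; move: (weight g) => q q0.
rewrite ltr_pdivlMr // -mulrA -[X in `|_| * X](gtr0_norm q0) -normrM mulrBl divfK ?gt_eqF //.
move=> h; have a0 : 0 < a%:R :> R by rewrite ltr0n.
set d : R := Z%:R * q%:R - #|Y|%:R in h.
have d1 : a%:R * d <= a%:R * `|d| by rewrite ler_pM2l // ler_norm.
have d2 : a%:R * - d <= a%:R * `|d| by rewrite ler_pM2l // -normrN ler_norm.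
have h1 : (a * Z * q <= a * #|Y| + #|Y|)%N.
  by rewrite -(ler_nat R) natrD !natrM; move: h d1 d2; move: (`|d|) => u; rewrite /d; lra.
have h2 : (a * #|Y| <= a * Z * q + #|Y|)%N.
  by rewrite -(ler_nat R) natrD !natrM; move: h d1 d2; move: (`|d|) => u; rewrite /d; lra.
apply/andP; split; last by nia.
move: h2 NY YN; move: (a * Z * q)%N #|Y| => u v h2 NY YN.
rewrite -(leq_pmul2l a_gt0); nia.
Qed.

(** [strict] makes an overflow count as a miss. This is required at the largest admissible guess,
    which must produce a verdict; at smaller guesses an overflow only withholds a vote. *)
Definition misses g (strict : bool) (o : option nat) : bool :=
  if o is Some z then ~~ near g N z else strict.

Lemma Pr_misses g i (Y : {set Ch}) (strict : bool) : target Y -> (samples * weight g <= N)%N ->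
  (strict -> N <= 2 * samples * weight g)%N ->
  Pr R (fun om => misses g strict (outcome_with Y om g i)) <= 16%:R^-1.
Proof.
move=> YT XN NX; have [YC YN NY Ymult] := YT.
pose mu : R := #|Y|%:R / (weight g)%:R.
pose id : Id n r gm k := (g, None, i).
have conc : Pr R (fun om => mu <= a%:R * `|(surviving id om Y)%:R - mu|) <= 32%:R^-1.
  apply: (@main_accurate R n r lam g0 gm k b lam_gt0 b_gt0 a a_gt0 g i Y N r_gt1 _ XN _ Ymult).
    by move=> y /(subsetP YC); rewrite inE => /andP[].
  move: NY a_gt1; clear; nia.
have survE om T : run G om id = Some T -> #|T :&: Y| = surviving id om Y.
  rewrite /id; case: (run_main G g om i r_gt1) => [->|[-> //]] [<-].
  apply: eq_card => y; rewrite !inE andbC; apply: andb_id2l => yY.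
  have := subsetP YC _ yY; rewrite inE => /andP[-> ->] /=.
  by rewrite -[pre 0 y]/(pre 0 y) (_ : pre 0 y = nil_bseq r _) ?eqxx //; apply: val_inj; rewrite /= take0.
case: strict NX => NX; last first.
  apply: le_trans (_ : Pr R (fun om => mu <= a%:R * `|(surviving id om Y)%:R - mu|) <= _); last first.
    by apply: le_trans conc _; lra.
  apply: Pr_sub => om; rewrite /outcome_with; case E: (run G om (g, None, i)) => [T|//].
  case: ifP => // _ /=; rewrite (survE om T E); apply: contraNT; rewrite -ltNge.
  exact: near_concentrated.
have F0 : (0 < found_cap)%N.
  by rewrite !muln_gt0 expn_gt0 b_gt0 !expn_gt0 a_gt0 (ltnW r_gt1).
apply: le_trans (_ : Pr R (fun om => ((run G om id == None) ||
    (found_cap <= #|branches G (bits om id) (nil_bseq r _) r|)%N) ||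
    (mu <= a%:R * `|(surviving id om Y)%:R - mu|)) <= _).
  apply: Pr_sub => om; rewrite /outcome_with.
  rewrite /id; case E: (run G om (g, None, i)) => [T|]; last by [].
  have Tb : T = branches G (bits om id) (nil_bseq r _) r.
    by move: E; case: (run_main G g om i r_gt1) => [->|[-> //]] [<-].
  case: ifP => [/ltnW|_ /=]; first by rewrite Tb => ->; rewrite orbT.
  rewrite (survE om T E) => h; apply/orP; right; apply: contraNT h; rewrite -ltNge.
  exact: near_concentrated.
apply: le_trans (Pr_or _ _ _) _.
(* One half pays for the deviation; the other is split between exceeding the memory allowance and
   exceeding [found_cap]. *)
rewrite (_ : 16^-1 = 32^-1 + 32^-1 :> R); last by field.
apply: lerD => //; apply: le_trans (Pr_or _ _ _) _.
rewrite (_ : 32^-1 = 64^-1 + 64^-1 :> R); last by field.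
apply: lerD; first exact: main_overflow.
apply: main_found => //.
apply: leq_trans (leq_mul (card_clique_chains G r_gt1) (leqnn _)) _.
have := leq_mul (leqnn (r ^ r * 64)) (NX isT).
by rewrite /found_cap -/(weight g); lia.
Qed.

Lemma weight_le g g' : (g <= g')%N -> (weight g <= weight g')%N.
Proof.
by move=> gg'; rewrite leq_mul2r leq_exp2l // leq_add2l gg' orbT.
Qed.

(** The guess [gs] has a verdict, so the winning guess is at most [gs]. There more than half of the
    copies vote for the winner and fewer than half miss the true count, so some copy is near
    both. *)
Lemma result_close om gs : (samples * weight gs <= N)%N ->
  (forall g, (g <= gs)%N -> 2 * #|[set i | misses g false (outcome om g i)]| < k)%N ->
  (2 * #|[set i | misses gs true (outcome om gs i)]| < k)%N ->
  close (result (outcome om)).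
Proof.
move=> XN few few'.
have N2 : (N < (2 ^ n).+1)%N.
  rewrite ltnS; apply: leq_trans (max_card _) _.
  by rewrite -cardsT -powersetT card_powerset cardsT card_ord.
have vs : verdict (outcome om) gs.
  rewrite /verdict; case: pickP => // /(_ (Ordinal N2)) /negP[] /=.
  have := cardsC [set i | misses gs true (outcome om gs i)]; rewrite card_ord.
  rewrite /votes (eq_card (A := ~: _) (B := [set i | if outcome om gs i is Some z then near gs N z else false])).
    by move: few'; lia.
  by move=> i; rewrite !inE /misses; case: outcome => // z; rewrite negbK.
rewrite /result; case: pickP => [g /andP[vg /forallP gmin]|none]; last first.
  have [g vg gmin] := @arg_minnP _ gs (fun g => verdict (outcome om) g) (fun g : 'I_gm => g : nat) vs.
  have /negP[] := negbT (none g); rewrite vg; apply/forallP => g'; apply/implyP => g'g.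
  by apply: contraTN g'g => vg'; rewrite -leqNgt gmin.
have ggs : (g <= gs)%N.
  rewrite leqNgt; apply/negP => h; by have := implyP (gmin gs) h; rewrite vs.
move: vg; rewrite /verdict; case: pickP => // N0 vN _ /=.
have [i] : exists i, i \in [set i | if outcome om g i is Some z then near g N0 z else false]
    :\: [set i | misses g false (outcome om g i)].
  apply/card_gt0P; rewrite cardsD subn_gt0.
  apply: leq_ltn_trans (subset_leq_card (subsetIr _ _)) _.
  by move: vN (few g ggs); rewrite /votes; lia.
rewrite !inE; case: outcome => [z|]; rewrite /= ?andbF // negbK.
case/andP=> /andP[h1 h2] /andP[h3 h4]; apply/andP; split; lia.
Qed.

(** The reference guess [gs] is the largest one whose expected sample still suffices; since the next
    one fails, the sample is within a factor 2 of [samples]. A union bound covers the tests and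
    ordinary misses of all admissible guesses and the strict misses at [gs]. *)
Lemma Pr_result : (0 < gm)%N ->
  (samples * (2 ^ g0 * lam ^ (r - 2)) <= N < samples * (2 ^ (g0 + gm) * lam ^ (r - 2)))%N ->
  Pr R (fun om => ~~ close (result (outcome om))) <= (gm * (2 * #|{: Ch}| + 2))%:R * 2%:R ^- k.
Proof.
move=> gm0 /andP[Nlo Nhi].
pose ok (g : 'I_gm) := (samples * weight g <= N)%N.
have ok0 : ok (Ordinal gm0) by rewrite /ok /unit_weight /scale addn0.
have [gs oks gmax] := @arg_maxnP _ (Ordinal gm0) ok (fun g : 'I_gm => g : nat) ok0.
have Ns : (N <= 2 * samples * weight gs)%N.
  have e : (2 * samples * weight gs = samples * (2 ^ (g0 + gs.+1) * lam ^ (r - 2)))%N.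
    by rewrite /unit_weight /scale addnS expnS; lia.
  have [gs1|gs1] := ltnP gs.+1 gm; last first.
    have -> : (2 * samples * weight gs = samples * (2 ^ (g0 + gm) * lam ^ (r - 2)))%N.
      by rewrite e (_ : gs.+1 = gm) //; apply/eqP; rewrite eqn_leq gs1 ltn_ord.
    exact: ltnW.
  rewrite e leqNgt; apply/negP => h.
  by have /gmax : ok (Ordinal gs1) := ltnW h; rewrite /= ltnn.
pose W g om := tests_ok om g && (k <= 2 * #|[set i | misses g false (outcome om g i)]|)%N.
apply: le_trans (_ : Pr R (fun om => [exists g, ok g && (~~ tests_ok om g || W g om)] ||
  (tests_ok om gs && (k <= 2 * #|[set i | misses gs true (outcome om gs i)]|)%N)) <= _).
  apply: Pr_sub => om; apply: contraNT; rewrite negb_or => /andP[/existsPn h1 h2].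
  have oktest g : ok g -> tests_ok om g /\
      (2 * #|[set i | misses g false (outcome om g i)]| < k)%N.
    move=> okg; have := h1 g; rewrite okg /= negb_or negbK => /andP[tg].
    by rewrite /W tg /= -ltnNge.
  apply: (result_close oks) => [g ggs|].
    apply: (oktest g _).2; apply: leq_trans oks.
    by rewrite leq_mul2l weight_le ?orbT.
  by move: h2; rewrite (oktest gs oks).1 /= -ltnNge.
have cst0 : 0 <= 2%:R ^- k :> R by rewrite invr_ge0 exprn_ge0.
apply: le_trans (Pr_or _ _ _) _.
apply: le_trans (_ : (gm * (2 * #|{: Ch}| + 1))%:R * 2%:R ^- k + 2%:R ^- k <= _); last first.
  rewrite -{2}[2%:R ^- k]mul1r -mulrDl ler_wpM2r // -(natrD _ _ 1) ler_nat; nia.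
apply: lerD; last first.
  apply: Pr_copies => // Y i YT; apply: Pr_misses => //.
apply: le_trans (Pr_exists _ _ _) _.
apply: le_trans (_ : \sum_(g | ok g) (2 * #|{: Ch}| + 1)%:R * 2%:R ^- k <= _).
  apply: ler_sum => g okg; apply: le_trans (Pr_or _ _ _) _.
  rewrite natrD mulrDl mul1r; apply: lerD; first exact: Pr_tests_fail.
  by apply: Pr_copies => // Y i YT; apply: Pr_misses.
rewrite sumr_const -[leLHS]mulr_natl mulrA -natrM ler_wpM2r // ler_nat leq_mul2r.
by apply/orP; right; apply: leq_trans (max_card _) _; rewrite card_ord.
Qed.

End Verdict.

(** * Streaming algorithms as machines with finitely many states *)

Lemma last_scanl (A B : Type) (f : A -> B -> A) x s :
  last x (scanl f x s) = foldl f x s.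
Proof. by elim: s x => //= y s IHs x; rewrite IHs. Qed.

Lemma mem_scanl (A : eqType) (B : Type) (f : A -> B -> A) x s y :
  y \in x :: scanl f x s -> exists2 l, (l <= size s)%N & y = foldl f x (take l s).
Proof.
elim: s x => [|z s IHs] x; rewrite inE => /predU1P[->|//].
- by exists 0%N.
- by exists 0%N.
by case/IHs=> l ls ->; exists l.+1.
Qed.

(* A streaming algorithm may be described by a machine with finitely many
   states, any injective encoding of the states providing its memory. *)
Section Machine.
Variables (R : realType) (n : nat) (St Om : finType).
Variables (st0 : St) (next : St -> option {set 'I_n} -> Om -> St) (read : St -> R).
Variable enc : St -> seq bool.
Hypothesis enc_inj : injective enc.
Hypothesis Om_gt0 : (0 < #|Om|)%N.

Definition dec (M : seq bool) : St := odflt st0 [pick st | enc st == M].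

Lemma encK st : dec (enc st) = st.
Proof.
rewrite /dec; case: pickP => [st' /eqP/enc_inj //|/(_ st)].
by rewrite eqxx.
Qed.

Lemma card_prednK : #|Om| = (#|Om|.-1).+1.
Proof. by rewrite prednK. Qed.

Definition draw_val (c : 'I_(#|Om|.-1).+1) : Om := enum_val (cast_ord (esym card_prednK) c).
Definition draw_rank (x : Om) : 'I_(#|Om|.-1).+1 := cast_ord card_prednK (enum_rank x).

Lemma draw_rankK : cancel draw_rank draw_val.
Proof. by move=> x; rewrite /draw_val cast_ordK enum_rankK. Qed.

Lemma draw_valK : cancel draw_val draw_rank.
Proof. by move=> c; rewrite /draw_rank enum_valK cast_ordKV. Qed.

Definition machine_alg : stream_alg R n :=
  StreamAlg (enc st0) (fun M sym c => enc (next (dec M) sym (draw_val c)))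
    (fun M => read (dec M)).

Variables (k : nat) (s : seq {set 'I_n}).
Notation draws := (draws machine_alg k s).
Implicit Types w : draws.

Definition draw_at w (l : nat) : Om :=
  nth (draw_val ord0) (map draw_val w) l.

Fixpoint state_after w (l : nat) : St :=
  if l is l'.+1 then next (state_after w l') (nth None (tape k s) l') (draw_at w l')
  else st0.

Lemma foldl_enc w l : (l <= size (tape k s))%N ->
  foldl (fun M p => @step _ _ machine_alg M p.1 p.2) (init machine_alg)
    (take l (zip (tape k s) w)) = enc (state_after w l).
Proof.
elim: l => [|l IHl] lt; first by rewrite take0.
have sz : size (zip (tape k s) w) = size (tape k s).
  by rewrite size_zip size_tuple minnn.
rewrite (take_nth (None, ord0)) ?sz // foldl_rcons IHl ?(ltnW lt) // nth_zip ?size_tuple //=.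
rewrite encK /draw_at (nth_map ord0) ?size_tuple //.
Qed.

Lemma output_machine w : output w = read (state_after w (size (tape k s))).
Proof.
rewrite /output /memories last_scanl -[zip _ _]take_size.
rewrite size_zip size_tuple minnn foldl_enc //=.
by rewrite encK.
Qed.

Lemma space_machine B : (forall w l, (l <= size (tape k s))%N ->
    (size (enc (state_after w l)) <= B)%N) ->
  (space_bits machine_alg k s <= B)%N.
Proof.
move=> sB; apply/bigmax_leqP => w _; apply/bigmax_leqP_seq => M MM _.
have [l lz ->] := mem_scanl MM; move: lz; rewrite size_zip size_tuple minnn => lz.
by rewrite foldl_enc // sB.
Qed.

End Machine.

(* Reading the [i]-th coin of a fresh uniform draw made at a time depending
   on [i] only gives, for all [i] together, uniform coins. *)
Section Diagonal.
Variables (R : realType) (n : nat) (St I : finType) (w : nat).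
Notation Om := {ffun I -> 'I_w.+1}.
Variables (st0 : St) (next : St -> option {set 'I_n} -> Om -> St) (read : St -> R).
Variable enc : St -> seq bool.
Hypothesis enc_inj : injective enc.
Hypothesis Om0 : (0 < #|{: Om}|)%N.
Variables (k : nat) (s : seq {set 'I_n}).
Notation A := (machine_alg st0 next read enc Om0).
Variable pos : I -> nat.
Hypothesis pos_lt : forall i, (pos i < size (tape k s))%N.

Definition coins_of (d : draws A k s) : Om := [ffun i => draw_at d (pos i) i].

(** Translating every draw by [h] translates the extracted coins by [h]. *)
Lemma Ex_coins_of (f : Om -> R) : Ex (f \o coins_of) = Ex f.
Proof.
pose shift (h : Om) (d : draws A k s) : draws A k s :=
  [tuple of map (fun c => draw_rank Om0 (draw_val Om0 c + h)) d].
have d0 : (0 < #|{: draws A k s}|)%N.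
  by apply/card_gt0P; exists [tuple of nseq _ ord0].
apply: (@Ex_equivariant R (draws A k s) Om shift (fun y h => y + h) coins_of f d0 Om0).
- move=> h d d' /(congr1 val) /= /inj_map e; apply: val_inj; apply: e => c c'.
  move=> /(can_inj (draw_rankK Om0)) /addIr; exact: (can_inj (draw_valK Om0)).
- exact: addrI.
move=> h d; apply/ffunP => i; rewrite !ffunE /draw_at.
have pd : (pos i < size d)%N by rewrite size_tuple.
rewrite (nth_map ord0) ?size_map // (nth_map ord0) // (nth_map ord0) //.
by rewrite draw_rankK ffunE.
Qed.

Lemma success_coins (good : pred R) (P : pred Om) :
  (forall d : draws A k s, P (coins_of d) -> good (output d)) ->
  Pr R P <= success_prob A k s good.
Proof.
move=> Pgood; rewrite /success_prob -(PrE R (fun d : draws A k s => good (output d))).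
rewrite /Pr -(Ex_coins_of (fun om => (P om)%:R)); apply: Pr_sub => d; exact: Pgood.
Qed.

End Diagonal.

Local Close Scope ring_scope.

(** * The stored records of chains and their updates *)

Section Tokens.
Variables (n r : nat).
Notation Ch := (r.-bseq 'I_n).
Notation NN := (n * n).
Implicit Types (x y : Ch) (P Q : {set {set 'I_n}}) (e : {set 'I_n}).

(* What is stored about a chain: the degrees of its vertices and the
   adjacencies between them, in the part of the stream read so far. *)
Definition Tok : finType :=
  (Ch * {ffun 'I_r -> 'I_NN.+1} * {ffun 'I_r * 'I_r -> bool})%type.
Implicit Types t : Tok.

Definition pos_adj P (x : seq 'I_n) (q : 'I_r * 'I_r) : bool :=
  if onth x q.1 is Some v then
    if onth x q.2 is Some w then [set v; w] \in P else false
  else false.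

Definition note P x : Tok :=
  (x, [ffun i : 'I_r => inord (pos_deg P x i)], [ffun q => pos_adj P x q]).

Definition tok_chain t : Ch := t.1.1.

Definition bump e t : Tok :=
  (tok_chain t, [ffun i => inord (t.1.2 i + touches (tok_chain t) i e)],
   [ffun q => t.2 q || pos_adj [set e] (tok_chain t) q]).

Definition tok_clique t : bool :=
  [forall q : 'I_r * 'I_r, (q.1 < q.2 < size (tok_chain t)) ==> t.2 q].

(** The empty chain has no vertex of least degree; its children are pairs, completed by the edge
    formed of both vertices. *)
Definition tok_edge t y : {set 'I_n} :=
  if size (tok_chain t) == 0 then [set v in y]
  else if argmin_vertex (tok_chain t) (fun i : 'I_r => t.1.2 i : nat) is Some v
       then [set v; last v y] else set0.

Lemma note_inj P : injective (note P).
Proof. by move=> x y []. Qed.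

Lemma note_nil P : note P (nil_bseq r _) = note set0 (nil_bseq r _).
Proof.
congr (_, _, _); apply/ffunP => i; rewrite !ffunE.
  congr inord; apply: eq_card => e; rewrite !inE /touches onth0n.
  by rewrite !andbF.
by rewrite /pos_adj onth0n.
Qed.

Lemma bump_note P e x : e \notin P -> #|P| < NN -> bump e (note P x) = note (e |: P) x.
Proof.
move=> eP PN; congr (_, _, _); apply/ffunP => i; rewrite !ffunE /=.
  apply: val_inj; have d1 : pos_deg P x i <= #|P|.
    by apply: subset_leq_card; apply/subsetP => f; rewrite inE => /andP[].
  have -> : pos_deg (e |: P) x i = pos_deg P x i + touches x i e.
    rewrite /pos_deg; case te : (touches x i e); last first.
      rewrite addn0; apply: eq_card => f; rewrite !inE.
      by case: eqVneq => [->|] //=; rewrite te andbF.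
    rewrite (_ : [set f in e |: P | touches x i f] = e |: [set f in P | touches x i f]).
      by rewrite cardsU1 inE (negbTE eP) addnC.
    by apply/setP => f; rewrite !inE; case: eqVneq => [->|] //=; rewrite te.
  have d2 : pos_deg P x i < NN.+1 by rewrite ltnS (leq_trans d1) // ltnW.
  by congr (nat_of_ord (inord (_ + _))); rewrite inordK.
rewrite /pos_adj; case: onth => // v; case: onth => // w.
by rewrite !inE orbC.
Qed.

Variable G : graph n.
Notation E := (edges G).

Lemma card_edges_le : #|E| <= NN.
Proof.
have <- : #|{: 'I_n * 'I_n}| = NN by rewrite card_prod !card_ord.
apply: leq_trans (leq_imset_card (fun p : 'I_n * 'I_n => [set p.1; p.2]) xpredT).
apply: subset_leq_card; apply/subsetP => e eE.
have /eqP/cards2P[v [w [_ ->]]] := card_edge eE.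
by apply/imsetP; exists (v, w).
Qed.

Lemma tok_clique_note x : tok_clique (note E x) = cl G x.
Proof.
rewrite /tok_clique /cl /=; case xE: (bseqval x) => [|v0 s].
  by apply/forallP => q; rewrite ltn0 andbF.
rewrite -xE; apply/forallP/(pairwiseP v0) => [h i j|h [i j]].
  rewrite !inE => ix jx ij.
  have ir : i < r by apply: leq_trans ix (size_bseq x).
  have jr : j < r by apply: leq_trans jx (size_bseq x).
  have := implyP (h (Ordinal ir, Ordinal jr)); rewrite /= ij jx ffunE /pos_adj /=.
  by rewrite !(onth_lt v0) //; apply.
apply/implyP => /= /andP[ij jx]; rewrite ffunE /pos_adj /=.
rewrite !(onth_lt v0) //; last exact: ltn_trans jx.
by apply: h; rewrite ?inE // (ltn_trans ij).
Qed.

(** The least-degree vertex is right only once the whole stream has been counted, hence [P = E]; the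
    empty chain consults no degrees. *)
Lemma tok_edge_note P x y : parent y = x -> 1 < size y -> (P = E) \/ size x = 0 ->
  tok_edge (note P x) y = last_edge G y.
Proof.
move=> yx y1 PE; rewrite /tok_edge (_ : tok_chain (note P x) = x) //; case: eqP => x0.
  move: yx; rewrite /parent; case: eqP => [y2 _|y2 yx]; last first.
    by move: x0 y1 y2; rewrite -yx pre_size ?leq_pred //; case: (size y) => [|[|[]]].
  have xE : pre (size y).-1 y != [::] :> seq _.
    by rewrite -size_eq0 pre_size ?leq_pred // y2.
  case yE : (bseqval y) y2 => [|p [|q []]] // _.
  have pE : pre (size y).-1 y = [:: p] :> seq _ by rewrite /= yE.
  have [|v [-> _ + _]] := @last_edge_rcons n r G _ y q xE; first by rewrite pE yE.
  rewrite -[v \in _]/(v \in bseqval (pre (size y).-1 y)) pE inE => /eqP ->.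
  apply/setP => u; rewrite [LHS]inE -[LHS]/(u \in bseqval y) yE.
  by rewrite !inE.
case: PE => // ->; rewrite /last_edge.
have yx' : pre (size y).-1 y = x.
  by move: yx; rewrite /parent; case: eqP => // _ e; case: x0; rewrite -e.
rewrite yx' /min_vertex.
have dE (i : 'I_r) : (note E x).1.2 i = pos_deg E x i :> nat.
  rewrite ffunE inordK // ltnS; apply: leq_trans card_edges_le.
  by apply: subset_leq_card; apply/subsetP => f; rewrite inE => /andP[].
have -> // : argmin_vertex x (fun i : 'I_r => (note E x).1.2 i) =
    argmin_vertex x (@pos_deg n r E x).
rewrite /argmin_vertex; congr obind; apply: eq_pick => i; rewrite dE; congr andb.
by apply: eq_forallb => j; rewrite dE.
Qed.

Notation Val := (option ({set Tok} * {set Ch})).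
Implicit Types S : Val.

Definition fresh s e (beta : pred Ch) (A : {set Tok}) : {set Ch} :=
  [set y : Ch | [&& 1 < size y, beta y &
    [exists t in A, [&& tok_chain t == parent y, size (tok_chain t) == s & tok_edge t y == e]]]].

Definition sample_edge s L e (beta : pred Ch) S : Val :=
  if S is Some (A, C) then
    let C' := C :|: fresh s e beta A in
    if #|C'| <= L then Some (A, C') else None
  else None.

(** Every kept chain gets a blank record, since the following pass counts degrees and adjacencies
    anew. Chains of other sizes are carried along. *)
Definition sample_end s S : Val :=
  if S is Some (A, C) then
    Some ([set note set0 x | x in C :|: [set x in [set tok_chain t | t in A] | size x != s]], set0)
  else None.

Definition check_edge e S : Val := omap (fun p : {set Tok} * {set Ch} => (bump e @: p.1, p.2)) S.

Definition check_end S : Val :=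
  omap (fun p : {set Tok} * {set Ch} => ([set t : Tok in p.1 | tok_clique t], set0)) S.

Definition chains S : option {set Ch} := omap (fun p : {set Tok} * {set Ch} => tok_chain @: p.1) S.

Definition pack P (o : option {set Ch}) : Val := omap (fun T : {set Ch} => (note P @: T, set0)) o.

Lemma imset_tok_chain P (T : {set Ch}) : tok_chain @: (note P @: T) = T.
Proof. by rewrite -imset_comp -[RHS]imset_id; apply: eq_imset. Qed.

Lemma packK P : cancel (pack P) chains.
Proof. by case=> //= T; rewrite imset_tok_chain. Qed.

(** The state of a run during a sampling pass: the records reflect the graph [P], and the edges [Q]
    have been read. *)
Definition sampling P s L (beta : pred Ch) (o : option {set Ch}) Q : Val :=
  if o is Some T then
    if #|offspring G beta Q s T| <= L then Some (note P @: T, offspring G beta Q s T) else None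
  else None.

Lemma offspring0 (beta : pred Ch) s (T : {set Ch}) : offspring G beta set0 s T = set0.
Proof. by apply/setP => y; rewrite !inE !andbF. Qed.

Lemma offspringU1 (beta : pred Ch) s (T : {set Ch}) e Q :
  offspring G beta (e |: Q) s T = offspring G beta Q s T :|: offspring G beta [set e] s T.
Proof.
apply/setP => y; rewrite !inE; case: (1 < size y) => //=; case: (parent y \in T) => //=.
by case: (size _ == s) => //=; case: (last_edge G y == e); rewrite /= ?orbT ?orbF //; case: (beta y); rewrite ?andbF ?orbT.
Qed.

Lemma sampling0 P s L beta o : sampling P s L beta o set0 = pack P o.
Proof. by case: o => //= T; rewrite offspring0 cards0. Qed.

Lemma fresh_note P s e (beta : pred Ch) (T : {set Ch}) : P = E \/ s = 0 ->
  fresh s e beta (note P @: T) = offspring G beta [set e] s T.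
Proof.
move=> PE; apply/setP => y; rewrite !inE; case: (ltnP 1 (size y)) => //= y1.
apply/idP/idP => [/andP[by_ /exists_inP[_ /imsetP[x xT ->]]]|].
  rewrite /tok_chain /= => /and3P[/eqP xy /eqP xs].
  rewrite (tok_edge_note (esym xy) y1) => [/eqP ->|].
    by rewrite -xy xT xs by_ !eqxx.
  by case: PE => [->|s0]; [left|right; rewrite xs].
case/and4P=> yT /eqP ys ye by_; rewrite by_ /=; apply/exists_inP.
exists (note P (parent y)); first exact: imset_f.
rewrite /tok_chain /= ys !eqxx /= (tok_edge_note erefl y1) //.
by case: PE => [->|s0]; [left|right; rewrite ys].
Qed.

(** Only the coins of chains closed by the current edge have to agree, which allows every symbol to
    bring its own draw. *)
Lemma sample_edgeE P s L (beta beta' : pred Ch) o Q e : P = E \/ s = 0 ->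
  (forall T, o = Some T ->
     offspring G beta' [set e] s T = offspring G beta [set e] s T) ->
  sample_edge s L e beta' (sampling P s L beta o Q) = sampling P s L beta o (e |: Q).
Proof.
move=> PE bb; case: o bb => //= T /(_ T erefl) bT.
case: leqP => QL /=; last first.
  rewrite leqNgt (leq_trans QL) // offspringU1 subset_leq_card //; exact: subsetUl.
by rewrite fresh_note // bT offspringU1.
Qed.

(** A round before its adjacency check, that is, the state between its two passes. *)
Definition grow_raw s L (beta : pred Ch) (o : option {set Ch}) : option {set Ch} :=
  if o is Some T then
    if #|offspring G beta E s T| <= L then
      Some (offspring G beta E s T :|: [set x in T | size x != s]) else None
  else None.

Lemma grow_roundE s L beta o :
  grow_round G beta L s o = omap (fun U : {set Ch} => [set x : Ch in U | cl G x]) (grow_raw s L beta o).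
Proof. by case: o => //= T; case: ifP. Qed.

Lemma sample_endE P s L beta o :
  sample_end s (sampling P s L beta o E) = pack set0 (grow_raw s L beta o).
Proof. by case: o => //= T; case: ifP => //= _; rewrite imset_tok_chain. Qed.

Lemma check_edgeE Q e (o : option {set Ch}) : e \notin Q -> #|Q| < NN ->
  check_edge e (pack Q o) = pack (e |: Q) o.
Proof.
move=> eQ QN; case: o => //= T; congr (Some (_, _)); rewrite -imset_comp.
by apply: eq_imset => x /=; apply: bump_note.
Qed.

Lemma check_endE (o : option {set Ch}) :
  check_end (pack E o) = pack E (omap (fun U : {set Ch} => [set x : Ch in U | cl G x]) o).
Proof.
case: o => //= T; congr (Some (_, _)); apply/setP => t; rewrite inE.
apply/andP/imsetP => [[/imsetP[x xT ->]]|[x + ->]].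
  by rewrite tok_clique_note => xcl; exists x; rewrite // inE xT.
by rewrite inE => /andP[xT xcl]; rewrite imset_f // tok_clique_note.
Qed.

End Tokens.

Local Arguments sampling : simpl never.

(** * The multi-pass algorithm and its simulation *)

Section Algorithm.
Variables (R : realType) (n r lam g0 gm k b a : nat).
Notation Ch := (r.-bseq 'I_n).
Notation NN := (n * n).
Notation Idt := (Id n r gm k).
Notation Om := {ffun Idt * Ch -> 'I_(width lam g0 gm).+1}.
Notation Tok := (Tok n r).
Notation Val := (option ({set Tok} * {set Ch})).
Implicit Types (id : Idt) (om : Om) (t : Idt -> option {set Ch}) (g : 'I_gm) (c x y z : Ch).

Definition start id : option {set Ch} :=
  Some (if id.1.2 == None then [set nil_bseq r _] else set0).

Definition capped t g i : option {set Ch} :=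
  if t (g, None, i) is Some T then if found_cap r b a < #|T| then None else Some T
  else None.

(** A clique found in one order may have to be counted in another, so every sequence over its
    vertices is tested, not only the prefixes of the chain found. *)
Definition testable t g c : bool :=
  (1 < size c < r) &&
  [exists i, [exists x in odflt set0 (capped t g i), all (mem x) c]].

Definition switch t id : option {set Ch} :=
  if id.1.2 is Some c then Some (if testable t id.1.1 c then [set c] else set0)
  else capped t id.1.1 id.2.

Definition cap_of (m : nat) g : nat := 128 * r ^ 2 * m %/ scale g0 g.
Definition round_of (i : nat) : nat := i.-1./2 %% r.

(* Pass 0 counts the edges. Passes [1 + 2 * j] and [2 + 2 * j] for [j < 2 * r]
   sample and check the extensions of round [j %% r], of the sampling runs when
   [j < r], of the tests of the prefixes found by them when [r <= j]. The
   remaining passes are idle. *)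
Definition end_pass (i : nat) (f : {ffun Idt -> Val}) : {ffun Idt -> Val} :=
  if (i == 0) || (4 * r < i) then f
  else if odd i then [ffun id => sample_end (round_of i) (f id)]
  else if i == 2 * r then
    [ffun id => pack set0 (switch (fun id => chains (check_end (f id))) id)]
  else [ffun id => check_end (f id)].

Definition St : finType := ('I_(5 * r).+1 * 'I_NN.+1 * {ffun Idt -> Val})%type.

Definition next (st : St) (sym : option {set 'I_n}) (om : Om) : St :=
  let: (i, m, f) := st in
  match sym with
  | Some e =>
      if i == 0 :> nat then (i, inord m.+1, f)
      else if 4 * r < i then st
      else if odd i then
        (i, m, [ffun id => sample_edge (round_of i) (cap_of m id.1.1) e (bits om id) (f id)])
      else (i, m, [ffun id => check_edge e (f id)])
  | None => (inord i.+1, m, end_pass i f)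
  end.

Definition st0 : St := (ord0, ord0, [ffun id => pack set0 (start id)]).

Definition active_of t g c : bool :=
  2 * #|[set j | if t (g, Some c, j) is Some T then theta r b (size c) < #|T| else true]| < k.

Definition good_order_of t g (K : {set 'I_n}) : option Ch :=
  [pick z : Ch | [&& size z == r, [set v in z] == K &
     [forall u : 'I_r, (1 < u) ==> active_of t g (pre u z)]]].

Definition outcome_of t g i : option nat :=
  omap (fun T : {set Ch} => #|[set x in T | good_order_of t g [set v in x] == Some x]|)
    (t (g, None, i)).

Definition read (st : St) : R :=
  ((result n r lam g0 a (outcome_of (fun id => chains (st.2 id))))%:R)%R.

Section Simulation.
Variables (G : graph n) (s : seq {set 'I_n}).
Hypothesis sG : streams s G.
Hypothesis r_gt1 : 1 < r.
Notation E := (edges G).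
Notation m := #|edges G|.

(** The history by rounds, for coins drawn in advance; the machine is shown to follow it pass by
    pass. *)
Fixpoint traj om (j : nat) : Idt -> option {set Ch} :=
  if j is j'.+1 then
    let t := fun id => grow_round G (bits om id) (cap r G g0 id.1.1) (j' %% r) (traj om j' id) in
    if j == r then switch t else t
  else start.

Lemma grow_round0 beta L j : grow_round G beta L j (Some (set0 : {set Ch})) = Some set0.
Proof.
have o0 : offspring G beta E j set0 = set0 by apply/setP => y; rewrite !inE andbF.
rewrite /= o0 cards0 /= set0U; congr Some; apply/setP => y; by rewrite !inE.
Qed.

Lemma traj_test1 om j g c i : j < r -> traj om j (g, Some c, i) = Some set0.
Proof.
elim: j => [//|j IHj] jr.
by rewrite [LHS]/= ltn_eqF // IHj ?(ltnW jr) // grow_round0.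
Qed.

Lemma traj_main1 om j g i : j < r ->
  traj om j (g, None, i) =
  grow_until G (bits om (g, None, i)) (cap r G g0 g) j (Some [set nil_bseq r _]).
Proof.
elim: j => [//|j IHj] jr.
by rewrite [LHS]/= ltn_eqF // IHj ?(ltnW jr) // grow_untilS modn_small // ltnW.
Qed.

Lemma traj_switch om j id : j.+1 = r -> traj om j.+1 id = switch (fun id =>
  grow_round G (bits om id) (cap r G g0 id.1.1) j (traj om j id)) id.
Proof.
by move=> jr; rewrite /= (introT eqP jr) modn_small //; rewrite -jr.
Qed.

Let r_predK : r.-1.+1 = r.
Proof. by rewrite prednK // ltnW. Qed.

Lemma traj_r_main om g i : traj om r (g, None, i) =
  if run G om (g, None, i) is Some T then
    if found_cap r b a < #|T| then None else Some T else None.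
Proof.
have := traj_switch om (g, None, i) r_predK; rewrite {1}r_predK => ->.
rewrite /switch /capped /= traj_main1 ?r_predK // -grow_untilS.
have -> : grow_until G (bits om (g, None, i)) (cap r G g0 g) r.-1.+1 (Some [set nil_bseq r _])
  = run G om (g, None, i) by rewrite /run /grow {1}r_predK.
by [].
Qed.

Definition tested om g c : bool :=
  (1 < size c < r) &&
  [exists i, [exists x in odflt set0 (traj om r (g, None, i)), all (mem x) c]].

Lemma traj_r_test om g c i :
  traj om r (g, Some c, i) = Some (if tested om g c then [set c] else set0).
Proof.
have := traj_switch om (g, Some c, i) r_predK; rewrite {1}r_predK => ->.
rewrite /switch /testable /tested /=; congr (Some (if _ && _ then _ else _)).
apply: eq_existsb => i'.
have := traj_switch om (g, None, i') r_predK; rewrite {1}r_predK => ->.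
by [].
Qed.

(** Sampling runs now hold only chains of size [r], and no round extends chains of that size. *)
Lemma traj_main2 om u g i : u <= r -> traj om (r + u) (g, None, i) = traj om r (g, None, i).
Proof.
elim: u => [|u IHu] ur; first by rewrite addn0.
rewrite addnS [LHS]/= gtn_eqF ?ltnS ?leq_addr // IHu ?(ltnW ur) //.
rewrite modnDl modn_small // traj_r_main; case eT : (run G om (g, None, i)) => [T|//].
case: ifP => // _.
have Tr : T \subset cliques_of_size r G r.
  case: (run_main G g om i r_gt1) eT => [->|[-> //]] [<-].
  by apply/subsetP => x; rewrite !inE => /and3P[-> ->].
have o0 : offspring G (bits om (g, None, i)) E u T = set0.
  apply/setP => y; rewrite !inE; apply/negP => /and4P[_ /(subsetP Tr) + /eqP pu _].
  by rewrite inE pu => /andP[/eqP e _]; rewrite e ltnn in ur.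
rewrite /= o0 cards0 /= set0U; congr Some; apply/setP => x; rewrite !inE.
case: (boolP (x \in T)) => //= /(subsetP Tr); rewrite inE => /andP[/eqP -> ->].
by rewrite andbT gtn_eqF.
Qed.

Lemma traj_test2 om u g c i : u <= r -> traj om (r + u) (g, Some c, i) =
  grow_until G (bits om (g, Some c, i)) (cap r G g0 g) u (traj om r (g, Some c, i)).
Proof.
elim: u => [|u IHu] ur; first by rewrite addn0.
rewrite addnS [LHS]/= gtn_eqF ?ltnS ?leq_addr // IHu ?(ltnW ur) //.
by rewrite modnDl modn_small // -grow_untilS.
Qed.

Lemma traj_end_test om g c i : tested om g c ->
  traj om (2 * r) (g, Some c, i) = run G om (g, Some c, i).
Proof. by move=> tc; rewrite mul2n -addnn traj_test2 // traj_r_test tc. Qed.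

Lemma traj_end_main om g i : traj om (2 * r) (g, None, i) = traj om r (g, None, i).
Proof. by rewrite mul2n -addnn traj_main2. Qed.

(** The order of a found clique consults only prefixes over its own vertices. All these were tested,
    and for them the stored result is that of the complete run. *)
Lemma outcome_traj om g i :
  outcome_of (traj om (2 * r)) g i = outcome G b a om g i.
Proof.
rewrite /outcome_of /outcome /outcome_with traj_end_main traj_r_main.
case eT : (run G om (g, None, i)) => [T|//]; case: ifP => // Fs /=; congr Some.
have Tr : T \subset cliques_of_size r G r.
  case: (run_main G g om i r_gt1) eT => [->|[-> //]] [<-].
  by apply/subsetP => x; rewrite !inE => /and3P[-> ->].
apply: eq_card => x; rewrite [LHS]in_set [RHS]in_setI [_ \in counted _ _ _ _]in_set.
apply: andb_id2l => xT; rewrite (subsetP Tr _ xT) /=.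
suff -> : good_order_of (traj om (2 * r)) g [set v in x] = good_order G b om g [set v in x] by [].
apply: eq_pick => z /=; case: eqP => //= zr; case: eqP => //= zx.
apply: eq_forallb => u; case: ltnP => //= u1.
have tz : tested om g (pre u z).
  rewrite /tested pre_size ?zr ?(ltnW (ltn_ord u)) // u1 ltn_ord /=.
  apply/existsP; exists i; rewrite traj_r_main eT Fs /=; apply/existsP; exists x.
  rewrite xT; apply/allP => v /mem_take vz /=.
  by have := in_set (mem z) v; rewrite zx inE => ->.
rewrite /active_of /active; congr (2 * _ < k); apply: eq_card => j.
by rewrite [LHS]in_set [RHS]in_set traj_end_test.
Qed.

(* The draw used for a coin is the one made when the edge closing the chain is
   read during the sampling pass of the round that extends its parent. *)
Definition pos (i : Idt * Ch) : nat :=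
  (1 + 2 * ((if i.1.1.2 is Some _ then r else 0) + size (parent i.2))) * m.+1
  + index (last_edge G i.2) s.

Let sizeE : size s = m.
Proof. by rewrite (perm_size sG) -cardE. Qed.

Lemma size_tape kk : size (tape kk s) = kk * m.+1.
Proof.
rewrite /tape size_flatten /shape map_nseq sumn_nseq size_rcons size_map sizeE.
exact: mulnC.
Qed.

Lemma parent_size y : size (parent y) < r.
Proof.
rewrite /parent; case: ifP => _; first exact: ltnW r_gt1.
rewrite pre_size ?leq_pred //; have := size_bseq y; move: r_gt1; lia.
Qed.

Lemma pos_lt i : pos i < size (tape (5 * r) s).
Proof.
rewrite size_tape /pos; have := parent_size i.2.
have : index (last_edge G i.2) s <= m by rewrite -sizeE index_size.
move: (size (parent _)) (index _ _) => p q; case: i.1.1.2 => [c|]; nia.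
Qed.

Lemma nth_tape i j : i < 5 * r -> j <= m ->
  nth None (tape (5 * r) s) (i * m.+1 + j) =
  if j < m then Some (nth set0 s j) else None.
Proof.
have sz : size (rcons (map some s) None) = m.+1 by rewrite size_rcons size_map sizeE.
move: (5 * r) => kk; rewrite /tape; elim: kk i => // kk IHk [|i] ik jm /=.
  rewrite nth_cat sz ltnS jm mul0n add0n nth_rcons size_map sizeE.
  case: ltnP => h; last by rewrite (eqP (_ : j == m)) ?eqxx // eqn_leq jm h.
  by rewrite (nth_map set0) ?sizeE.
rewrite nth_cat sz mulSn -addnA ltnNge leq_addr /= addKn; exact: IHk.
Qed.

(** After the switch all records are blank, as no pass has yet read the adjacencies of the new
    roots. This is harmless: round [r] has index 0 and extends only empty chains. *)
Definition noted (j : nat) : {set {set 'I_n}} := if j == r then set0 else E.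

(** The state in pass [i] depends on the edges read only as a set, so the order of the stream does
    not influence it. *)
Definition mid om (i : nat) (Q : {set {set 'I_n}}) : St :=
  let j := i.-1./2 in
  if i == 0 then (inord i, inord #|Q|, [ffun id => pack set0 (start id)])
  else if 4 * r < i then (inord i, inord m, [ffun id => pack E (traj om (2 * r) id)])
  else if odd i then
    (inord i, inord m, [ffun id => sampling G (noted j) (j %% r) (cap r G g0 id.1.1)
       (bits om id) (traj om j id) Q])
  else
    (inord i, inord m, [ffun id => pack Q (grow_raw G (j %% r) (cap r G g0 id.1.1)
       (bits om id) (traj om j id))]).

(** Chains that round [j] can extend occur only in sampling runs when [j < r] and only in tests
    afterwards; hence [pos] points into the current pass. *)
Lemma traj_phase om j id T x : j < 2 * r -> traj om j id = Some T -> x \in T ->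
  size x = j %% r -> (if id.1.2 is Some _ then r else 0) + j %% r = j.
Proof.
move=> j2; case: id => [[g [c|]] i] /=; have [jr|rj] := ltnP j r.
- by rewrite traj_test1 // => -[<-]; rewrite inE.
- move=> _ _ _; rewrite -{1 2}(subnKC rj) modnDl modn_small ?subnKC //.
  by rewrite ltn_subLR // addnn -mul2n.
- by move=> _ _ _; rewrite modn_small.
rewrite -{1}(subnKC rj) traj_main2; last by rewrite leq_subLR addnn -mul2n ltnW.
rewrite traj_r_main; case eT : (run G om (g, None, i)) => [T'|//].
case: ifP => // _ [<-] xT xj.
case: (run_main G g om i r_gt1) eT => [->|[-> //]] [eT].
move: xT; rewrite -eT inE xj => /and3P[/eqP e _ _].
by have := ltn_pmod j (ltnW r_gt1); rewrite e ltnn.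
Qed.

Lemma noted_ok j : noted j = E \/ j %% r = 0.
Proof. by rewrite /noted; case: eqP => [->|_]; [right; rewrite modnn|left]. Qed.

Lemma odd_pass i : odd i -> i = (2 * i.-1./2).+1.
Proof. by case: i => // i /= oi; rewrite -[LHS](odd_double_half i.+1) /= oi; lia. Qed.

Let m_le : m <= NN := card_edges_le G.

Lemma next_mid_edge om om' i (Q : {set {set 'I_n}}) e : i < 5 * r -> e \in E -> e \notin Q -> Q \subset E ->
  (forall ic, pos ic = i * m.+1 + index e s -> om' ic = om ic) ->
  next (mid om i Q) (Some e) om' = mid om i (e |: Q).
Proof.
move=> i5 eE eQ QE coinE.
have iK : nat_of_ord (inord i : 'I_(5 * r).+1) = i by rewrite inordK // ltnW.
have Qm : #|Q| < m.
  by apply: proper_card; rewrite properE QE; apply/subsetPn; exists e.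
rewrite /mid; case: (posnP i) => [i0|ipos].
  rewrite i0 /next /= inordK // eqxx cardsU1 eQ inordK //.
  by rewrite ltnS (leq_trans (ltnW Qm)).
case: ltnP => [i4|i4]; first by rewrite /next iK (gtn_eqF ipos) i4.
case oi : (odd i); rewrite /next iK (gtn_eqF ipos) ltnNge i4 /= oi; last first.
  congr (_, _, _); apply/ffunP => id; rewrite !ffunE.
  by apply: check_edgeE => //; apply: leq_trans m_le.
congr (_, _, _); apply/ffunP => id; rewrite !ffunE.
rewrite /cap_of inordK // -/(cap r G g0 id.1.1) /round_of.
have iE := odd_pass oi; set j := i.-1./2 in iE *.
have j2 : j < 2 * r by move: i4; rewrite iE; lia.
apply: sample_edgeE; first exact: noted_ok.
move=> T eT; apply/setP => y; rewrite !inE; case: (boolP (parent y \in T)) => [yT|]; last by rewrite andbF.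
case: (boolP (size (parent y) == j %% r)) => [/eqP yj|]; last by rewrite !andbF.
case: (boolP (last_edge G y == e)) => [/eqP ye|]; last by rewrite !andbF.
congr [&& _, _, _, _ & _]; rewrite /bits /coin coinE // /pos /= yj ye.
by rewrite (traj_phase j2 eT yT yj) add1n -iE.
Qed.

Lemma next_mid_end om om' i : i < 5 * r ->
  next (mid om i E) None om' = mid om i.+1 set0.
Proof.
move=> i5; have iK : nat_of_ord (inord i : 'I_(5 * r).+1) = i by rewrite inordK // ltnW.
have r0 : 0 < r by apply: ltnW.
rewrite /mid /=; case: (posnP i) => [->|ipos].
  have h41 : (4 * r < 1) = false by apply/negbTE; rewrite -leqNgt muln_gt0 r0.
  rewrite /next inordK // /end_pass /= h41.
  congr (_, _, _); apply/ffunP => id; rewrite !ffunE sampling0.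
  rewrite /noted (ltn_eqF r0) /start /=; case: eqP => _; last by rewrite !imset0.
  by rewrite !imset_set1 note_nil.
case: (ltnP (4 * r) i) => [i4|i4].
  by rewrite /next /end_pass iK (gtn_eqF ipos) i4 ltnS ltnW.
rewrite ltnS; case: (boolP (odd i)) => oi.
  rewrite /next /end_pass iK (gtn_eqF ipos) [4 * r < i]ltnNge i4 oi /=.
  have iE := odd_pass oi; set j := i.-1./2 in iE *.
  have -> : (4 * r <= i) = false.
    by apply/negbTE; rewrite -ltnNge ltn_neqAle i4 andbT iE; apply/eqP; lia.
  have jE : i./2 = j by rewrite iE /= mul2n uphalf_double.
  congr (_, _, _); apply/ffunP => id; rewrite !ffunE sample_endE jE.
  by rewrite /round_of.
rewrite /next iK.
have iE : i = 2 * (i.-1./2).+1.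
  by move: ipos oi; case: (i) => // i' _ /=; rewrite negbK => oi; have := odd_double_half i'; rewrite oi; lia.
set j := i.-1./2 in iE *.
have jE : i./2 = j.+1 by rewrite iE mul2n doubleK.
have trajS : forall id, traj om j.+1 id = (if j.+1 == r then switch (fun id =>
   grow_round G (bits om id) (cap r G g0 id.1.1) (j %% r) (traj om j id)) id else
   grow_round G (bits om id) (cap r G g0 id.1.1) (j %% r) (traj om j id)).
  by move=> id /=; case: ifP.
have endE id : check_end (pack E (grow_raw G (j %% r) (cap r G g0 id.1.1) (bits om id) (traj om j id)))
   = pack E (grow_round G (bits om id) (cap r G g0 id.1.1) (j %% r) (traj om j id)).
  by rewrite check_endE grow_roundE.
have fE id : (end_pass i [ffun id => pack E (grow_raw G (j %% r) (cap r G g0 id.1.1)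
    (bits om id) (traj om j id))]) id = pack (noted j.+1) (traj om j.+1 id).
  rewrite trajS /end_pass (gtn_eqF ipos) [4 * r < i]ltnNge i4 /= (negbTE oi).
  rewrite (_ : i == 2 * r = (j.+1 == r)); last by rewrite iE eqn_pmul2l.
  rewrite /noted; case: eqP => [jr|_]; rewrite !ffunE; last by rewrite endE.
  congr pack; rewrite /switch; case: id.1.2 => [c|].
    congr (Some (if _ && _ then _ else _)); apply: eq_existsb => i'.
    by rewrite /capped !ffunE endE packK.
  by rewrite /capped !ffunE endE packK.
case: (leqP (4 * r) i) => [i4'|i4'].
  have ei : j.+1 = 2 * r by move: i4 i4'; rewrite iE; lia.
  congr (_, _, _); apply/ffunP => id; rewrite fE.
  by rewrite ffunE ei /noted (gtn_eqF (_ : r < 2 * r)) // mul2n -addnn -{1}(add0n r) ltn_add2r.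
rewrite /=; congr (_, _, _); apply/ffunP => id; rewrite fE.
by rewrite ffunE sampling0 jE.
Qed.

End Simulation.
End Algorithm.

Local Arguments sampling : simpl never.
Local Arguments pack : simpl never.
Local Arguments note : simpl never.

(** * The number of stored records *)

Section Space.
Variables (n r : nat) (G : graph n) (lam g0 gm k b a : nat).
Notation Ch := (r.-bseq 'I_n).
Notation Idt := (Id n r gm k).
Notation Om := {ffun Idt * Ch -> 'I_(width lam g0 gm).+1}.
Notation Val := (option ({set Tok n r} * {set Ch})).
Notation E := (edges G).
Notation m := #|edges G|.
Notation mid := (mid b a G).
Notation traj := (traj b a G).
Notation tested := (tested b a G).
Hypothesis r_gt1 : 1 < r.
Implicit Types (om : Om) (id : Idt) (g : 'I_gm) (c x y : Ch) (T : {set Ch}).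

Definition cost (S : Val) : nat := if S is Some (A, C) then #|A| + #|C| else 1.
Definition load (o : option {set Ch}) : nat := if o is Some T then #|T| else 1.
Definition cap0 : nat := 128 * r ^ 2 * m %/ 2 ^ g0.

Lemma cap_le g : cap r G g0 g <= cap0.
Proof. by apply: leq_div2l; rewrite ?expn_gt0 // leq_exp2l // leq_addr. Qed.

Lemma cost_pack P o : cost (pack P o) = load o.
Proof. by case: o => //= T; rewrite /pack /= cards0 addn0 (card_imset _ (@note_inj n r P)). Qed.

(** All chains of a run have the same size, so a round either replaces all of them by at most [L]
    new ones or adds none. *)
Lemma grow_until_load beta L s c : load (grow_until G beta L s (Some [set c])) <= L.+1.
Proof.
suff : forall T, grow_until G beta L s (Some [set c]) = Some T ->
    #|T| <= L.+1 /\ exists p, forall x, x \in T -> size x = p.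
  by case: grow_until => //= T /(_ T erefl)[].
elim: s => [|s IHs] T.
  by rewrite /grow_until /= => -[<-]; rewrite cards1; split=> //; exists (size c) => x /set1P ->.
rewrite grow_untilS; case: grow_until IHs => //= T' /(_ T' erefl) [T'L [p T'p]].
case: ifP => // CL [<-]; have [ps|ps] := eqVneq p s.
  have sub : [set x in offspring G beta E s T' :|: [set x in T' | size x != s] | cl G x]
      \subset offspring G beta E s T'.
    apply/subsetP => x; rewrite [_ \in [set _ in _ | _]]inE [_ \in _ :|: _]inE.
    by case/andP=> /orP[//|]; rewrite inE => /andP[/T'p ->]; rewrite ps eqxx.
  split; first by apply: leq_trans (subset_leq_card sub) _; apply: leqW.
  exists (if s == 0 then 2 else s.+1) => y /(subsetP sub).
  rewrite inE => /and4P[y1 _ /eqP + _]; rewrite /parent.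
  case: eqP => [y2 <- //|y2]; rewrite pre_size ?leq_pred // => <-.
  by case: (size y) y1 y2 => [|[|[|]]].
have C0 : offspring G beta E s T' = set0.
  apply/setP => y; rewrite !inE; apply/negP => /and4P[_ /T'p -> e _].
  by rewrite (negbTE ps) in e.
have sub : [set x in offspring G beta E s T' :|: [set x in T' | size x != s] | cl G x] \subset T'.
  by apply/subsetP => x; rewrite C0 set0U inE => /andP[+ _]; rewrite inE => /andP[].
split; first by apply: leq_trans (subset_leq_card sub) _.
by exists p => x /(subsetP sub); apply: T'p.
Qed.

(** Run identifiers range over all conceivable roots, far too many to pay for; a test whose root was
    not found holds the empty set and costs nothing. *)
Definition live om id : bool := if id.1.2 is Some c then tested om id.1.1 c else true.

Lemma traj_load om j id : j <= 2 * r ->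
  load (traj om j id) <= (if live om id then cap0.+1 else 0).
Proof.
case: id => [[g [c|]] i]; rewrite /live /= => j2; last first.
  have capS := cap_le g; rewrite -ltnS in capS.
  have [jr|rj] := ltnP j r.
    by rewrite traj_main1 //; apply: leq_trans (grow_until_load _ _ _ _) capS.
  rewrite -(subnKC rj) traj_main2 //; last by rewrite leq_subLR addnn -mul2n.
  rewrite traj_r_main //; apply: leq_trans capS.
  have : load (run G om (g, None, i)) <= (cap r G g0 g).+1 by apply: grow_until_load.
  by case: run => //= T; case: ifP.
have [jr|rj] := ltnP j r; first by rewrite traj_test1 //= cards0.
rewrite -(subnKC rj) traj_test2 //; last by rewrite leq_subLR addnn -mul2n.
rewrite traj_r_test //; case: ifP => _.
  by apply: leq_trans (grow_until_load _ _ _ _) _; rewrite ltnS cap_le.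
have -> : grow_until G (bits om (g, Some c, i)) (cap r G g0 g) (j - r) (Some set0) = Some set0.
  by elim: (j - r) => [//|u IHu]; rewrite grow_untilS IHu grow_round0.
by rewrite /= cards0.
Qed.

Lemma offspring_set0 beta (Q : {set {set 'I_n}}) s :
  offspring G beta Q s (set0 : {set Ch}) = set0.
Proof. by apply/setP => y; rewrite !inE andbF. Qed.

Lemma mid_cost om i (Q : {set {set 'I_n}}) id : Q \subset E ->
  cost ((mid om i Q).2 id) <= (if live om id then 2 * cap0 + 2 else 0).
Proof.
move=> QE; have load0 o : (0 < load o) || (o == Some set0).
  by case: o => //= T; rewrite lt0n cards_eq0; case: eqVneq => [->|]; rewrite ?eqxx ?orbT.
have c2 (x y z : nat) : x <= (if live om id then y else 0) -> y <= z -> x <= (if live om id then z else 0).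
  by case: ifP => // _; apply: leq_trans.
rewrite /mid; case: ifP => i0 /=.
  rewrite ffunE cost_pack; apply: c2 (traj_load om id (leq0n _)) _; lia.
case: ifP => i4 /=.
  rewrite ffunE cost_pack; apply: c2 (traj_load om id (leqnn _)) _; lia.
set j := i.-1./2; have j2 : j <= 2 * r.
  have h := odd_double_half i.-1; rewrite -/j in h; move/negbT: i4; rewrite -leqNgt => i4; lia.
have := traj_load om id j2.
case: (orP (load0 (traj om j id))) => [l0 tl|/eqP e0 _]; last first.
  have -> // : forall S : Val, S = Some (set0, set0) -> cost S <= (if live om id then 2 * cap0 + 2 else 0).
    by move=> S ->; rewrite /= !cards0.
  case: ifP => _ /=; rewrite ffunE e0.
    by rewrite /sampling offspring_set0 cards0 /= imset0.
  rewrite /grow_raw offspring_set0 cards0 /= set0U /pack /=; congr (Some (_, _)).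
  by apply/setP => x; rewrite inE; apply/imsetP => -[y]; rewrite !inE.
case lv : (live om id) tl => /=; last by rewrite leqNgt l0.
case et : (traj om j id) l0 => [T|] _ /= tl; last first.
  by case: ifP => _ /=; rewrite ffunE et /sampling /= addn2.
have cg := cap_le id.1.1.
case: ifP => _ /=; rewrite ffunE et /sampling.
  case: (leqP #|offspring G (bits om id) Q (j %% r) T| _) => CL; last by rewrite /cost; lia.
  rewrite /= (card_imset _ (@note_inj n r _)).
  by apply: leq_trans (leq_add tl (leq_trans CL cg)) _; lia.
rewrite cost_pack /grow_raw; case: (leqP #|offspring G (bits om id) E (j %% r) T| _) => /= CL; last by lia.
apply: leq_trans (leq_card_setU _ _) _.
have sub : [set x in T | size x != j %% r] \subset T.
  by apply/subsetP => x; rewrite inE => /andP[].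
by apply: leq_trans (leq_add (leq_trans CL cg) (leq_trans (subset_leq_card sub) tl)) _; lia.
Qed.

(** Each copy keeps at most [found_cap] cliques, and at most [r.+1 * r ^ r] sequences of length at
    most [r] use the vertices of one of them. *)
Lemma card_tested om g :
  #|[set c | tested om g c]| <= k * (found_cap r b a * (r.+1 * r ^ r)).
Proof.
pose S (i : 'I_k) : {set Ch} := odflt set0 (traj om r (g, None, i)).
apply: leq_trans (_ : \sum_i \sum_(x in S i) #|[set c : Ch | (1 < size c) && all (mem x) c]| <= _).
  rewrite -sum1_card; apply: leq_trans (_ : \sum_(c : Ch) \sum_i \sum_(x in S i)
     (if (1 < size c) && all (mem x) c then 1 else 0) <= _).
    rewrite big_mkcond; apply: leq_sum => c _; rewrite inE; case: ifP => //.
    case/andP=> /andP[c1 _] /existsP[i /existsP[x /andP[xS cx]]].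
    by rewrite (bigD1 i) //= (bigD1 x) //= c1 cx.
  rewrite exchange_big /=; apply: leq_sum => i _; rewrite exchange_big /=.
  apply: leq_sum => x _; rewrite -big_mkcond sum1_card.
  by apply: subset_leq_card; apply/subsetP => c; rewrite inE.
rewrite -[k in leqRHS]card_ord -sum_nat_const; apply: leq_sum => i _.
apply: leq_trans (_ : #|S i| * (r.+1 * r ^ r) <= _); last first.
  rewrite leq_mul2r /S traj_r_main //; apply/orP; right.
  by case: run => [T|]; rewrite ?cards0 //; case: ifP => [_|/negbT]; rewrite ?cards0 //= -leqNgt.
rewrite -sum_nat_const; apply: leq_sum => x _.
apply: leq_trans (_ : \sum_(p < r.+1) #|[set c : Ch | [&& size c == p, 1 < size c & all (mem x) c]]| <= _).
  pose sz (c : Ch) : 'I_r.+1 := inord (size c).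
  rewrite (card_fibers sz); apply: leq_sum => p _; apply: subset_leq_card.
  apply/subsetP => c; rewrite !inE => /andP[-> /eqP <-].
  by rewrite /sz inordK ?ltnS ?size_bseq // eqxx.
rewrite -[X in X * _](card_ord r.+1) -sum_nat_const; apply: leq_sum => p _.
have [K0|K0] := eqVneq [set v in x] set0.
  rewrite (_ : [set c : Ch | _] = set0) ?cards0 //; apply/setP => c; rewrite !inE.
  apply/negP => /and3P[_ + /allP cx]; case: (bseqval c) cx => //= v s cx _.
  have : v \in [set v in x] by rewrite inE; exact: cx (mem_head v s).
  by rewrite K0 inE.
apply: leq_trans (_ : #|[set v in x]| ^ p <= _).
  apply: leq_trans (card_chains_in r p K0); apply: subset_leq_card.
  apply/subsetP => c; rewrite !inE => /and3P[-> _ /allP cx] /=.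
  by apply/allP => v /cx; rewrite /= inE.
have xr : #|[set v in x]| <= r.
  by rewrite cardsE; apply: leq_trans (card_size _) (size_bseq x).
apply: leq_trans (_ : r ^ p <= _).
  by case: (nat_of_ord p) => [|q]; rewrite ?expn0 // leq_exp2r.
by rewrite leq_pexp2l ?(ltnW r_gt1) // -ltnS.
Qed.

Lemma mid_total om i (Q : {set {set 'I_n}}) : Q \subset E ->
  \sum_id cost ((mid om i Q).2 id) <=
  gm * k * (1 + k * (found_cap r b a * (r.+1 * r ^ r))) * (2 * cap0 + 2).
Proof.
move=> QE; apply: (@leq_trans (\sum_(id : Idt) (if live om id then 2 * cap0 + 2 else 0))).
  by apply: leq_sum => id _; apply: mid_cost.
rewrite -big_mkcond sum_nat_const leq_mul2r; apply/orP; right.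
rewrite mulnDr muln1 -[leqLHS](cardID (fun id : Idt => id.1.2 == None)).
apply: leq_add.
  pose f (p : 'I_gm * 'I_k) : Idt := (p.1, None, p.2).
  apply: leq_trans (_ : #|f @: setT| <= _).
    apply: subset_leq_card; apply/subsetP => -[[g o] j]; rewrite !inE /= => /andP[_ /eqP /= ->].
    by apply/imsetP; exists (g, j).
  by apply: leq_trans (leq_imset_card _ _) _; rewrite cardsT card_prod !card_ord.
pose f (p : 'I_gm * Ch * 'I_k) : Idt := (p.1.1, Some p.1.2, p.2).
pose B := [set p : 'I_gm * Ch | tested om p.1 p.2].
apply: leq_trans (_ : #|f @: setX B setT| <= _).
  apply: subset_leq_card; apply/subsetP => -[[g [c|]] j]; rewrite !inE /= ?andbF // => tc.
  by apply/imsetP; exists (g, c, j); rewrite // inE /= !inE /= andbT.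
apply: leq_trans (leq_imset_card _ _) _; rewrite cardsX cardsT card_ord.
rewrite mulnAC leq_mul2r; apply/orP; right.
have := @leq_card_fibers _ _ (fun p : 'I_gm * Ch => p.1) B setT _ _ _.
rewrite cardsT card_ord; apply => [//|g _].
apply: leq_trans (card_tested om g).
rewrite -(@card_in_imset _ _ (fun p : 'I_gm * Ch => p.2)) => [|[g1 c1] [g2 c2]]; last first.
  by rewrite !inE /= => /andP[_ /eqP ->] /andP[_ /eqP ->] ->.
apply: subset_leq_card; apply/subsetP => _ /imsetP[[g' c] + ->].
by rewrite !inE /= => /andP[tc /eqP <-].
Qed.

End Space.

(** * Encoding states as bit strings *)

Section FixedWidth.
Variables (A : finType) (w : nat).
Hypothesis Aw : #|A| <= 2 ^ w.

Definition code (x : A) : seq bool :=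
  nth [tuple of nseq w false] (enum {: w.-tuple bool}) (enum_rank x).

Lemma size_code x : size (code x) = w.
Proof. by rewrite /code size_tuple. Qed.

Lemma code_inj : injective code.
Proof.
have rk (x : A) : enum_rank x < size (enum {: w.-tuple bool}).
  have -> : size (enum {: w.-tuple bool}) = 2 ^ w.
    by rewrite -cardE card_tuple card_bool.
  by apply: leq_trans (ltn_ord (enum_rank x)) _; exact: Aw.
move=> x y /val_inj /eqP; rewrite nth_uniq ?enum_uniq ?rk // => /eqP e.
by apply: enum_rank_inj; apply: val_inj.
Qed.

Lemma flatten_code_inj : 0 < w -> injective (fun s => flatten (map code s)).
Proof.
move=> w0; elim=> [|x s IHs] [|y t] //=.
- by move/(congr1 size); rewrite size_cat size_code /=; case: (w) w0.
- by move/(congr1 size); rewrite size_cat size_code /=; case: (w) w0.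
move/eqP; rewrite eqseq_cat ?size_code // => /andP[/eqP/code_inj -> /eqP/IHs ->].
by [].
Qed.

Lemma size_flatten_code s : size (flatten (map code s)) = size s * w.
Proof. by elim: s => //= x s IHs; rewrite size_cat size_code IHs. Qed.

End FixedWidth.

Section Encoding.
Variables (n r gm k : nat).
Notation Ch := (r.-bseq 'I_n).
Notation NN := (n * n).
Notation Idt := (Id n r gm k).
Notation Tok := (Tok n r).
Notation Val := (option ({set Tok} * {set Ch})).
Notation St := (St n r gm k).
Variable l : nat.
Hypothesis nl : n < 2 ^ l.

Definition Entry : finType := (Idt * option (Tok + Ch))%type.

(** A sparse listing of all runs: an empty run contributes no entry and an overflow exactly one, so
    the code length follows [cost] rather than the number of identifiers. *)
Definition entries (f : {ffun Idt -> Val}) : {set Entry} :=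
  [set u : Entry | match u.2, f u.1 with
     | None, None => true
     | Some (inl t), Some p => t \in p.1
     | Some (inr y), Some p => y \in p.2
     | _, _ => false end].

Lemma entries_inj : injective entries.
Proof.
move=> f f' e; apply/ffunP => id.
have eu o : ((id, o) \in entries f) = ((id, o) \in entries f') by rewrite e.
have := eu None; rewrite !inE /=; case fE: (f id) => [[A C]|]; case f'E: (f' id) => [[A' C']|] // _.
congr (Some (_, _)); apply/setP => x.
  by have := eu (Some (inl x)); rewrite !inE /= fE f'E.
by have := eu (Some (inr x)); rewrite !inE /= fE f'E.
Qed.

Lemma card_entries f : #|entries f| <= \sum_id cost (f id).
Proof.
rewrite (card_fibers (fun u : Entry => u.1)); apply: leq_sum => id _.
case fE : (f id) => [[A C]|] /=.
  apply: leq_trans (_ : #|[set ((id, Some (inl t)) : Entry) | t in A] :|: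
      [set ((id, Some (inr y)) : Entry) | y in C]| <= _).
    apply: subset_leq_card; apply/subsetP => -[id' o]; rewrite !inE /= => /andP[h /eqP e].
    move: h; rewrite e fE; case: o => [[t|y]|] // h; apply/orP; [left|right]; exact: imset_f.
  by apply: leq_trans (leq_card_setU _ _) _; apply: leq_add; apply: leq_imset_card.
apply: leq_trans (_ : #|[set ((id, None) : Entry)]| <= _); last by rewrite cards1.
apply: subset_leq_card; apply/subsetP => -[id' o]; rewrite !inE /= => /andP[h /eqP e].
by move: h; rewrite e fE; case: o => [[]|].
Qed.

Lemma card_chains_type : #|{: Ch}| <= 2 ^ (l * r).
Proof.
pose f (y : Ch) : {ffun 'I_r -> option 'I_n} := [ffun i : 'I_r => onth y i].
have f_inj : injective f.
  move=> y z /ffunP e; apply: val_inj; apply: eq_from_onth => i.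
  case: (ltnP i r) => ir; first by have := e (Ordinal ir); rewrite !ffunE.
  by rewrite !onth_default // (leq_trans (size_bseq _)).
apply: leq_trans (leq_card f f_inj) _.
rewrite card_ffun card_option !card_ord expnM.
by case: (r) => [//|q]; rewrite leq_exp2r.
Qed.

Lemma NN_lt : NN < 2 ^ (2 * l).
Proof.
rewrite mul2n -addnn expnD; case: (n) nl => [|n'] h; first by rewrite muln_gt0 expn_gt0.
by rewrite ltn_mul.
Qed.

Definition entry_width : nat := gm + k + 4 * (l * r) + r * r + 3.

Lemma card_Entry : #|Entry| <= 2 ^ entry_width.
Proof.
have ch := card_chains_type.
have tok : #|{: Tok}| <= 2 ^ (3 * (l * r) + r * r).
  rewrite !card_prod !card_ffun card_prod card_bool !card_ord.
  rewrite expnD leq_mul // (_ : 3 * (l * r) = l * r + 2 * l * r); last by lia.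
  rewrite expnD leq_mul // expnM; case: (r) => [//|q].
  by rewrite leq_exp2r // NN_lt.
have two u : u < 2 ^ u by apply: ltn_expl.
have -> : #|Entry| = #|{: Idt}| * #|{: option (Tok + Ch)}| by rewrite card_prod.
have -> : #|{: Idt}| = gm * (#|{: Ch}|).+1 * k by rewrite 2!card_prod card_option !card_ord.
rewrite card_option card_sum.
have h1 : (#|{: Ch}|).+1 <= 2 ^ (l * r).+1.
  by rewrite expnS mul2n -addnn -addn1 leq_add // expn_gt0.
have h2 : (#|{: Tok}| + #|{: Ch}|).+1 <= 2 ^ (3 * (l * r) + r * r).+2.
  have c3 : #|{: Ch}| <= 2 ^ (3 * (l * r) + r * r).
    by apply: leq_trans ch _; rewrite leq_exp2l //; lia.
  have p := expn_gt0 2 (3 * (l * r) + r * r); rewrite !expnS; lia.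
apply: leq_trans (leq_mul (leq_mul (leq_mul (ltnW (two gm)) h1) (ltnW (two k))) h2) _.
by rewrite -!expnD leq_exp2l // /entry_width; lia.
Qed.

Definition head_width : nat := 5 * r + 2 * l.

Lemma card_head : #|{: 'I_(5 * r).+1 * 'I_NN.+1}| <= 2 ^ head_width.
Proof. by rewrite card_prod !card_ord expnD leq_mul ?NN_lt // ltn_expl. Qed.

Definition encode (st : St) : seq bool :=
  code head_width (st.1 : 'I_(5 * r).+1 * 'I_NN.+1)%type ++
  flatten (map (code entry_width) (enum (entries st.2))).

Lemma encode_inj : injective encode.
Proof.
move=> [h f] [h' f'] /eqP; rewrite eqseq_cat ?size_code //=.
case/andP=> /eqP /(code_inj card_head) -> /eqP.
move/(flatten_code_inj card_Entry) => e; congr (_, _); apply: entries_inj.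
have {}e : enum (entries f) = enum (entries f') by apply: e; rewrite /entry_width addn3.
by apply/setP => u; rewrite -mem_enum e mem_enum.
Qed.

Lemma size_encode st : size (encode st) <= head_width + (\sum_id cost (st.2 id)) * entry_width.
Proof.
rewrite size_cat size_code size_flatten_code leq_add2l leq_mul2r -cardE card_entries.
by rewrite orbT.
Qed.

End Encoding.

(** * Correctness and space of the sampling algorithm *)

Section Correctness.
Variables (R : realType) (n r lam g0 gm k b a l : nat).
Notation Ch := (r.-bseq 'I_n).
Notation Idt := (Id n r gm k).
Notation Om := {ffun Idt * Ch -> 'I_(width lam g0 gm).+1}.
Hypothesis nl : n < 2 ^ l.

Definition sampling_alg : stream_alg R n :=
  machine_alg (st0 n r gm k) (@next n r lam g0 gm k b a) (@read R n r lam g0 gm k b a)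
    (encode l) (Om_gt0 (Idt * Ch)%type (width lam g0 gm)).

Variables (G : graph n) (s : seq {set 'I_n}).
Hypothesis sG : streams s G.
Hypothesis r_gt1 : 1 < r.
Notation E := (edges G).
Notation m := #|edges G|.
Notation mid := (mid b a G).
Implicit Types d : draws sampling_alg (5 * r) s.
Notation xi d := (coins_of (pos G s) d).

Let sizeE : size s = m.
Proof. by rewrite (perm_size sG) -cardE. Qed.

Let uniq_s : uniq s.
Proof. by rewrite (perm_uniq sG) enum_uniq. Qed.

Let mem_s e : (e \in s) = (e \in E).
Proof. by rewrite (perm_mem sG) mem_enum. Qed.

Lemma eq_outcome_of (t t' : Idt -> option {set Ch}) g i : t =1 t' ->
  outcome_of b t g i = outcome_of b t' g i.
Proof.
move=> tt; have aE c : active_of b t g c = active_of b t' g c.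
  rewrite /active_of; congr (2 * _ < k); apply: eq_card => j.
  by rewrite [LHS]in_set [RHS]in_set tt.
have gE K : good_order_of b t g K = good_order_of b t' g K.
  apply: eq_pick => z; congr [&& _, _ & _]; apply: eq_forallb => u.
  by rewrite aE.
rewrite /outcome_of tt; case: (t' (g, None, i)) => //= T; congr Some.
by apply: eq_card => x; rewrite [LHS]in_set [RHS]in_set gE.
Qed.

Lemma take_setS j : j < m ->
  [set e in take j.+1 s] = nth set0 s j |: [set e in take j s].
Proof.
move=> jm; apply/setP => e; rewrite (take_nth set0) ?sizeE // !inE mem_rcons.
by rewrite inE.
Qed.

Lemma state_after_edges d i j : i < 5 * r ->
  state_after d (i * m.+1) = mid (xi d) i set0 -> j <= m ->
  state_after d (i * m.+1 + j) = mid (xi d) i [set e in take j s].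
Proof.
move=> ir di; elim: j => [_|j IHj jm].
  by rewrite addn0 di take0; congr mid; apply/setP => e; rewrite !inE.
rewrite addnS [LHS]/= IHj ?(ltnW jm) // (nth_tape sG) ?(ltnW jm) // jm take_setS //.
have js : j < size s by rewrite sizeE.
have esE : nth set0 s j \in E by rewrite -mem_s mem_nth.
apply: (next_mid_edge b a sG r_gt1) => //.
- rewrite inE; apply/negP => /(nthP set0)[j' + e].
  rewrite size_take_min leq_min => /andP[j'j j's]; move: e; rewrite nth_take // => /eqP.
  by rewrite nth_uniq // => /eqP e; rewrite e ltnn in j'j.
- by apply/subsetP => e; rewrite inE => /mem_take; rewrite mem_s.
by move=> ic; rewrite index_uniq // => e; rewrite ffunE e.
Qed.

Lemma take_all_set : [set e in take m s] = E.
Proof. by rewrite -sizeE take_size; apply/setP => e; rewrite inE mem_s. Qed.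

Lemma state_after_pass d i : i <= 5 * r ->
  state_after d (i * m.+1) = mid (xi d) i set0.
Proof.
elim: i => [_|i IHi ir].
  rewrite mul0n /mid /= /st0 cards0; congr (_, _, _); apply: val_inj; by rewrite /= inordK.
have -> : i.+1 * m.+1 = (i * m.+1 + m).+1 by lia.
rewrite [LHS]/= (state_after_edges ir (IHi (ltnW ir)) (leqnn m)).
by rewrite (nth_tape sG) // ltnn take_all_set (next_mid_end b a sG r_gt1).
Qed.

Lemma output_sampling d :
  output d = ((result n r lam g0 a (outcome G b a (xi d)))%:R)%R :> R.
Proof.
rewrite (output_machine (encode_inj nl)) (size_tape sG) state_after_pass //.
rewrite /read; congr (_%:R)%R; apply: eq_result => g i.
rewrite -outcome_traj //; apply: eq_outcome_of => id.
have h4 : 4 * r < 5 * r by rewrite ltn_pmul2r // ltnW.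
by rewrite /mid h4 (gtn_eqF (leq_ltn_trans (leq0n _) h4)) /= ffunE packK.
Qed.

Lemma space_sampling :
  space_bits sampling_alg (5 * r) s <= head_width r l +
    (gm * k * (1 + k * (found_cap r b a * (r.+1 * r ^ r))) * (2 * cap0 r G g0 + 2)) *
    entry_width r gm k l.
Proof.
apply: space_machine; first exact: (encode_inj nl).
move=> d t; rewrite (size_tape sG) => tl.
apply: leq_trans (size_encode l _) _; rewrite leq_add2l leq_mul2r; apply/orP; right.
have [i [Q [QE ->]]] : exists i (Q : {set {set 'I_n}}), Q \subset E /\ state_after d t = mid (xi d) i Q.
  have [i5|i5] := leqP (5 * r) (t %/ m.+1).
    exists (5 * r), set0; split; first exact: sub0set.
    rewrite -state_after_pass //; congr state_after; apply/eqP; rewrite eqn_leq tl /=.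
    by apply: leq_trans (leq_trunc_div t m.+1); rewrite leq_mul2r i5 orbT.
  exists (t %/ m.+1), [set e in take (t %% m.+1) s]; split.
    by apply/subsetP => e; rewrite inE => /mem_take; rewrite mem_s.
  rewrite -state_after_edges -?divn_eq //; first exact: state_after_pass (ltnW i5).
  by rewrite -ltnS ltn_pmod.
exact: mid_total.
Qed.

End Correctness.

(** * Exact counting by storing the whole graph *)

Section StoreAll.
Variables (R : realType) (n r l : nat).
Notation Pairs := {set 'I_n * 'I_n}.
Hypothesis nl : n < 2 ^ l.

(** Ordered pairs are stored because a pair has a code of about [2 * l] bits, while codes for
    arbitrary vertex sets have [n] bits. *)
Definition add_edge (Q : Pairs) (o : option {set 'I_n}) (_ : 'I_1) : Pairs :=
  [set p | (p \in Q) || (o == Some [set p.1; p.2])].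

Definition count_cliques (Q : Pairs) : R :=
  (#|[set K : {set 'I_n} | (#|K| == r) &&
     [forall x in K, forall y in K, (x != y) ==> ((x, y) \in Q)]]|%:R)%R.

Let pair_width := (2 * l).+1.

Lemma card_pairs : #|{: 'I_n * 'I_n}| <= 2 ^ pair_width.
Proof.
rewrite card_prod !card_ord expnS; apply: leq_trans (ltnW (NN_lt nl)) _.
by rewrite leq_pmull.
Qed.

Definition encode_pairs (Q : Pairs) : seq bool :=
  flatten (map (code pair_width) (enum Q)).

Lemma encode_pairs_inj : injective encode_pairs.
Proof.
move=> Q Q' /(flatten_code_inj card_pairs isT) e.
by apply/setP => p; rewrite -mem_enum e mem_enum.
Qed.

Lemma card_I1_gt0 : 0 < #|'I_1|.
Proof. by rewrite card_ord. Qed.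

Definition exact_alg : stream_alg R n :=
  machine_alg (set0 : Pairs) add_edge count_cliques encode_pairs card_I1_gt0.

Variables (G : graph n) (s : seq {set 'I_n}).
Hypothesis sG : streams s G.
Hypothesis r_gt0 : 0 < r.
Implicit Types d : draws exact_alg (5 * r) s.

Lemma state_after_exact d t : t <= size (tape (5 * r) s) ->
  state_after d t = [set p | Some [set p.1; p.2] \in take t (tape (5 * r) s)].
Proof.
elim: t => [_|t IHt lt]; first by rewrite take0; apply/setP => p; rewrite !inE.
rewrite [LHS]/= IHt ?(ltnW lt) // (take_nth None) //.
by apply/setP => p; rewrite !inE mem_rcons in_cons orbC eq_sym.
Qed.

Lemma mem_tape k e : 0 < k -> (Some e \in tape k s) = (e \in edges G).
Proof.
rewrite -[RHS]mem_enum -(perm_mem sG); case: k => // k _; rewrite /tape.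
have h : (Some e \in rcons (map some s) None) = (e \in s).
  by rewrite mem_rcons inE /= mem_map // => x y [].
elim: k => [|k IHk]; first by rewrite /= cats0 h.
rewrite [nseq _ _]/= [flatten _]/= mem_cat [X in _ || X]IHk h.
by rewrite orbb.
Qed.

Lemma output_exact d : output d = ((num_cliques G r)%:R)%R :> R.
Proof.
rewrite (output_machine encode_pairs_inj) state_after_exact // take_size.
rewrite /count_cliques /num_cliques; congr (_%:R)%R; apply: eq_card => K.
rewrite !in_set; congr (_ && _); apply: eq_forallb => x; congr (_ ==> _).
apply: eq_forallb => y; congr (_ ==> _); congr (_ ==> _).
by rewrite in_set mem_tape // muln_gt0.
Qed.

Lemma space_exact : space_bits exact_alg (5 * r) s <= 4 * #|edges G| * (2 * l).+1.
Proof.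
apply: space_machine => [|d t lt]; first exact: encode_pairs_inj.
rewrite size_flatten_code leq_mul2r -cardE (state_after_exact _ lt); apply/orP; right.
apply: (@leq_trans #|\bigcup_(e in edges G) setX e e|).
  apply: subset_leq_card; apply/subsetP => -[x y]; rewrite inE /= => /mem_take.
  rewrite mem_tape ?muln_gt0 // => e; apply/bigcupP; exists [set x; y] => //.
  by rewrite in_setX set21 set22.
apply: (@leq_trans (\sum_(e in edges G) 4)); last by rewrite sum_nat_const mulnC.
apply: (@leq_trans (\sum_(e in edges G) #|setX e e|)); last first.
  by apply: leq_sum => e eE; rewrite cardsX (card_edge eE).
elim/big_rec2: _ => [|e u A _ h]; first by rewrite cards0.
by apply: leq_trans (leq_card_setU _ _) _; rewrite leq_add2l.
Qed.

End StoreAll.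

(** * Arithmetic of the space bound *)

Section Budget.
Variables (r a l : nat).
Hypothesis r_ge3 : 3 <= r.
Hypothesis a_gt1 : 1 < a.
Hypothesis l_gt0 : 0 < l.
Notation q := (r ^ r).
Notation b := (2 * a * r ^ r.+1).
Notation X := (samples r b a).
Notation F := (found_cap r b a).
(** As [m <= n * n < 2 ^ (2 * l)], this many doublings carry the guesses beyond the true count. With
    [k] copies, [2 ^ k] outweighs the product of the number of guesses, of a multiple of the number
    of chains, and of [n]. *)
Notation gm := (2 * l).
Notation k := (2 * l + l * r + 2).

Lemma cube_le : r * r * r <= q.
Proof.
rewrite (_ : r * r * r = r ^ 3); last by ring.
by rewrite leq_exp2l // ltnW.
Qed.

Lemma q_ge27 : 27 <= q.
Proof. apply: leq_trans cube_le; nia. Qed.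

(** Since [65 <= r ^ 4], the factor [65 ^ r.-1] is at most a power of [r ^ r]; numerical constants
    are absorbed by [27 <= r ^ r]. *)
Lemma samples_le : X <= a ^ 3 * q ^ 9.
Proof.
have q27 := q_ge27; have rq := cube_le.
have h65 : 65 ^ r.-1 <= q ^ 4.
  apply: (@leq_trans ((r ^ 4) ^ r)); last by rewrite -!expnM mulnC.
  apply: (@leq_trans (65 ^ r)); first by rewrite leq_exp2l // leq_pred.
  by rewrite leq_exp2r ?(ltn_trans _ r_ge3) // !expnS expn0; nia.
have hr : r ^ r.+1 <= q * q by rewrite expnS leq_mul //; nia.
have hb : b <= a * q ^ 3.
  apply: leq_trans (leq_mul (leqnn (2 * a)) hr) _.
  rewrite (_ : 2 * a * _ = a * (2 * (q * q))); last by lia.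
  by rewrite leq_mul2l (expnS q 2) leq_mul ?orbT //; lia.
have h64 : 64 <= q ^ 2 by rewrite expnS expn1; nia.
rewrite /samples.
apply: leq_trans (leq_mul (leq_mul (leq_mul h64 (leqnn (a ^ 2))) hb) h65) _.
apply: eq_leq; ring.
Qed.

Lemma found_cap_le : F <= a ^ 3 * q ^ 12.
Proof.
have q27 := q_ge27; have h128 : 128 <= q ^ 2 by rewrite expnS expn1; nia.
rewrite /found_cap.
apply: leq_trans (leq_mul (leq_mul h128 samples_le) (leqnn q)) _.
apply: eq_leq; ring.
Qed.

(** The number of live runs contributes [l ^ 3 * a ^ 3 * q ^ 17], the records per run
    [a ^ 3 * q ^ 13], the bits per record [l * q ^ 2]; one more [q] absorbs the head of the code. *)
Definition budget : nat := l ^ 4 * a ^ 6 * q ^ 33.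

Lemma k_le : k <= l * q.
Proof.
have rq : r + 4 <= q by have := cube_le; nia.
apply: leq_trans (leq_mul (leqnn l) rq); nia.
Qed.

Lemma copies_le : gm * k * (1 + k * (F * (r.+1 * q))) <= l ^ 3 * a ^ 3 * q ^ 17.
Proof.
have q27 := q_ge27; have kl := k_le.
have rq : r.+1 <= q by have := cube_le; nia.
have h : 1 + k * (F * (r.+1 * q)) <= 2 * (l * a ^ 3 * q ^ 15).
  rewrite (mul2n (l * a ^ 3 * q ^ 15)) -addnn leq_add //; first by rewrite !muln_gt0 !expn_gt0; lia.
  apply: leq_trans (leq_mul kl (leq_mul found_cap_le (leq_mul rq (leqnn q)))) _.
  by apply: eq_leq; ring.
apply: leq_trans (leq_mul (leq_mul (leqnn gm) kl) h) _.
rewrite (_ : _ * _ * _ = 4 * (l ^ 3 * a ^ 3 * q ^ 16)); last by ring.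
rewrite (_ : l ^ 3 * a ^ 3 * q ^ 17 = q * (l ^ 3 * a ^ 3 * q ^ 16)); last by ring.
by rewrite leq_mul2r; apply/orP; right; lia.
Qed.

Lemma entry_width_le : entry_width r gm k l <= l * q ^ 2.
Proof.
have rq : r * r + 4 * r <= 3 * q by have := cube_le; nia.
have q27 := q_ge27; have kl := k_le; rewrite /entry_width.
apply: (@leq_trans (l * (q * 9))); last by rewrite leq_mul2l expnS expn1 leq_mul2l; lia.
have h : l * (r * r + 4 * r) <= l * (3 * q) by rewrite leq_mul2l rq orbT.
have h2 : r * r <= l * (r * r) by rewrite leq_pmull.
have h3 : l * 27 <= l * q by rewrite leq_mul2l q27 orbT.
lia.
Qed.

Lemma head_width_le : 2 * head_width r l <= l * q ^ 2.
Proof.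
have rq : 10 * r <= 2 * q by have := cube_le; nia.
have q27 := q_ge27; rewrite /head_width.
apply: (@leq_trans (l * (q * 9))); last by rewrite leq_mul2l expnS expn1 leq_mul2l; lia.
have h : 2 * q <= l * (2 * q) by rewrite leq_pmull.
have h3 : l * 27 <= l * q by rewrite leq_mul2l q27 orbT.
lia.
Qed.

(** Everything is multiplied by [T] to avoid division. Contributions that do not shrink with the
    allowance [c] are paid by [T <= 2 * m * D]. *)
Lemma sampling_budget (c m D T : nat) :
  T <= 2 * m * D -> c * T <= 256 * r ^ 2 * m * X * D ->
  (head_width r l + (gm * k * (1 + k * (F * (r.+1 * q)))) * (2 * c + 2) *
     entry_width r gm k l) * T <= m * D * budget.
Proof.
move=> Tm cT.
have q27 := q_ge27.
have h : (2 * c + 2) * T <= m * D * (a ^ 3 * q ^ 13).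
  apply: (@leq_trans (m * D * (512 * r ^ 2 * X + 4))); first by nia.
  rewrite leq_mul2l; apply/orP; right.
  have rq : r ^ 2 <= q by have := cube_le; rewrite expnS expn1; nia.
  have hq : 512 <= q ^ 2 by rewrite expnS expn1; nia.
  have h1 : 512 * r ^ 2 * X <= a ^ 3 * q ^ 12.
    by apply: leq_trans (leq_mul (leq_mul hq rq) samples_le) _; apply: eq_leq; ring.
  have h2 : 0 < a ^ 3 * q ^ 12 by rewrite muln_gt0 !expn_gt0; lia.
  have -> : a ^ 3 * q ^ 13 = a ^ 3 * q ^ 12 * q by ring.
  by move: (a ^ 3 * q ^ 12) h1 h2 => u h1 h2; nia.
rewrite mulnDl.
have hH : head_width r l * T <= m * D * (l * q ^ 2).
  by apply: (@leq_trans (2 * head_width r l * (m * D))); [nia | rewrite mulnC leq_mul // head_width_le].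
have hU := leq_mul (leq_mul copies_le h) entry_width_le.
set U := gm * k * _ in hU *.
rewrite (_ : U * _ * _ * T = U * ((2 * c + 2) * T) * entry_width r gm k l); last by ring.
apply: leq_trans (leq_add hH hU) _.
rewrite (_ : _ + _ = m * D * (l * q ^ 2 + l ^ 4 * a ^ 6 * q ^ 32)); last by ring.
rewrite leq_mul2l; apply/orP; right.
have h1 : l * q ^ 2 <= l ^ 4 * a ^ 6 * q ^ 32.
  rewrite (_ : l ^ 4 * a ^ 6 * q ^ 32 = l * q ^ 2 * (l ^ 3 * a ^ 6 * q ^ 30)); last by ring.
  by rewrite leq_pmulr // !muln_gt0 !expn_gt0; lia.
rewrite /budget (_ : l ^ 4 * a ^ 6 * q ^ 33 = l ^ 4 * a ^ 6 * q ^ 32 * q); last by ring.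
apply: leq_trans (leq_add h1 (leqnn _)) _.
by rewrite addnn -mul2n mulnC leq_mul2l; apply/orP; right; lia.
Qed.

Lemma exact_budget (m D T : nat) :
  T <= X * D -> 4 * m * (2 * l).+1 * T <= m * D * budget.
Proof.
move=> TX; have q27 := q_ge27.
apply: leq_trans (leq_mul (leqnn _) TX) _.
apply: (@leq_trans (m * D * (12 * l * (a ^ 3 * q ^ 9)))).
  rewrite (_ : _ * _ * (X * D) = m * D * (4 * (2 * l).+1 * X)); last by ring.
  rewrite leq_mul2l leq_mul ?orbT ?samples_le //; lia.
rewrite leq_mul2l; apply/orP; right.
apply: leq_trans (leq_mul (leq_mul (_ : 12 <= q) (leqnn l)) (leqnn _)) _; first by lia.
rewrite /budget (_ : l ^ 4 * _ * _ = q * l * (a ^ 3 * q ^ 9) * (l ^ 3 * a ^ 3 * q ^ 23)); last by ring.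
by rewrite leq_pmulr // !muln_gt0 !expn_gt0; lia.
Qed.

End Budget.

(** * Choice of parameters and conclusion *)

Local Open Scope ring_scope.

(** The largest ratio allowed by [close] is [(a + 2) / (a - 2)], which exceeds 1 by
    [4 / (a - 2)]. *)
Lemma close_approx (R : realType) n r (G : graph n) a N0 (eps : R) :
  (2 < a)%N -> 4 <= eps * (a%:R - 2) -> close r G a N0 ->
  approx eps (num_cliques G r) N0%:R.
Proof.
rewrite /close /approx; move: (num_cliques G r) => N a2 ea /andP[].
rewrite -!(ler_nat R) !natrD !natrM.
have a2' : 2 < a%:R :> R by rewrite ltr_nat.
have a_gt2 : 0 < a%:R - 2 :> R by lra.
have N_ge0 : 0 <= N%:R :> R by [].
have N0_ge0 : 0 <= N0%:R :> R by [].
move: a%:R N%:R N0%:R ea a2' a_gt2 N_ge0 N0_ge0 => u v w ea u2 u2' v0 w0 h1 h2.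
have hv : 4 * v <= eps * (u - 2) * v by rewrite ler_wpM2r.
have e0 : 0 <= eps by rewrite -(pmulr_lge0 _ u2'); lra.
apply/andP; split.
  by rewrite -(ler_pM2l (_ : 0 < u + 2)); nra.
by rewrite -(ler_pM2l u2'); nra.
Qed.

Lemma success_sure (R : realType) n (A : stream_alg R n) k s (good : pred R) :
  (forall w : draws A k s, good (output w)) -> success_prob A k s good = 1.
Proof.
move=> gd; rewrite /success_prob (_ : [set w | _] = setT); last first.
  by apply/setP => w; rewrite !inE gd.
rewrite cardsT divff // pnatr_eq0 -lt0n; apply/card_gt0P.
by exists [tuple of nseq _ ord0].
Qed.

Definition log_width (n : nat) : nat := (trunc_log 2 n).+1.

Lemma lt_exp_log_width n : (n < 2 ^ log_width n)%N.
Proof. exact: trunc_log_ltn. Qed.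

Lemma log_width_le (R : realType) n : (0 < n)%N ->
  (log_width n)%:R <= 2 * ln n%:R + 1 :> R.
Proof.
move=> n0; have /andP[lo _] := trunc_log_bounds (isT : (1 < 2)%N) n0.
(* From [expR (- 2^-1) >= 1 - 2^-1] follows [expR (2^-1) <= 2]. *)
have ln2 : 2^-1 <= ln 2%:R :> R.
  rewrite -ler_expR lnK ?posrE //.
  have e0 := expR_gt0 (2^-1 : R).
  have h : expR (- 2^-1) >= 1 - 2^-1 :> R by exact: expR_ge1Dx.
  have h2 : expR (- 2^-1) * expR (2^-1) = 1 :> R by rewrite -expRD addNr expR0.
  by move: (expR _) (expR _) e0 h h2 => u v e0 h h2; nra.
have : ln (2 ^ trunc_log 2 n)%:R <= ln n%:R :> R.
  by rewrite ler_ln ?posrE ?ltr0n ?expn_gt0 // ler_nat.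
rewrite natrX lnXn // /log_width -[_.+1]addn1 natrD => h; rewrite -[ln _ *+ _]mulr_natr in h.
have := ler_wpM2r (ler0n R (trunc_log 2 n)) ln2.
by move: h; lra.
Qed.

Section Final.
Variables (R : realType) (r a : nat).
Hypothesis r_ge3 : (3 <= r)%N.
Hypothesis a_gt2 : (2 < a)%N.
Let b := (2 * a * r ^ r.+1)%N.
Let X := samples r b a.

Definition unit_size (lam : nat) : nat := (X * lam ^ (r - 2))%N.

(* Below [unit_size lam] there are too few cliques to sample, but then storing
   the whole graph is within the space bound. *)
Definition clique_alg (n lam T : nat) : stream_alg R n :=
  let l := log_width n in
  if [&& 0 < lam, 0 < T & unit_size lam <= T]%N then
    sampling_alg R n r lam (trunc_log 2 (T %/ unit_size lam)) (2 * l)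
      (2 * l + l * r + 2) b a l
  else exact_alg R n r l.

Variables (n : nat) (G : graph n) (s : seq {set 'I_n}) (T : nat).
Hypothesis sG : streams s G.
Hypothesis T_le : (T <= num_cliques G r)%N.
Notation lam := (degeneracy G).
Notation m := #|edges G|.
Notation l := (log_width n).
Notation D := (lam ^ (r - 2))%N.

Let r_gt1 : (1 < r)%N. Proof. exact: ltnW. Qed.

Lemma num_cliques_bound : (num_cliques G r <= 2 * m * D)%N.
Proof.
by have [out [out_lam out_ord]] := degeneracy_orientation G; exact: num_cliques_le out_ord.
Qed.

Lemma unit_size_gt0 : (0 < lam)%N -> (0 < unit_size lam)%N.
Proof. by move=> lam0; rewrite /unit_size /X /samples /b !muln_gt0 !expn_gt0; lia. Qed.

Lemma guess_bounds : (0 < lam)%N -> (unit_size lam <= T)%N ->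
  let g0 := trunc_log 2 (T %/ unit_size lam) in
  (2 ^ g0 * unit_size lam <= T < 2 * 2 ^ g0 * unit_size lam)%N.
Proof.
move=> lam0 uT /=; have u0 := unit_size_gt0 lam0.
have q0 : (0 < T %/ unit_size lam)%N by rewrite divn_gt0.
have /andP[lo hi] := trunc_log_bounds (isT : (1 < 2)%N) q0.
by rewrite -leq_divRL // lo -expnS -ltn_divLR.
Qed.

Lemma success_clique_alg (eps : R) : 0 < eps -> 4 <= eps * (a%:R - 2) ->
  1 - n%:R `^ (- 1) <= success_prob (clique_alg n lam T) (5 * r) s (approx eps (num_cliques G r)).
Proof.
move=> eps0 ea; rewrite /clique_alg; case: ifP => [/and3P[lam0 T0 uT]|_]; last first.
  rewrite success_sure => [|w]; first by rewrite gerBl powR_ge0.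
  rewrite (output_exact (lt_exp_log_width n) sG (ltnW r_gt1)) /approx.
  have : 0 <= (num_cliques G r)%:R :> R by [].
  by move: (_%:R) => N N0; apply/andP; split; nra.
set g0 := trunc_log 2 _.
pose P (om : {ffun Id n r (2 * l) (2 * l + l * r + 2) * r.-bseq 'I_n ->
    'I_(width lam g0 (2 * l)).+1}) := close r G a (result n r lam g0 a (outcome G b a om)).
apply: (@le_trans _ _ (Pr R P)); last first.
  apply: (@success_coins R n _ _ _ _ (@next n r lam g0 (2 * l) (2 * l + l * r + 2) b a)
    _ (encode l) (Om_gt0 _ _) _ _ _ (pos_lt sG r_gt1) _ P) => d.
  rewrite (output_sampling (lt_exp_log_width n) sG r_gt1).
  exact: close_approx.
have N0 : (0 < num_cliques G r)%N by apply: leq_trans T_le.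
have m0 : (0 < m)%N.
  by have := leq_trans N0 num_cliques_bound; rewrite !muln_gt0 => /andP[].
have /andP[g0lo g0hi] := guess_bounds lam0 uT; rewrite -/g0 in g0lo g0hi.
have mn := card_edges_le G; have nn := NN_lt (lt_exp_log_width n).
have n0 : (0 < n)%N by have := leq_trans m0 mn; rewrite muln_gt0 andbb.
have Nwin : (samples r b a * (2 ^ g0 * D) <= num_cliques G r
    < samples r b a * (2 ^ (g0 + 2 * l) * D))%N.
  rewrite mulnCA; apply/andP; split; first exact: leq_trans T_le.
  apply: leq_ltn_trans num_cliques_bound _.
  rewrite mulnA ltn_pmul2r ?expn_gt0 ?lam0 // expnD mulnA.
  have X2 : (2 <= samples r b a * 2 ^ g0)%N.
    rewrite /samples -!mulnA; apply: (@leq_mul 2 1) => //.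
    by rewrite /b !muln_gt0 !expn_gt0; lia.
  have := leq_ltn_trans mn nn; move: (2 ^ (2 * l))%N (samples r b a * 2 ^ g0)%N X2 => u v.
  by clear; nia.
have := Pr_result R (2 * l + l * r + 2) lam0 (erefl lam) r_gt1 (ltnW a_gt2) m0
  (leqnn b) (isT : (0 < 2 * l)%N) Nwin.
rewrite (Pr_compl R P (Om_gt0 _ _)).
set p := Pr R P; set u := (_%:R); move=> h.
suff : u / 2 ^+ (2 * l + l * r + 2) <= n%:R^-1 by rewrite powR_inv1 //; lra.
rewrite ler_pdivrMr ?exprn_gt0 // mulrC ler_pdivlMr ?ltr0n // /u -natrX -natrM ler_nat.
have ch := card_chains_type r (lt_exp_log_width n).
apply: leq_trans (leq_mul (leq_mul (leqnn _) (_ : _ <= 4 * 2 ^ (l * r))%N)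
  (ltnW (lt_exp_log_width n))) _.
  by have := expn_gt0 2 (l * r); lia.
have ll : (2 * l <= 2 ^ l)%N by rewrite /log_width expnS leq_mul2l; exact: ltn_expl.
apply: leq_trans (leq_mul (leq_mul ll (leqnn _)) (leqnn _)) _.
(* The exponents of [2 * l], of the chain count and of [n] add up to exactly [k]. *)
rewrite (_ : 4 = 2 ^ 2)%N // -!expnD leq_exp2l //; lia.
Qed.

Lemma space_clique_alg : (0 < T)%N ->
  (space_bits (clique_alg n lam T) (5 * r) s * T <= m * D * budget r a l)%N.
Proof.
move=> T0; have TD := leq_trans T_le num_cliques_bound.
have lam0 : (0 < lam)%N.
  have := leq_trans T0 TD; rewrite !muln_gt0 expn_gt0 => /andP[_ /orP[//|/eqP]]; lia.
have a1 := ltnW a_gt2; have l0 : (0 < l)%N by [].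
rewrite /clique_alg lam0 T0 /=; case: (leqP (unit_size lam) T) => [uT|/ltnW uT].
  apply: leq_trans (leq_mul (@space_sampling R n r lam _ (2 * l) (2 * l + l * r + 2) b a l
    (lt_exp_log_width n) _ _ sG r_gt1) (leqnn T)) _.
  apply: sampling_budget => //; have /andP[_ /ltnW hi] := guess_bounds lam0 uT.
  have := leq_trunc_div (128 * r ^ 2 * m) (2 ^ trunc_log 2 (T %/ unit_size lam)).
  rewrite -/(cap0 r G _) /unit_size -/X -/b -/X in hi *.
  move: (cap0 _ _ _) (2 ^ trunc_log 2 _)%N hi => c p hi hc.
  have := leq_mul (leqnn c) hi; have := leq_mul hc (leqnn (2 * (X * D))); clearbody X.
  move: (r ^ 2)%N => rr; move: D #|_| => d e; clear; lia.
apply: leq_trans (leq_mul (space_exact R (lt_exp_log_width n) sG (ltnW r_gt1)) (leqnn T)) _.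
exact: exact_budget.
Qed.

End Final.

Section SpacePolynomial.
Import (canonicals) mpoly.

(** [budget] with [log_width n] replaced by [2 * ln n + 1] and [a] by [4 / eps + 3]. *)
Definition space_poly (R : realType) : mpoly.mpoly 3 R :=
  let x (i : 'I_3) := mpoly.mpolyX R (mpoly.mnm1 i) in
  let c := @mpoly.mpolyC 3 R in
  (c 2 * x (inord 0) + 1) ^+ 4 * (c 4 * x (inord 1) + c 3) ^+ 6 * x (inord 2) ^+ 33.

Lemma meval_space_poly (R : realType) (x y z : R) :
  mpoly.meval (tnth [tuple x; y; z]) (space_poly R) =
  (2 * x + 1) ^+ 4 * (4 * y + 3) ^+ 6 * z ^+ 33.
Proof.
rewrite /space_poly !(mpoly.mevalM, rmorphXn, mpoly.mevalD, mpoly.mevalC, mpoly.mevalXU, rmorph1) /=.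
by rewrite !(tnth_nth 0) !inordK.
Qed.

End SpacePolynomial.

Theorem theorem2 (R : realType) :
  exists (C : R) (P : mpoly.mpoly 3 R), 0 < C /\
  forall (eps : R) (r : nat), 0 < eps -> (3 <= r)%N ->
  exists A : forall n lambda T : nat, stream_alg R n,
  forall (n : nat) (G : graph n) (s : seq {set 'I_n}) (T : nat),
    streams s G -> (T <= num_cliques G r)%N ->
    let m := #|edges G| in
    let lambda := degeneracy G in
    let alg := A n lambda T in
    success_prob alg (5 * r) s (approx eps (num_cliques G r))
      >= 1 - n%:R `^ (- C) /\
    ((0 < T)%N ->
     (space_bits alg (5 * r) s)%:R <=
       (m * lambda ^ (r - 2))%:R / T%:R *
       mpoly.meval (tnth [tuple ln (n%:R : R); eps^-1; (r ^ r)%:R]) P).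
Proof.
exists 1, (space_poly R); split=> // eps r eps0 r3.
have x0 : 0 <= 4 * eps^-1 :> R by rewrite mulr_ge0 // invr_ge0 ltW.
(* Truncation loses less than 1, so adding 3 gives both [2 < a] and [4 / eps <= a - 2]. *)
pose a := (Num.trunc (4 * eps^-1) + 3)%N.
have /andP[alo ahi] := Num.Theory.truncn_itv x0.
have a2 : (2 < a)%N by rewrite /a; lia.
have ea : 4 <= eps * (a%:R - 2).
  have h : 4 * eps^-1 <= a%:R - 2.
    by move: ahi; rewrite /a natrD -[_.+1]addn1 natrD; lra.
  by rewrite mulrC -ler_pdivrMr.
exists (clique_alg R r a) => n G s T sG TN /=; split.
  exact: success_clique_alg.
move=> T0; rewrite mulrAC ler_pdivlMr ?ltr0n //.
apply: le_trans (_ : (#|edges G| * degeneracy G ^ (r - 2) * budget r a (log_width n))%:R <= _).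
  by rewrite -natrM ler_nat; exact: space_clique_alg.
rewrite natrM ler_wpM2l // meval_space_poly /budget !natrM !natrX.
have n0 : (0 < n)%N.
  have N0 := leq_trans T0 TN.
  have := leq_trans N0 (num_cliques_bound r3 G); rewrite !muln_gt0 => /andP[/andP[_ m0] _].
  by have := leq_trans m0 (card_edges_le G); rewrite muln_gt0 andbb.
have lw := log_width_le R n0.
have al : a%:R <= 4 * eps^-1 + 3 by rewrite /a natrD lerD2r.
by rewrite !ler_pM ?mulr_ge0 ?exprn_ge0 ?lerXn2r ?nnegrE //; apply: le_trans al.
Qed.
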